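(* Let $a,b,q,p$ be complex parameters with $a,b,q\neq 0$ and $|p|<1$ (generic, so that no denominator below vanishes), and let $r\ge 1$ be an integer. (a) Let $l,k,n,m_1,\dots,m_r$ be integers such that $m_1\ge m_2\ge\dots\ge m_r$ and $n-l+m_i-k\ge 0$ for all $i=1,\dots,r$. Then the elliptic generating function for nonintersecting lattice paths with starting points $(l+i,k-i)$ and end points $(n,m_i)$, $i=1,\dots,r$, is $$ \begin{aligned} &\det_{1\le i,j\le r}\big(w(\mathcal P((l+j,k-j)\to(n,m_i)))\big)\\ &=q^{3\binom{r+1}3+\binom{r+2}3+r(n-l)k-(n-l)\binom{r+1}2-r^2k+\sum_{i=1}^r(i-1)m_i} \prod_{1\le i<j\le r}\theta(q^{m_i-m_j},aq^{1+n+m_i+m_j})\\ &\times\prod_{i=1}^r\frac{(q^{1+n-l-i};q,p)_{m_i-k+i}(aq^{1+n+2k-r-i};q,p)_{m_i-k+i}(aq^{1+l+2k-i};q,p)_{n-l-r}}{(q;q,p)_{m_i-k+r}(aq^{1+l+2k-i};q,p)_{m_i-k+i}(aq^{1+l+i};q,p)_{n-l-i}}\\ &\times\prod_{i=1}^r\frac{(bq^{2+n+k+l-i};q,p)_{m_i-k+i}(bq^{1+2l+2i};q,p)_{2n-2l-2i}}{(bq^{1+2n+k-i};q,p)_{m_i-k+i}(bq^{1+2l+k+i};q,p)_{2n-2l-2i}}\\ &\times\prod_{i=1}^r\frac{(aq^{1+k-n-i}/b;q,p)_{m_i-k+i}(aq^{1-n}/b,aq^{-n}/b;q,p)_{n-l-i}}{(aq^{k-l-i}/b;q,p)_{m_i-k+i}(aq^{1+k-n-i}/b,aq^{k-n-i}/b;q,p)_{n-l-i}}.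 \end{aligned} $$ (b) Let $l,k,m,n_1,\dots,n_r$ be integers such that $n_1\le n_2\le\dots\le n_r$ and $n_i-l+m-k\ge 0$ for all $i=1,\dots,r$. Then the elliptic generating function for nonintersecting lattice paths with starting points $(l+i,k-i)$ and end points $(n_i,m)$, $i=1,\dots,r$, is $$ \begin{aligned} &\det_{1\le i,j\le r}\big(w(\mathcal P((l+j,k-j)\to(n_i,m)))\big)\\ &=q^{2\binom{r+1}3+(l-k+1)\binom{r+1}2-rlk+\sum_{i=1}^r(k-i)n_i}\prod_{1\le i<j\le r}\theta(q^{n_j-n_i},bq^{1+m+n_i+n_j})\\ &\times\prod_{i=1}^r\frac{(q^{n_i-l};q,p)_{m-k+1}(aq^{n_i+2k-i};q,p)_{m-k+1-r+i}(aq^{l+2k};q,p)_{n_i-l-i}}{(q;q,p)_{m-k+i}(aq^{l+2k};q,p)_{m-k+1-r+i}(aq^{1+l+i};q,p)_{n_i-l-i}}\\ &\times\prod_{i=1}^r\frac{(bq^{1+n_i+k+l};q,p)_{m-k+1}(bq^{1+2l+2i};q,p)_{2n_i-2l-2i}}{(bq^{1+2n_i+k-i};q,p)_{m-k+i}(bq^{1+2l+k+i};q,p)_{2n_i-2l-2i}}\\ &\times\prod_{i=1}^r\frac{(aq^{k-n_i}/b;q,p)_{m-k+1}(aq^{1-n_i}/b,aq^{-n_i}/b;q,p)_{n_i-l-i}}{(aq^{k-l-i}/b;q,p)_{m-k+1}(aq^{k-n_i}/b;q,p)_{n_i-l+1-2i}(aq^{k-r-n_i}/b;q,p)_{n_i-l+r-2i}}.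 \end{aligned} $$ (c) Let $l,k,m,n_1,\dots,n_r$ be integers such that $n_1\le n_2\le\dots\le n_r$ and $m-l-k\ge 0$. Then the elliptic generating function for nonintersecting lattice paths with starting points $(l+i,k-i)$ and end points $(n_i,m-n_i)$, $i=1,\dots,r$, is $$ \begin{aligned} &\det_{1\le i,j\le r}\big(w(\mathcal P((l+j,k-j)\to(n_i,m-n_i)))\big)\\ &=q^{2\binom{r+1}3+(l-k+1)\binom{r+1}2-rlk+\sum_{i=1}^r(k-i)n_i}\prod_{1\le i<j\le r}\theta(q^{n_j-n_i},aq^{m-n_i-n_j}/b)\\ &\times\prod_{i=1}^r\frac{(q^{n_i-l};q,p)_{m-n_i-k+i}(aq^{n_i+2k-i};q,p)_{m-n_i-k+1}(aq^{l+2k};q,p)_{n_i-l-i}}{(q;q,p)_{m-n_i-k+r}(aq^{l+2k};q,p)_{m-n_i-k+1}(aq^{1+l+i};q,p)_{n_i-l-i}}\\ &\times\prod_{i=1}^r\frac{(bq^{1+n_i+k+l};q,p)_{m-n_i-k+i}(bq^{1+2l+2i};q,p)_{2n_i-2l-2i}}{(bq^{1+2n_i+k-i};q,p)_{m-n_i-k+i}(bq^{1+2l+k+i};q,p)_{2n_i-2l-2i}}\\ &\times\prod_{i=1}^r\frac{(aq^{1+k-n_i-i}/b;q,p)_{m-n_i-k+i}}{(aq^{k-l-i}/b;q,p)_{m-n_i-k+i}}\\ &\times\prod_{i=1}^r\frac{(aq^{1-n_i}/b,aq^{-n_i}/b;q,p)_{n_i-l-i}}{(aq^{1+k-n_i-i}/b;q,p)_{n_i-l-i}(aq^{k-r-n_i}/b;q,p)_{n_i-l+r-2i}}.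 \end{aligned} $$ (d) Let $l,n,m,k_1,\dots,k_r$ be integers such that $k_1\ge k_2\ge\dots\ge k_r$ and $n-l+m-k_i\ge 0$ for all $i=1,\dots,r$. Then the elliptic generating function for nonintersecting lattice paths with starting points $(l,k_i)$ and end points $(n+i,m-i)$, $i=1,\dots,r$, is $$ \begin{aligned} &\det_{1\le i,j\le r}\big(w(\mathcal P((l,k_j)\to(n+i,m-i)))\big)\\ &=q^{\sum_{i=1}^r(n-l+i)k_i}\prod_{1\le i<j\le r}\theta(q^{k_i-k_j},aq^{l+k_i+k_j})\\ &\times\prod_{i=1}^r\frac{(q^{1+n+i-l};q,p)_{m-k_i-i}(aq^{1+n+2k_i};q,p)_{m-k_i}(aq^{1+l+2k_i};q,p)_{n-l}}{(q;q,p)_{m-k_i-1}(aq^{1+l+2k_i};q,p)_{m-k_i-1}(aq^{1+l};q,p)_{n-l+i}}\\ &\times\prod_{i=1}^r\frac{(bq^{1+n+k_i+l+r};q,p)_{m-k_i-r-1+i}(bq^{1+2l};q,p)_{2n-2l+2i}}{(bq^{1+2n+k_i};q,p)_{m-k_i+i}(bq^{1+2l+k_i};q,p)_{2n-2l}}\\ &\times\prod_{i=1}^r\frac{(aq^{1+k_i-n}/b;q,p)_{m-k_i-i-1}(aq^{1-n-i}/b,aq^{-n-i}/b;q,p)_{n-l+i}}{(aq^{1+k_i-l}/b;q,p)_{m-k_i-i}(aq^{1+k_i-n}/b;q,p)_{n-l}(aq^{k_i-r-n}/b;q,p)_{n-l+r}}. \end{aligned} $$ (e) Let $k,n,m,l_1,\dots,l_r$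 be integers such that $l_1\le l_2\le\dots\le l_r$ and $n-l_i+m-k\ge 0$ for all $i=1,\dots,r$. Then the elliptic generating function for nonintersecting lattice paths with starting points $(l_i,k)$ and end points $(n+i,m-i)$, $i=1,\dots,r$, is $$ \begin{aligned} &\det_{1\le i,j\le r}\big(w(\mathcal P((l_j,k)\to(n+i,m-i)))\big)\\ &=q^{(n+r+k)\binom r2+(n+1)rk-\sum_{i=1}^r(k+i-1)l_i}\prod_{1\le i<j\le r}\theta(q^{l_j-l_i},bq^{k+l_i+l_j})\\ &\times\prod_{i=1}^r\frac{(q^{1+n+r-l_i};q,p)_{m-k-r}(aq^{1+n+2k+i};q,p)_{m-k-1}(aq^{1+l_i+2k};q,p)_{n+i-l_i}}{(q;q,p)_{m-k-i}(aq^{1+l_i+2k};q,p)_{m-k-1}(aq^{1+l_i};q,p)_{n+i-l_i}}\\ &\times\prod_{i=1}^r\frac{(bq^{1+n+k+r+l_i};q,p)_{m-k-r}(bq^{1+2l_i};q,p)_{2n+2i-2l_i}}{(bq^{1+2n+k+2i};q,p)_{m-k-i}(bq^{1+k+2l_i};q,p)_{2n+2i-2l_i}}\\ &\times\prod_{i=1}^r\frac{(aq^{1+k-n-i}/b;q,p)_{m-k-1}(aq^{1-n-i}/b,aq^{-n-i}/b;q,p)_{n+i-l_i}}{(aq^{1+k-l_i}/b;q,p)_{m-k-1}(aq^{1+k-n-i}/b,aq^{k-n-i}/b;q,p)_{n+i-l_i}}. \end{aligned} $$ (f) Let $k,n,m,l_1,\dots,l_r$ be integers such that $l_1\le l_2\le\dots\le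 l_r$ and $n+m-k\ge 0$. Then the elliptic generating function for nonintersecting lattice paths with starting points $(l_i,k-l_i)$ and end points $(n+i,m-i)$, $i=1,\dots,r$, is $$ \begin{aligned} &\det_{1\le i,j\le r}\big(w(\mathcal P((l_j,k-l_j)\to(n+i,m-i)))\big)\\ &=q^{k\binom{r+1}2+rnk-\sum_{i=1}^r(n+k+i-l_i)l_i}\prod_{1\le i<j\le r}\theta(q^{l_j-l_i},aq^{k-l_i-l_j}/b)\\ &\times\prod_{i=1}^r\frac{(q^{1+n+r-l_i};q,p)_{m-k-r+l_i+i-1}(aq^{1+n+2k-2l_i};q,p)_{m-k+l_i}(aq^{1+2k-l_i};q,p)_{n-l_i}}{(q;q,p)_{m-k+l_i-1}(aq^{1+2k-l_i};q,p)_{m-k+l_i-i}(aq^{1+l_i};q,p)_{n+i-l_i}}\\ &\times\prod_{i=1}^r\frac{(bq^{1+n+k+i};q,p)_{m-k+l_i-i}(bq^{1+2l_i};q,p)_{2n+2i-2l_i}}{(bq^{1+2n+k-l_i};q,p)_{m-k+l_i+i}(bq^{1+k+l_i};q,p)_{2n-2l_i}}\\ &\times\prod_{i=1}^r\frac{(aq^{1+k-n-l_i}/b;q,p)_{m-k+l_i-i-1}}{(aq^{1+k-2l_i}/b;q,p)_{m-k+l_i-1}}\\ &\times\prod_{i=1}^r\frac{(aq^{1-n-i}/b,aq^{-n-i}/b;q,p)_{n+i-l_i}}{(aq^{1+k-n-l_i}/b;q,p)_{n-l_i}(aq^{k-n-r-l_i}/b;q,p)_{n+r-l_i}}. \end{aligned}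 $$ In each part the assertion is that the generating function $w(\mathcal P_+(\mathbf u\to\mathbf v))$, for the indicated tuples $\mathbf u$ of starting points and $\mathbf v$ of end points, equals the displayed determinant, which equals the displayed product.
   Context: Theta functions: for $x\ne0$, $|p|<1$, $\theta(x)=\theta(x;p):=(x;p)_\infty(p/x;p)_\infty$ with $(x;p)_\infty=\prod_{k=0}^\infty(1-xp^k)$, and $\theta(x_1,\dots,x_s)=\prod_{i=1}^s\theta(x_i)$. Theta shifted factorials: for every integer $n$, $(a;q,p)_n=\prod_{k=0}^{n-1}\theta(aq^k)$ if $n\ge1$, $(a;q,p)_0=1$, and $(a;q,p)_n=1/\prod_{k=0}^{-n-1}\theta(aq^{n+k})$ if $n\le-1$; and $(a_1,\dots,a_s;q,p)_n=\prod_{i=1}^s(a_i;q,p)_n$. (A factor $1/(q;q,p)_{n}$ with $n<0$ is a product of theta values containing $\theta(1)=0$, hence equals $0$.) Lattice paths: paths in $\mathbb Z^2$ consisting of unit horizontal steps $(x-1,y)\to(x,y)$ and unit vertical steps $(x,y-1)\to(x,y)$ in the positive direction; the path with no steps from a point to itself is allowed. $\mathcal P(u\to v)$ is the (finite, possibly empty) set of all lattice paths from $u$ to $v$. For $r$-tuples of points $\mathbf u=(u_1,\dots,u_r)$, $\mathbf v=(v_1,\dots,v_r)$, $\mathcal P_+(\mathbf u\to\mathbf v)$ is the set of all $r$-tuples $(P_1,\dots,P_r)$ of paths, $P_i$ running from $u_i$ to $v_i$, which are nonintersecting, i.e. no two of the paths have a lattice point in common. Weights: the horizontal edge $(n-1,m)\to(n,m)$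 has the elliptic weight $$w(n,m)=w(n,m;a,b;q,p):=\frac{\theta(aq^{n+2m},bq^{2n},bq^{2n-1},aq^{1-n}/b,aq^{-n}/b)}{\theta(aq^n,bq^{2n+m},bq^{2n+m-1},aq^{1+m-n}/b,aq^{m-n}/b)}\,q^m .$$ The weight $w(P)$ of a path $P$ is the product of the weights of its horizontal steps (empty product $=1$); the weight of an $r$-tuple of paths is the product of the weights of its members. For a finite set $\mathcal M$ of paths or of tuples of paths, $w(\mathcal M):=\sum_{x\in\mathcal M}w(x)$ (so $w(\emptyset)=0$); this is the elliptic generating function of $\mathcal M$.
   Formalization: In (e) the exponent of q carries an additional term −C(r,3), since the printed exponent makes the formula false for r≥3 (e.g. r=3, k=n=0, m=3, l=(1,2,3): the determinant is 1 but the printed product is q). *)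

(* Defs.v *)
From mathcomp Require Import all_boot all_order all_algebra.
From mathcomp Require Import complex.
From mathcomp Require Import all_classical all_reals all_analysis.

Set Implicit Arguments.
Unset Strict Implicit.
Unset Printing Implicit Defensive.
Import Order.TTheory GRing.Theory Num.Theory numFieldNormedType.Exports.
Local Open Scope classical_set_scope.
Local Open Scope ring_scope.

Section Theta.
Variable C : numFieldType.
Implicit Types (p q x : C) (xs : seq C) (n : int).

Definition pochinf x p : C :=
  limn (fun N : nat => \prod_(0 <= k < N) (1 - x * p ^+ k) : C).

Definition theta1 p x : C := pochinf x p * pochinf (p / x) p.

Definition theta p xs : C := \prod_(x <- xs) theta1 p x.

(* Inversion is total with 0^-1 = 0, hence (tpoch1 q p x n)^-1 is the product of
   thetas for every n < 0; in particular (tpoch1 q p q n)^-1 = 0 for n < 0. *)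
Definition tpoch1 q p x n : C :=
  match n with
  | Posz N => \prod_(0 <= k < N) theta1 p (x * q ^+ k)
  | Negz N => (\prod_(0 <= k < N.+1) theta1 p (x * q ^ (n + k%:Z)))^-1
  end.

Definition tpoch q p xs n : C := \prod_(x <- xs) tpoch1 q p x n.

(* The integers occurring in the shifted factorials are arbitrary, so these
   are all the theta values that can occur in a denominator. *)
Definition generic (a b q p : C) : Prop :=
  [/\ forall N : int, 0 < N -> theta1 p (q ^ N) != 0,
      forall N : int, theta1 p (a * q ^ N) != 0,
      forall N : int, theta1 p (b * q ^ N) != 0
    & forall N : int, theta1 p (a * q ^ N / b) != 0].

End Theta.

Section Paths.

Definition lpoint : Type := (int * int)%type.

Definition hstep : rel lpoint := fun u v => v == (u.1 + 1, u.2).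
Definition vstep : rel lpoint := fun u v => v == (u.1, u.2 + 1).
Definition lattice_step : rel lpoint := fun u v => hstep u v || vstep u v.

(* A path is the list of all its lattice points, both end points included. *)
Definition lattice_paths (u v : lpoint) : set (seq lpoint) :=
  [set P | [/\ sorted lattice_step P, ohead P = Some u & last u P = v]].

Definition nonintersecting_paths (r : nat) (u v : 'I_r -> lpoint) :
    set {ffun 'I_r -> seq lpoint} :=
  [set P | (forall i, lattice_paths (u i) (v i) (P i)) /\
           (forall i j, i != j -> forall x, ~ (x \in P i /\ x \in P j))].

Variables (C : numFieldType) (a b q p : C).

Definition edge_weight (n m : int) : C :=
  theta p [:: a * q ^ (n + 2 * m); b * q ^ (2 * n); b * q ^ (2 * n - 1);
              a * q ^ (1 - n) / b; a * q ^ (- n) / b] /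
  theta p [:: a * q ^ n; b * q ^ (2 * n + m); b * q ^ (2 * n + m - 1);
              a * q ^ (1 + m - n) / b; a * q ^ (m - n) / b] * q ^ m.

Definition path_weight (P : seq lpoint) : C :=
  \prod_(e <- zip P (behead P) | hstep e.1 e.2) edge_weight e.2.1 e.2.2.

Definition path_gf (u v : lpoint) : C :=
  \sum_(P \in lattice_paths u v) path_weight P.

Definition nonintersecting_gf (r : nat) (u v : 'I_r -> lpoint) : C :=
  \sum_(P \in nonintersecting_paths u v) \prod_(i < r) path_weight (P i).

Definition path_det (r : nat) (u v : 'I_r -> lpoint) : C :=
  \det (\matrix_(i < r, j < r) path_gf (u j) (v i)).

End Paths.

(* One-based index: [i : 'I_r] stands for the index i+1 in {1, ..., r}. *)
Definition idx (r : nat) (i : 'I_r) : int := i.+1%:Z.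

Definition weakly_increasing (r : nat) (m : 'I_r -> int) : Prop :=
  forall i j : 'I_r, (i <= j)%N -> m i <= m j.

Definition weakly_decreasing (r : nat) (m : 'I_r -> int) : Prop :=
  forall i j : 'I_r, (i <= j)%N -> m j <= m i.

(* Main.v *)
Require Import Defs.
From mathcomp Require Import all_boot all_order all_algebra all_fingroup.
From mathcomp Require Import complex.
From mathcomp Require Import all_classical all_reals all_analysis.
From mathcomp Require Import ring lra zify.
Import Order.TTheory GRing.Theory Num.Theory numFieldNormedType.Exports.
Local Open Scope classical_set_scope.
Local Open Scope ring_scope.

(** The proof has three ingredients: the crossing of lattice paths, a product formula for
    the generating function of the paths between two points, and the evaluation of a
    determinant whose entries are products of theta functions. The last two rest on the
    addition formula for theta functions.

    Nonintersecting paths. In all six cases the starting points, and likewise the end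
    points, proceed weakly from north-west to south-east. Two paths that join them in the
    wrong order therefore have a point in common ([crossing]), and exchanging the tails after
    such a point cancels all intersecting families in the Leibniz expansion ([lgv]). This
    gives the equality of the generating function and the determinant.

    The entries. The weights are such that the generating function of the paths from (l, k)
    to (n, m) is an explicit quotient of shifted factorials ([path_gfE]), an elliptic
    binomial coefficient: the quotient satisfies the recursion given by the last step of a
    path, because after cancellation this recursion is the addition formula ([theta_four]).

    The determinants. In each case either the starting points or the end points advance
    along an antidiagonal, one step for each column j, and the factors of the entry (i, j)
    that involve both i and j telescope. Up to factors of the row and of the column, the entry is a
    product of brackets theta(c x y) theta(x / y), where x = xi_i belongs to the row and y
    runs through eta_t for t > j and through zeta_t for 1 <= t <= j. By the addition formula
    a bracket is, up to a monomial, a 2 x 2 minor formed by vectors attached to x and y. For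
    such minors the determinant equals the product of the minors of all pairs of rows, times a
    product of minors that pair the vectors of eta with those of zeta ([kdetE],
    [theta_det]); this is shown by eliminating one row with the three-term relation of
    minors. Each formula of the theorem is this evaluation for one choice of c, xi, eta and
    zeta, with the values regrouped into shifted factorials.

    The addition formula. By the Jacobi triple product, theta(x y) theta(x / y) is a double
    series. Collecting its terms according to the parity of the difference of the two
    indices turns it into a 2 x 2 determinant of series in x and in y ([cvg_wdet]), so
    that the addition formula is once more the three-term relation of minors. The triple
    product is obtained as the limit of its finite form, the q-binomial theorem
    ([jtripleE]). *)

(** * Limits of complex sequences *)

Section ComplexLimits.
Variable R : realType.
Let C : numFieldType := R[i].

(** The norm of R[i] takes its values in R[i]; this returns estimates to R. *)
Lemma norm_complexE (x : C) : exists2 r : R, 0 <= r & `|x| = r%:C%C.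
Proof.
exists (complex.Re `|x|).
  by have := normr_ge0 x; rewrite lecE => /andP[].
by apply/eqP; rewrite eq_complex /= eqxx /=; have := normr_ge0 x; rewrite lecE => /andP[].
Qed.

Lemma cvg_complex0 (u : nat -> C) (v : nat -> R) :
  (forall n, `|u n| <= (v n)%:C%C) -> v @ \oo --> 0 -> u @ \oo --> 0.
Proof.
move=> uv v0; apply/cvgrPdist_lt => e e0.
have [r r0 re] := norm_complexE e.
rewrite gtr0_norm // in re; rewrite re ltcR in e0.
move/cvgrPdist_lt: v0 => /(_ _ e0); apply: filterS => n.
rewrite !sub0r !normrN => vr.
rewrite re; apply: le_lt_trans (uv n) _; rewrite ltcR.
exact: le_lt_trans (ler_norm _) vr.
Qed.

Lemma cvg_geo0 (u : nat -> C) (K : C) (z : C) :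
  `|z| < 1 -> (forall n, `|u n| <= K * `|z| ^+ n) -> u @ \oo --> 0.
Proof.
move=> z1 uK; have [r r0 zr] := norm_complexE z.
have [k k0 Kk] := norm_complexE K.
have r1 : r < 1 by move: z1; rewrite zr -[1]/(1%:C%C) ltcR.
apply: (@cvg_complex0 _ (fun n => k * r ^+ n)); last first.
  rewrite -[0](mulr0 k); apply: cvgM; first exact: cvg_cst.
  by apply: cvg_expr; rewrite ger0_norm.
move=> n; apply: le_trans (uK n) _; rewrite rmorphM rmorphXn /= -zr -Kk.
by rewrite ler_wpM2r ?exprn_ge0 // real_ler_norm // (ger0_real _) //; 
   have := le_trans (normr_ge0 _) (uK 0%N); rewrite expr0 mulr1.
Qed.

Lemma real_cvg_geo (v : nat -> R) (k r : R) : 0 <= r < 1 ->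
  (forall n, `|v n.+1 - v n| <= k * r ^+ n) -> cvgn v.
Proof.
move=> /andP[r0 r1] vk.
have -> : v = (fun n => v 0%N + series (fun n => v n.+1 - v n) n).
  by apply/funext => n; rewrite seriesEnat /= telescope_sumr // addrC subrK.
apply: is_cvgD; first exact: is_cvg_cst.
apply: normed_cvg; apply: (@series_le_cvg _ _ (fun n => k * r ^+ n)) => //.
- by move=> n; apply: normr_ge0.
- by move=> n; apply: le_trans (vk n); apply: normr_ge0.
- by apply: (@is_cvg_geometric_series _ k); rewrite ger0_norm.
Qed.

Lemma cvg_complexD (v w : nat -> R) (lv lw : R) : v @ \oo --> lv -> w @ \oo --> lw ->
  (fun n => (v n +i* w n)%C : C) @ \oo --> ((lv +i* lw)%C : C).
Proof.
move=> vl wl; apply/cvgrPdist_lt => e e0.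
have [r r0 re] := norm_complexE e.
rewrite gtr0_norm // in re; rewrite re ltcR in e0.
have e20 : 0 < r / 2 by lra.
move/cvgrPdist_lt: vl => /(_ _ e20) vl; move/cvgrPdist_lt: wl => /(_ _ e20) wl.
move: vl wl; apply: filterS2 => n vn wn.
rewrite re.
have -> : (lv +i* lw)%C - (v n +i* w n)%C = (lv - v n)%:C%C + 'i%C * (lw - w n)%:C%C.
  by apply/eqP; rewrite eq_complex /=; apply/andP; split; apply/eqP; ring.
apply: le_lt_trans (ler_normD _ _) _; rewrite normrM.
have -> : `|'i%C| = 1 :> C by rewrite normc_def /= expr0n expr1n add0r sqrtr1.
have nR (x : R) : `|x%:C%C| = `|x|%:C%C by rewrite normc_def /= expr0n addr0 sqrtr_sqr.
by rewrite mul1r !nR -rmorphD ltcR /=; lra.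
Qed.

(** Increments bounded by a geometric sequence make the real and the imaginary part
    Cauchy, so that the completeness of R suffices. *)
Lemma complex_cvg_geo (u : nat -> C) (K z : C) : `|z| < 1 ->
  (forall n, `|u n.+1 - u n| <= K * `|z| ^+ n) -> cvgn u.
Proof.
move=> z1 uK; have [r r0 zr] := norm_complexE z.
have [k k0 Kk] := norm_complexE K.
have r1 : 0 <= r < 1 by rewrite r0; move: z1; rewrite zr -[1]/(1%:C%C) ltcR.
have uk n : `|u n.+1 - u n| <= (k * r ^+ n)%:C%C.
  apply: le_trans (uK n) _; rewrite rmorphM rmorphXn /= -zr -Kk.
  rewrite ler_wpM2r ?exprn_ge0 // real_ler_norm // (ger0_real _) //.
  by have := le_trans (normr_ge0 _) (uK 0%N); rewrite expr0 mulr1.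
have cv : cvgn (fun n => complex.Re (u n)).
  apply: (real_cvg_geo _ k r r1) => n; rewrite -lecR.
  apply: le_trans (uk n); rewrite -raddfB; exact: normc_ge_Re.
have cw : cvgn (fun n => complex.Im (u n)).
  apply: (real_cvg_geo _ k r r1) => n; rewrite -lecR.
  apply: le_trans (uk n); rewrite -raddfB /= -normrN -ReiNIm.
  apply: le_trans (normc_ge_Re _) _.
  by rewrite normrM [X in _ * X]normc_def /= expr0n expr1n add0r sqrtr1 mulr1.
apply/cvg_ex; exists ((limn (fun n => complex.Re (u n)) +i* limn (fun n => complex.Im (u n)))%C : C).
have -> : u = (fun n => (complex.Re (u n) +i* complex.Im (u n))%C : C).
  by apply/funext => n; case: (u n).
exact: cvg_complexD.
Qed.

End ComplexLimits.

(** * Infinite products and the theta function *)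

Section RealProducts.
Variable R : realType.
Implicit Types (x r : R).

Lemma geo_sum_le r (N : nat) : 0 <= r < 1 -> \sum_(0 <= k < N) r ^+ k <= (1 - r)^-1.
Proof.
move=> /andP[r0 r1]; rewrite -[leRHS]mul1r ler_pdivlMr; last by lra.
rewrite big_mkord -(opprB r 1) mulrN mulrC -subrX1 opprB gerBl.
exact: exprn_ge0.
Qed.

(** From 1 + t <= exp t the product is at most the exponential of a geometric sum. *)
Lemma prod1D_bounded x r : 0 <= x -> 0 <= r < 1 ->
  exists M : R, forall N, \prod_(0 <= k < N) (1 + x * r ^+ k) <= M.
Proof.
move=> x0 r01; have /andP[r0 r1] := r01.
exists (expR (x * (1 - r)^-1)) => N.
apply: (@le_trans _ _ (expR (x * \sum_(0 <= k < N) r ^+ k))).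
  rewrite mulr_sumr expR_sum; apply: ler_prod => k _.
  by rewrite expR_ge1Dx addr_ge0 // mulr_ge0 // exprn_ge0.
by rewrite ler_expR ler_wpM2l // geo_sum_le.
Qed.

(** Each inverse factor 1 / (1 - r^(k+1)) is at most 1 + r^k / (1 - r), hence at most
    exp (r^k / (1 - r)), and the exponents are summable. *)
Lemma prod1B_lower r : 0 <= r < 1 ->
  exists2 e : R, 0 < e & forall N, e <= \prod_(0 <= k < N) (1 - r ^+ k.+1).
Proof.
move=> r01; have /andP[r0 r1] := r01.
exists (expR (- (1 - r)^-1 * (1 - r)^-1)) => [|N]; first exact: expR_gt0.
apply: (@le_trans _ _ (expR (- (1 - r)^-1 * \sum_(0 <= k < N) r ^+ k))).
  by rewrite ler_expR ler_wnM2l ?geo_sum_le // oppr_le0 invr_ge0; lra.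
rewrite mulr_sumr expR_sum; apply: ler_prod => k _.
rewrite expR_ge0 /= mulNr expRN.
have t0 : 0 <= r ^+ k.+1 by exact: exprn_ge0.
have tr : r ^+ k.+1 <= r by rewrite exprS ler_piMr // exprn_ile1 // ltW.
have tk : r ^+ k.+1 <= r ^+ k by rewrite exprS ler_piMl ?exprn_ge0 // ltW.
have p1 : 0 < 1 - r ^+ k.+1 by lra.
rewrite -[leRHS]invrK lef_pV2 ?posrE ?expR_gt0 ?invr_gt0 //.
apply: le_trans (expR_ge1Dx _).
rewrite -[leLHS]mul1r ler_pdivrMr // -subr_ge0.
set t := r ^+ k.+1 in t0 tr tk p1 *; set w := r ^+ k in tk *.
have -> : (1 + (1 - r)^-1 * w) * (1 - t) - 1 = (1 - r)^-1 * (w * (1 - t) - (1 - r) * t) .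
  by field; lra.
rewrite mulr_ge0 ?invr_ge0; [by [] | lra|].
have : t * (1 - t) <= w * (1 - t) by rewrite ler_wpM2r //; lra.
have : (1 - r) * t <= (1 - t) * t by rewrite ler_wpM2r //; lra.
by rewrite [(1 - t) * t]mulrC; lra.
Qed.

End RealProducts.

Section Pochhammer.
Variable R : realType.
Let C : numFieldType := R[i].
Implicit Types (p q x z : C).
Variable p : C.
Hypothesis p1 : `|p| < 1.

Definition poch x N : C := \prod_(0 <= k < N) (1 - x * p ^+ k).

Lemma pochS x N : poch x N.+1 = poch x N * (1 - x * p ^+ N).
Proof. by rewrite /poch big_nat_recr. Qed.

Lemma poch_recl x N : poch x N.+1 = (1 - x) * poch (x * p) N.
Proof.
rewrite /poch big_nat_recl // expr0 mulr1; congr (_ * _).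
by apply: eq_bigr => k _; rewrite exprS mulrA.
Qed.

Lemma poch_bounded x : exists2 M : C, 0 <= M & forall N, `|poch x N| <= M.
Proof.
have [r r0 pr] := norm_complexE R p; have [y y0 xy] := norm_complexE R x.
have r01 : 0 <= r < 1 by rewrite r0; move: p1; rewrite pr -[1]/(1%:C%C) ltcR.
have [M MP] := prod1D_bounded R y r y0 r01.
exists (M%:C%C) => [|N].
  rewrite -[0]/(0%:C%C) lecR; apply: le_trans (MP 0%N).
  by rewrite big_geq.
apply: (@le_trans _ _ ((\prod_(0 <= k < N) (1 + y * r ^+ k))%:C%C)); last by rewrite lecR.
rewrite normr_prod rmorph_prod; apply: ler_prod => k _ /=; rewrite normr_ge0 /=.
apply: le_trans (ler_normB _ _) _.
by rewrite normr1 normrM normrX pr xy rmorphD rmorph1 rmorphM rmorphXn.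
Qed.

(** Keeps the denominators of the Gaussian binomial coefficients away from 0. *)
Lemma poch_lower : exists2 e : C, 0 < e & forall N, e <= `|poch p N|.
Proof.
have [r r0 pr] := norm_complexE R p.
have r01 : 0 <= r < 1 by rewrite r0; move: p1; rewrite pr -[1]/(1%:C%C) ltcR.
have /andP[_ r1] := r01.
have [e e0 eP] := prod1B_lower R r r01.
exists (e%:C%C) => [|N]; first by rewrite -[0]/(0%:C%C) ltcR.
apply: (@le_trans _ _ ((\prod_(0 <= k < N) (1 - r ^+ k.+1))%:C%C)); first by rewrite lecR.
rewrite normr_prod rmorph_prod; apply: ler_prod => k _ /=; apply/andP; split.
  rewrite -[0]/(0%:C%C) lecR subr_ge0 exprn_ile1 //; exact: ltW.
apply: le_trans _ (lerB_dist _ _).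
by rewrite normr1 -exprS normrX pr rmorphB rmorph1 rmorphXn.
Qed.

Lemma pochp_neq0 N : poch p N != 0.
Proof.
have [e e0 eP] := poch_lower.
by rewrite -normr_gt0; apply: lt_le_trans e0 (eP N).
Qed.

Lemma poch_step x : exists2 K : C, 0 <= K &
  forall N, `|poch x N.+1 - poch x N| <= K * `|p| ^+ N.
Proof.
have [M M0 MP] := poch_bounded x.
exists (M * `|x|) => [|N]; first by rewrite mulr_ge0.
rewrite pochS mulrBr mulr1 addrC addKr normrN !normrM normrX -mulrA.
by rewrite ler_wpM2r // mulr_ge0 // exprn_ge0.
Qed.

Lemma cvg_poch x : poch x N @[N --> \oo] --> pochinf x p.
Proof.
have [K K0 KP] := poch_step x.
have := @complex_cvg_geo R (poch x) K p p1 KP.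
by [].
Qed.

(** The Cauchy property of the partial products with an explicit rate: the increments
    are of order |p|^N and sum to a geometric tail. *)
Lemma poch_dist x : exists2 K : C, 0 <= K &
  forall N d, `|poch x (N + d) - poch x N| <= K * `|p| ^+ N.
Proof.
have [K K0 KP] := poch_step x.
have q0 : 0 < 1 - `|p| by rewrite subr_gt0.
exists (K / (1 - `|p|)) => [|N d]; first by rewrite divr_ge0 // ltW.
suff : `|poch x (N + d) - poch x N| <= K / (1 - `|p|) * `|p| ^+ N * (1 - `|p| ^+ d).
  move/le_trans; apply; rewrite ler_piMr //.
    by rewrite mulr_ge0 ?exprn_ge0 // divr_ge0 // ltW.
elim: d => [|d IH]; first by rewrite addn0 subrr normr0 expr0 subrr mulr0.
rewrite addnS.
have -> : poch x (N + d).+1 - poch x N =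
  (poch x (N + d).+1 - poch x (N + d)) + (poch x (N + d) - poch x N) by ring.
apply: le_trans (ler_normD _ _) _.
apply: le_trans (lerD (KP _) IH) _.
rewrite le_eqVlt; apply/orP; left; apply/eqP.
by rewrite exprD exprS; field; rewrite gt_eqF.
Qed.

Lemma cvg_theta1 x : poch x N * poch (p / x) N @[N --> \oo] --> theta1 p x.
Proof. by apply: cvgM; apply: cvg_poch. Qed.

Lemma pochinf_recl x : pochinf x p = (1 - x) * pochinf (x * p) p.
Proof.
have h1 : (fun N => poch x N.+1) @ \oo --> pochinf x p.
  by have := cvg_poch x; rewrite -(cvg_shiftS (poch x)).
have h2 : (fun N => poch x N.+1) @ \oo --> (1 - x) * pochinf (x * p) p.
  have -> : (fun N => poch x N.+1) = (fun N => (1 - x) * poch (x * p) N).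
    by apply/funext => N; rewrite poch_recl.
  by apply: cvgM; [exact: cvg_cst | exact: cvg_poch].
have hC : hausdorff_space C := @norm_hausdorff _ C.
by rewrite -[LHS](cvg_lim hC h1) -[RHS](cvg_lim hC h2).
Qed.

(** By (x;p) = (1 - x) (xp;p), both sides consist of the same infinite products up to
    the first factors 1 - 1/x and 1 - x, whose quotient is - 1/x. *)
Lemma theta1V x : x != 0 -> theta1 p x^-1 = - theta1 p x / x.
Proof.
move=> x0; rewrite /theta1 (pochinf_recl x^-1) (pochinf_recl x) invrK.
rewrite [x^-1 * p]mulrC [p * x]mulrC.
by field.
Qed.

End Pochhammer.

(** * The finite Jacobi triple product *)

Section TripleProduct.
Variable R : realType.
Let C : numFieldType := R[i].
Implicit Types (x y z : C) (k : int).
Variable s : C.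
Hypotheses (s0 : s != 0) (s1 : `|s| < 1).
Let p := s ^+ 2.

Lemma sqr_norm_lt1 : `|p| < 1.
Proof. by rewrite /p normrX expr_lt1. Qed.
Let p1 := sqr_norm_lt1.
Local Notation P := (poch R p).

(** A square root s of the nome keeps the exponents of the Jacobi series integral:
    this is the term (-1)^k p^(k(k-1)/2) z^k. *)
Definition jterm k z : C := s ^ (k * (k - 1)) * (- z) ^ k.

Lemma jtermE k z : jterm k z = s ^ (k * (k - 1)) * (- z) ^ k.
Proof. by []. Qed.

(** The Gaussian binomial coefficient of m + n over m in base p; indexing by the two
    parts makes it total. *)
Definition gauss (m n : nat) : C := P p (m + n)%N / (P p m * P p n).

Lemma gauss0n n : gauss 0 n = 1.
Proof.
rewrite /gauss add0n [X in _ / (X * _)]/poch big_geq // mul1r divff //.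
exact: pochp_neq0.
Qed.

Lemma gaussn0 n : gauss n 0 = 1.
Proof.
rewrite /gauss addn0 [X in _ / (_ * X)]/poch big_geq // mulr1 divff //.
exact: pochp_neq0.
Qed.

Lemma gauss_pascal m n :
  gauss m.+1 n.+1 = gauss m.+1 n + p ^+ n.+1 * gauss m n.+1.
Proof.
have nz N : P p N != 0 by exact: pochp_neq0.
have hm := nz m.+1; have hn := nz n.+1; have hmn := nz (m + n).+2.
rewrite /gauss !addSn !addnS !(pochS R p p (m + n).+1) !(pochS R p p m) !(pochS R p p n).
move: hm hn; rewrite !pochS !mulf_eq0 !negb_or => /andP[m0 m1] /andP[n0 n1].
rewrite -!exprS; rewrite -!exprS in m1 n1.
have -> : p ^+ (m + n).+2 = p ^+ m.+1 * p ^+ n.+1 by rewrite -exprD addSn addnS.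
by field; rewrite m0 n0 m1 n1.
Qed.

Lemma jterm0 z : jterm 0 z = 1.
Proof. by rewrite /jterm mul0r !expr0z mulr1. Qed.

Lemma jtermS k z : z != 0 -> jterm (k + 1) z = - z * s ^ (2 * k) * jterm k z.
Proof.
move=> z0; rewrite /jterm expfzDr ?oppr_eq0 // expr1z.
have -> : (k + 1) * (k + 1 - 1) = 2 * k + k * (k - 1) by ring.
by rewrite expfzDr //; ring.
Qed.

Lemma pz (n : nat) : p ^+ n = s ^ (2 * n%:Z).
Proof. by rewrite /p -exprM -exprnP. Qed.

(** Induction on L: the factor 1 - z p^L of the product combines neighbouring terms
    according to the Pascal rule. *)
Lemma qbinomial z L : z != 0 ->
  P z L = \sum_(j < L.+1) gauss j (L - j) * jterm j z.
Proof.
move=> z0; elim: L => [|L IH].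
  by rewrite big_ord1 gauss0n jterm0 mulr1 /poch big_geq.
have jS (j : nat) : jterm j.+1 z = - z * p ^+ j * jterm j z.
  by rewrite -addn1 PoszD jtermS // pz.
have e1 := IH; rewrite big_ord_recl in e1; have e2 := IH; rewrite big_ord_recr /= in e2.
rewrite pochS mulrBr mulr1 {1}e1 e2.
rewrite [in RHS]big_ord_recl [in RHS]big_ord_recr /=.
rewrite !subn0 !gauss0n !mul1r !subnn !gaussn0 !jterm0 !mul1r.
rewrite jS !mulrDl opprD -!addrA.
congr (1 + _); rewrite addrA; congr (_ + _); last by ring.
rewrite mulr_suml -sumrB; apply: eq_bigr => i _.
rewrite /bump /= !add1n.
have [d Ld] : exists d, L = (i + d.+1)%N.
  by exists (L - i.+1)%N; have := ltn_ord i; lia.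
have -> : (L.+1 - i.+1 = d.+1)%N by lia.
have -> : (L - i.+1 = d)%N by lia.
have -> : (L - i = d.+1)%N by lia.
have -> : p ^+ L = p ^+ i * p ^+ d.+1 by rewrite {1}Ld exprD.
by rewrite gauss_pascal jS; ring.
Qed.

Lemma jterm_pdiv k z : z != 0 -> jterm (k - 1) z = (- p / z) * jterm k (z / p).
Proof.
move=> z0; rewrite /jterm.
have p0 : p != 0 by rewrite expf_neq0.
have -> : - (z / p) = - z * s ^ (-2 : int).
  by rewrite /p -exprnN mulNr.
rewrite exprzMl ?unitfE ?oppr_eq0 ?expfz_neq0 // exprz_exp.
have -> : (k - 1) * (k - 1 - 1) = 2 + (k * (k - 1) + (-2) * k) by ring.
rewrite !expfzDr ?oppr_eq0 //.
have -> : (- z) ^ (-1 : int) = (- z)^-1 by rewrite exprN1.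
rewrite -[s ^ 1]/s -[p]/(s * s).
by field.
Qed.

(** The Jacobi series truncated to -N <= k <= M, with Gaussian binomial coefficients as
    weights. *)
Definition jtriple (M N : nat) z : C :=
  \sum_(j < (M + N).+1) gauss j (M + N - j) * jterm (j%:Z - N%:Z) z.

(** Induction on N: pulling the first factor 1 - p/z = - (p/z) (1 - z/p) out of the second
    product lengthens the first one and replaces z by z/p, which shifts the summation
    index by one. *)
Lemma jtripleE M N z : z != 0 -> P z M * P (p / z) N = jtriple M N z.
Proof.
have p0 : p != 0 by rewrite expf_neq0.
elim: N M z => [|N IH] M z z0.
  rewrite [P (p / z) 0]/poch big_geq // mulr1 qbinomial // /jtriple addn0.
  by apply: eq_bigr => j _; rewrite subr0.
rewrite poch_recl.
have -> : 1 - p / z = - p / z * (1 - z / p) by field; rewrite p0 z0.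
have -> : P z M * (- p / z * (1 - z / p) * P (p / z * p) N) =
   - p / z * (P (z / p) M.+1 * P (p / (z / p)) N).
  rewrite poch_recl divfK //.
  have -> : p / (z / p) = p / z * p by field; rewrite p0 z0.
  by ring.
rewrite IH ?mulf_neq0 ?invr_eq0 // /jtriple mulr_sumr addSnnS.
apply: eq_bigr => j _.
have -> : j%:Z - N.+1%:Z = j%:Z - N%:Z - 1 by lia.
by rewrite (jterm_pdiv (j%:Z - N%:Z)) // ; ring.
Qed.

End TripleProduct.

(** * The Jacobi triple product in the limit *)

Lemma quotient_dist (F : numFieldType) (M D e a b b' c : F) : 0 < e ->
  `|c| <= M -> `|a| <= M -> `|b'| <= M -> `|b - a| <= D -> `|b' - a| <= D ->
  e <= `|a| -> e <= `|b| -> e <= `|b'| ->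
  `|c / (b * b') - c / (a * a)| <= M * (M * D + M * D) / (e * e * (e * e)).
Proof.
move=> e0 cM aM b'M ba b'a ea eb eb'; have e00 := ltW e0.
have nz (x : F) : e <= `|x| -> x != 0 by move=> ex; rewrite -normr_gt0 (lt_le_trans e0).
have -> : c / (b * b') - c / (a * a) =
   c * (a * (a - b') + b' * (a - b)) / (b * b' * (a * a)).
  by field; rewrite !nz.
rewrite normrM normfV; apply: ler_pM => //.
  rewrite normrM; apply: ler_pM => //.
  apply: le_trans (ler_normD _ _) _; rewrite !normrM.
  by apply: lerD; apply: ler_pM => //; rewrite distrC.
rewrite lef_pV2 ?posrE ?mulr_gt0 ?normr_gt0 ?mulf_neq0 ?nz //.
by rewrite !normrM; do 2![apply: ler_pM; rewrite ?mulr_ge0 //].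
Qed.
Arguments quotient_dist {F M D e a b b' c}.

Lemma normfXz (F : numFieldType) (x : F) (k : int) : `|x ^ k| = `|x| ^ k.
Proof. by case: k => n; rewrite ?NegzE -?exprnN ?normfV normrX. Qed.

Lemma sqrz_abs (k : int) : k * k = (`|k| * `|k|)%N%:Z.
Proof. by case: k => n //; rewrite NegzE mulrNN. Qed.

Lemma geo_nat_le (F : numFieldType) (t : F) n : 0 <= t -> t < 1 -> n%:R * t ^+ n * (1 - t) <= 1 - t ^+ n.
Proof.
move=> t0 t1; elim: n => [|n IH]; first by rewrite mulr0n !mul0r expr0 subrr.
have -> : n.+1%:R * t ^+ n.+1 * (1 - t) =
   t * (n%:R * t ^+ n * (1 - t)) + t ^+ n.+1 * (1 - t).
  by rewrite exprS -natr1; ring.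
apply: le_trans (lerD (ler_wpM2l t0 IH) (lexx _)) _.
rewrite -subr_ge0.
have -> : 1 - t ^+ n.+1 - (t * (1 - t ^+ n) + t ^+ n.+1 * (1 - t)) = (1 - t) * (1 - t ^+ n.+1).
  by rewrite exprS; ring.
by apply: mulr_ge0; rewrite subr_ge0; [exact: ltW | apply: exprn_ile1 => //; exact: ltW].
Qed.

Lemma geo_nat_sqr_le (F : numFieldType) (t : F) N : 0 <= t -> t < 1 ->
  (t ^+ 2) ^+ N * (N + N).+1%:R <= (2 / (1 - t) + 1) * t ^+ N.
Proof.
move=> t0 t1; have t10 : 0 < 1 - t by rewrite subr_gt0.
have tN0 : 0 <= t ^+ N by rewrite exprn_ge0.
have tN1 : t ^+ N <= 1 by apply: exprn_ile1 => //; exact: ltW.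
have -> : (t ^+ 2) ^+ N * (N + N).+1%:R = (2 * (N%:R * t ^+ N) + t ^+ N) * t ^+ N.
  by rewrite exprAC -natr1 natrD; ring.
apply: ler_wpM2r => //; apply: lerD => //; apply: ler_wpM2l => //.
rewrite -[leRHS]mul1r ler_pdivlMr //; apply: le_trans (geo_nat_le _ _ _ t0 t1) _.
by rewrite gerBl.
Qed.

Section TripleProductLimit.
Variable R : realType.
Let C : numFieldType := R[i].
Implicit Types (x y z : C) (k : int).
Variable s : C.
Hypotheses (s0 : s != 0) (s1 : `|s| < 1).
Local Notation p := (s ^+ 2).
Let p1 : `|p| < 1 := sqr_norm_lt1 R s s1.
Local Notation P := (poch R p).
Local Notation gauss := (gauss R s).
Local Notation jterm := (jterm R s).

Lemma gauss_bounded : exists2 M : C, 0 <= M & forall m n, `|gauss m n| <= M.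
Proof.
have [M M0 MP] := poch_bounded R p p1 p.
have [e e0 eP] := poch_lower R p p1.
exists (M / (e * e)) => [|m n]; first by rewrite divr_ge0 // mulr_ge0 // ltW.
rewrite /gauss normrM normfV normrM; apply: ler_pM => //; first exact: MP.
rewrite lef_pV2 ?posrE ?mulr_gt0 ?normr_gt0 ?(pochp_neq0 R p p1) //.
have e00 := ltW e0.
by apply: ler_pM => //; exact: eP.
Qed.

(** With d the distance from j to N, the Pochhammer products in both denominators have
    length at least N - d, so all of them agree up to order |p|^(N - d). *)
Lemma gauss_near : exists2 K : C, 0 <= K & forall N j, (j <= N + N)%N ->
  `|gauss j (N + N - j) - gauss N N| <= K * `|p| ^+ (N - `|j%:Z - N%:Z|)%N.
Proof.
have [M M0 MP] := poch_bounded R p p1 p.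
have [e e0 eP] := poch_lower R p p1.
have [K K0 KP] := poch_dist R p p1 p.
exists (M * (M * (K + K) + M * (K + K)) / (e * e * (e * e))) => [|N j jN].
  by rewrite divr_ge0 // ?mulr_ge0 ?addr_ge0 ?mulr_ge0 ?addr_ge0 // ltW.
set f := (N - _)%N.
have dist a : (f <= a)%N -> `|P p a - P p N| <= (K + K) * `|p| ^+ f.
  move=> fa; have -> : P p a - P p N = (P p a - P p f) - (P p N - P p f) by ring.
  apply: le_trans (ler_normB _ _) _; rewrite mulrDl lerD //.
    by rewrite -(subnKC fa); exact: KP.
  have fN : (f <= N)%N by rewrite /f; lia.
  by rewrite -(subnKC fN); exact: KP.
set j' := (N + N - j)%N.
have dj : `|P p j - P p N| <= (K + K) * `|p| ^+ f by apply: dist; rewrite /f; lia.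
have dj' : `|P p j' - P p N| <= (K + K) * `|p| ^+ f by apply: dist; rewrite /f /j'; lia.
have -> : M * (M * (K + K) + M * (K + K)) / (e * e * (e * e)) * `|p| ^+ f =
  M * (M * ((K + K) * `|p| ^+ f) + M * ((K + K) * `|p| ^+ f)) / (e * e * (e * e)).
  by ring.
rewrite /gauss; have -> : (j + j' = N + N)%N by rewrite /j'; lia.
exact: (quotient_dist e0 (MP _) (MP _) (MP _) dj dj' (eP _) (eP _) (eP _)).
Qed.

(** Once t^n <= 1 / beta, the quantity (t^n beta)^n stays below 1; the finitely many
    other n are bounded by a power of beta. *)
Lemma growth (t beta : C) : 0 <= t -> t < 1 -> 1 <= beta ->
  exists2 K : C, 0 <= K & forall n, t ^+ (n * n) * beta ^+ n <= K.
Proof.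
move=> t0 t1 b1; have b0 : 0 < beta by apply: lt_le_trans b1.
have : (fun n => t ^+ n : C) @ \oo --> (0 : C).
  apply: (@cvg_geo0 R _ 1 t); first by rewrite ger0_norm.
  by move=> n; rewrite mul1r normrX.
move/cvgrPdist_lt => /(_ beta^-1); rewrite invr_gt0 => /(_ b0) [n0 _ n0P].
exists (beta ^+ n0) => [|n]; first by rewrite exprn_ge0 // ltW.
case: (leqP n0 n) => [n0n|nn0].
  apply: (@le_trans _ _ 1); last by rewrite exprn_ege1.
  rewrite exprM -exprMn exprn_ile1 //.
    by rewrite mulr_ge0 ?exprn_ge0 // ltW.
  have := n0P n n0n; rewrite /= sub0r normrN ger0_norm ?exprn_ge0 // => /ltW.
  by rewrite -[_^-1]mul1r ler_pdivlMr.
apply: (@le_trans _ _ (beta ^+ n)); last by rewrite ler_weXn2l // ltnW.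
by rewrite ler_piMl ?exprn_ge0 ?(ltW b0) // exprn_ile1 // ltW.
Qed.

(** The quadratic exponent of s beats any geometric growth, in both directions of k. *)
Lemma jterm_small z (beta : C) : z != 0 -> 1 <= beta ->
  exists2 K : C, 0 <= K & forall k, `|jterm k z| * beta ^+ `|k|%N <= K.
Proof.
move=> z0 b1; set t := `|s|; have t0 : 0 < t by rewrite normr_gt0.
have zn0 : 0 < `|z| by rewrite normr_gt0.
set w := `|z| / t; have w0 : 0 < w by rewrite divr_gt0.
set rho := w + w^-1 + 1.
have wV0 : 0 < w^-1 by rewrite invr_gt0.
have rho1 : 1 <= rho by rewrite lerDr addr_ge0 // ltW.
have [K K0 KP] := growth t (rho * beta) (ltW t0) s1 (mulr_ege1 rho1 b1).
exists K => // k; apply: le_trans (KP `|k|%N).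
have -> : `|jterm k z| = t ^+ (`|k| * `|k|) * w ^ k.
  rewrite jtermE normrM !normfXz normrN -/t /w expfzMl exprz_inv.
  have -> : k * (k - 1) = (`|k| * `|k|)%N%:Z + - k.
    by rewrite mulrBr mulr1 sqrz_abs.
  by rewrite expfzDr ?gt_eqF // exprnP; ring.
rewrite exprMn mulrA; apply: ler_wpM2r; first by rewrite exprn_ge0 // (le_trans _ b1).
apply: ler_wpM2l; first by rewrite exprn_ge0 // ltW.
have nn (x : C) (n : nat) : 0 < x -> x <= rho -> x ^+ n <= rho ^+ n.
  by move=> x0 xr; apply: lerXn2r; rewrite ?nnegrE // ?ltW // (lt_le_trans x0).
case: k => n; rewrite -?exprnP /=.
  by apply: nn => //; rewrite /rho -addrA lerDl addr_ge0 // ltW.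
rewrite NegzE -exprnN -exprVn; apply: nn => //.
by rewrite /rho addrAC lerDr addr_ge0 // ltW.
Qed.

(** The symmetric partial sums of the Jacobi series. *)
Definition jsum (N : nat) z : C :=
  \sum_(j < (N + N).+1) jterm (j%:Z - N%:Z) z.

(** At distance d from the centre the coefficients differ by O(|p|^(N - d)), whereas the
    term itself is O(|p|^d) by the decay estimate with beta = 1 / |p|. Thus each of the
    2 N + 1 differences is O(|p|^N), and their sum is O(|s|^N). *)
Lemma jtriple_sub_jsum z : z != 0 ->
  (fun N => jtriple R s N N z - gauss N N * jsum N z) @ \oo --> (0 : C).
Proof.
move=> z0.
have [K K0 KP] := gauss_near.
have p0 : 0 < `|p| by rewrite normr_gt0 expf_neq0.
have b1 : 1 <= `|p|^-1 by rewrite invf_ge1 // ltW.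
have [L L0 LP] := jterm_small z `|p|^-1 z0 b1.
have t1 : 0 < 1 - `|s| by rewrite subr_gt0.
apply: (@cvg_geo0 R _ (K * L * (2 / (1 - `|s|) + 1)) s s1) => N.
rewrite /jtriple /jsum mulr_sumr -sumrB.
apply: le_trans (ler_norm_sum _ _ _) _.
apply: (@le_trans _ _ (\sum_(j < (N + N).+1) (K * L * `|p| ^+ N))).
  apply: ler_sum => j _; rewrite -mulrBl normrM.
  have jN : (j <= N + N)%N by have := ltn_ord j; lia.
  apply: le_trans (ler_wpM2r (normr_ge0 _) (KP N j jN)) _.
  set d := `|_|%N; have dN : (d <= N)%N by rewrite /d; lia.
  have -> : K * L * `|p| ^+ N = K * `|p| ^+ (N - d) * (L * `|p| ^+ d).
    by rewrite -{1}(subnK dN) exprD; ring.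
  apply: ler_wpM2l; first by rewrite mulr_ge0 // exprn_ge0.
  by have := LP (j%:Z - N%:Z); rewrite -/d exprVn ler_pdivrMr // exprn_gt0.
rewrite sumr_const card_ord -[leLHS]mulr_natr normrX.
rewrite -[leLHS]mulrA -[leRHS]mulrA; apply: ler_wpM2l; first exact: mulr_ge0.
exact: geo_nat_sqr_le.
Qed.

End TripleProductLimit.

(** * Summation over a square and over a rotated square *)

Section Box.
Variables (F : numFieldType) (f : int -> int -> F) (N : nat) (B : F).
Hypothesis fB : forall k l, (N <= `|k| + `|l|)%N -> `|f k l| <= B.

(** The points (k, l) of the square in rotated coordinates: k = u + v + 1 - N, with
    l = v - u or l = u - v + 1 according to the parity of k - l - N. Both k and l are shifted
    by N to become indices. *)
Let rotate (t : 'I_N * 'I_N.+1 * bool) : 'I_(N + N).+1 * 'I_(N + N).+1 :=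
  (inord (t.1.1 + t.1.2 + 1)%N,
   inord (if t.2 then t.1.2 + (N - t.1.1) else t.1.1 + (N - t.1.2) + 1)%N).

Lemma rotate1E u v b : (rotate (u, v, b)).1 = (u + v + 1)%N :> nat.
Proof. by rewrite /= inordK //; have := ltn_ord u; have := ltn_ord v; lia. Qed.

Lemma rotate2E u v b : (rotate (u, v, b)).2 = (if b then v + (N - u) else u + (N - v) + 1)%N :> nat.
Proof. by rewrite /= inordK //; have := ltn_ord u; have := ltn_ord v; case: b; lia. Qed.

Lemma rotate_inj : injective rotate.
Proof.
move=> [[u v] b] [[u' v'] b'] e.
have e1 : (rotate (u, v, b)).1 = (rotate (u', v', b')).1 :> nat by rewrite e.
have e2 : (rotate (u, v, b)).2 = (rotate (u', v', b')).2 :> nat by rewrite e.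
rewrite !rotate1E in e1; rewrite !rotate2E in e2; clear e.
have := ltn_ord u; have := ltn_ord v; have := ltn_ord u'; have := ltn_ord v'.
move=> lv' lu' lv lu.
have eb : b = b' by case: b e2; case: b'; lia.
subst b'.
have eu : u = u' :> nat by clear -e1 e2 lu lv lu' lv'; case: b e2; lia.
have ev : v = v' :> nat by lia.
by rewrite (val_inj eu) (val_inj ev).
Qed.

Lemma rotate_onto (t : 'I_(N + N).+1 * 'I_(N + N).+1) :
  (`|t.1%:Z - N%:Z| + `|t.2%:Z - N%:Z| < N)%N -> exists x, t = rotate x.
Proof.
case: t => [[i li] [j lj]] /= tN.
case eo: (odd (i + j + N)).
- have hv : ((i + j - 1 - N)./2 < N.+1)%N by lia.
  have hu : (i - 1 - (i + j - 1 - N)./2 < N)%N by lia.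
  exists (Ordinal hu, Ordinal hv, true).
  by rewrite [RHS]surjective_pairing; congr (_, _); apply: ord_inj; rewrite ?rotate1E ?rotate2E /=; lia.
- have hu : ((i + j - N)./2 - 1 < N)%N by lia.
  have hv : (i - 1 - ((i + j - N)./2 - 1) < N.+1)%N by lia.
  exists (Ordinal hu, Ordinal hv, false).
  by rewrite [RHS]surjective_pairing; congr (_, _); apply: ord_inj; rewrite ?rotate1E ?rotate2E /=; lia.
Qed.

(** Every (k, l) with |k| + |l| < N is hit exactly once by the rotated coordinates, so
    the two sums differ by terms that are bounded by B. *)
Lemma box_sum :
  `|\sum_(i < (N + N).+1) \sum_(j < (N + N).+1) f (i%:Z - N%:Z) (j%:Z - N%:Z) -
    \sum_(u < N) \sum_(v < N.+1)
      (f (u%:Z + v%:Z + 1 - N%:Z) (u%:Z - v%:Z + 1) +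
       f (u%:Z + v%:Z + 1 - N%:Z) (v%:Z - u%:Z))| <= ((N + N).+1 ^ 2)%:R * B.
Proof.
pose g (t : 'I_(N + N).+1 * 'I_(N + N).+1) := f (t.1%:Z - N%:Z) (t.2%:Z - N%:Z).
rewrite pair_bigA /= -/g.
have -> : \sum_(u < N) \sum_(v < N.+1)
      (f (u%:Z + v%:Z + 1 - N%:Z) (u%:Z - v%:Z + 1) +
       f (u%:Z + v%:Z + 1 - N%:Z) (v%:Z - u%:Z)) = \sum_(t in codom rotate) g t.
  rewrite -(big_uniq _ (_ : uniq (codom rotate))) /=; last first.
    by rewrite map_inj_uniq ?enum_uniq //; exact: rotate_inj.
  rewrite big_map big_enum /=.
  have -> : \sum_t g (rotate t) =
            \sum_(p : 'I_N * 'I_N.+1) \sum_(b : bool) g (rotate (p, b)).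
    by rewrite pair_bigA; apply: eq_bigr => -[].
  rewrite pair_bigA; apply: eq_bigr => [[u v] _] /=.
  rewrite big_bool /= addrC /g !rotate1E !rotate2E /=.
  have := ltn_ord u; have := ltn_ord v => lv lu.
  by congr (f _ _ + f _ _); lia.
rewrite (bigID (mem (codom rotate))) /= addrAC subrr add0r.
apply: le_trans (ler_norm_sum _ _ _) _.
have B0 : 0 <= B by apply: le_trans (fB N N _); [exact: normr_ge0 | rewrite /=; lia].
apply: (@le_trans _ _ (\sum_(t : 'I_(N + N).+1 * 'I_(N + N).+1) B)); last first.
  by rewrite sumr_const card_prod card_ord -mulnn mulr_natl.
rewrite big_mkcond /=; apply: ler_sum => t _; case: ifP => // tI.
apply: fB; rewrite leqNgt; apply/negP => /rotate_onto [x tx].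
by move: tI; rewrite tx codom_f.
Qed.
End Box.

(** * The addition formula for theta functions *)

Definition addition_formula (F : fieldType) (th : F -> F) : Prop :=
  forall x y u v, x != 0 -> y != 0 -> u != 0 -> v != 0 ->
  th (x * y) * th (x / y) * (th (u * v) * th (u / v)) -
  th (x * v) * th (x / v) * (th (u * y) * th (u / y)) =
  u / y * (th (y * v) * th (y / v) * (th (x * u) * th (x / u))).

Lemma cvg_double : (fun n : nat => (n + n)%N) @ \oo --> \oo.
Proof.
move=> A [N _ NA]; exists N => // n /= Nn; apply: NA => /=.
exact: leq_trans Nn (leq_addr _ _).
Qed.

Lemma expfz2 (F : fieldType) (x : F) (k : int) : x ^ (2 * k) = x ^ k * x ^ k.
Proof. by rewrite mulrC -exprz_exp -[RHS]expr2. Qed.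

Section TermProducts.
Variables (F : fieldType) (s x y : F).
Hypotheses (s0 : s != 0) (x0 : x != 0) (y0 : y != 0).
Let jt (k : int) (z : F) : F := s ^ (k * (k - 1)) * (- z) ^ k.

Lemma expN1zz (k : int) : (-1 : F) ^ k * (-1) ^ k = 1.
Proof. by rewrite -expfzMl mulrNN mulr1 exp1rz. Qed.

(** In the product of the Jacobi series at x y and x / y, the coordinates S, D of the
    terms with indices of equal parity separate the variables: S governs x and D governs y. *)
Lemma jterm_even (S D : int) :
  jt (S + D) (x * y) * jt (S - D) (x / y) =
  x * (s ^ (2 * (S * (S - 1))) * x ^ (2 * S - 1)) * (s ^ (2 * (D * D)) * y ^ (2 * D)).
Proof.
rewrite /jt -![- (_ * _)]mulN1r !expfzMl !exprz_inv.
have -> : 2 * (S * (S - 1)) = (S + D) * (S + D - 1) + (S - D) * (S - D - 1) - 2 * (D * D) by ring.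
rewrite opprD opprK !expfzDr ?oppr_eq0 ?oner_eq0 // !expfz2 -!invr_expz !expr1z !expfz2.
have b0 : (-1 : F) ^ D != 0 by rewrite expfz_neq0 // oppr_eq0 oner_eq0.
have xD := expfz_neq0 D x0; have yS := expfz_neq0 S y0; have sD := expfz_neq0 (D * D) s0.
have := expN1zz S.
move: ((-1) ^ S) ((-1) ^ D) b0 (x ^ D) xD (y ^ S) yS (x ^ S) (y ^ D) (s ^ (D * D)) sD (s ^ ((S + D) * _)) (s ^ ((S - D) * _)).
move=> a b b0 xD xD0 yS yS0 xS yD sDD sDD0 s1 s2 aa.
by field: aa; rewrite x0 sDD0 yS0 xD0 b0.
Qed.

(** The same separation for indices of different parity, with the roles of the even
    and the odd powers interchanged. *)
Lemma jterm_odd (S D : int) :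
  jt (S + D) (x * y) * jt (S - D + 1) (x / y) =
  - x * (s ^ (2 * (S * S)) * x ^ (2 * S)) * (s ^ (2 * (D * (D - 1))) * y ^ (2 * D - 1)).
Proof.
rewrite /jt -![- (_ * _)]mulN1r !expfzMl !exprz_inv.
have -> : 2 * (S * S) = (S + D) * (S + D - 1) + (S - D + 1) * (S - D + 1 - 1) - 2 * (D * (D - 1)) by ring.
rewrite !opprD !opprK !expfzDr ?oppr_eq0 ?oner_eq0 // !expfz2 -!invr_expz !expr1z !expfz2.
have b0 : (-1 : F) ^ D != 0 by rewrite expfz_neq0 // oppr_eq0 oner_eq0.
have xD := expfz_neq0 D x0; have yS := expfz_neq0 S y0; have sD := expfz_neq0 (D * (D - 1)) s0.
have := expN1zz S.
move: ((-1) ^ S) ((-1) ^ D) b0 (x ^ D) xD (y ^ S) yS (x ^ S) (y ^ D) (s ^ (D * _)) sD (s ^ ((S + D) * _)) (s ^ ((S - D + 1) * _)).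
move=> a b b0 xD xD0 yS yS0 xS yD sDD sDD0 s1 s2 aa.
by field: aa; rewrite y0 sDD0 yS0 xD0 b0.
Qed.
End TermProducts.

(** The relation between the 2 x 2 minors of a 2 x 4 matrix, with the weights that the
    theta products carry. *)
Lemma plucker_vec (F : fieldType) (x y u v ax bx ay by_ au bu av bv : F) : y != 0 ->
  x * (ax * by_ - bx * ay) * (u * (au * bv - bu * av)) -
  x * (ax * bv - bx * av) * (u * (au * by_ - bu * ay)) =
  u / y * (y * (ay * bv - by_ * av) * (x * (ax * bu - bx * au))).
Proof. by move=> y0; field. Qed.

Lemma norm_quarter (F : numFieldType) : `|4^-1 : F| = 4^-1.
Proof. by rewrite ger0_norm ?invr_ge0. Qed.

Lemma norm_quarter_lt1 (F : numFieldType) : `|4^-1 : F| < 1.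
Proof. by rewrite norm_quarter invf_lt1 // ltr1n. Qed.

Lemma norm_mul_pow_le (F : numFieldType) (a b c L M : F) m n : 0 <= c ->
  `|a| * c ^+ m <= L -> `|b| * c ^+ n <= M -> `|a * b| * c ^+ (m + n) <= L * M.
Proof.
by move=> c0 aL bM; rewrite normrM exprD mulrACA ler_pM // mulr_ge0 // exprn_ge0.
Qed.

Lemma norm_mul_le (F : numFieldType) (a b L M : F) :
  `|a| <= L -> `|b| <= M -> `|a * b| <= L * M.
Proof. by move=> aL bM; rewrite normrM ler_pM. Qed.

Lemma cvg0_mul_bounded (F : numFieldType) (g d : nat -> F) (M : F) : 0 <= M ->
  (forall n, `|g n| <= M) -> d @ \oo --> (0 : F) ->
  (fun n => g n * d n) @ \oo --> (0 : F).
Proof.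
move=> M0 gM d0; apply/cvgrPdist_lt => e e0.
have M1 : 0 < M + 1 by rewrite ltr_wpDl.
move/cvgrPdist_lt: d0 => /(_ (e / (M + 1)) (divr_gt0 e0 M1)).
apply: filterS => n; rewrite !sub0r !normrN normrM ltr_pdivlMr // => de.
apply: le_lt_trans de; rewrite mulrC ler_wpM2l //.
by apply: le_trans (gM n) _; rewrite lerDl.
Qed.

Lemma seq_cvgM {F : numFieldType} {f g : nat -> F} {a b : F} :
  f @ \oo --> a -> g @ \oo --> b -> (fun n => f n * g n) @ \oo --> a * b.
Proof. exact: cvgM. Qed.

Lemma seq_cvgB {F : numFieldType} {f g : nat -> F} {a b : F} :
  f @ \oo --> a -> g @ \oo --> b -> (fun n => f n - g n) @ \oo --> a - b.
Proof. exact: cvgB. Qed.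

Lemma seq_cvg_cst {F : numFieldType} (a : F) : (fun _ : nat => a) @ \oo --> a.
Proof. exact: cvg_cst. Qed.

Lemma seq_cvg_eq {F : numFieldType} {f : nat -> F} {a b : F} :
  f @ \oo --> a -> (forall n, f n = b) -> a = b.
Proof.
move=> fa fb; apply: (cvg_unique _ fa) => //.
have -> : f = fun _ => b by apply/funext.
exact: cvg_cst.
Qed.

Section Addition.
Variable R : realType.
Let C : numFieldType := R[i].
Implicit Types (x y z : C) (k : int).
Variable s : C.
Hypotheses (s0 : s != 0) (s1 : `|s| < 1).
Local Notation p := (s ^+ 2).
Let p1 : `|p| < 1 := sqr_norm_lt1 R s s1.
Local Notation gauss := (gauss R s).
Local Notation jterm := (jterm R s).
Local Notation jsum := (jsum R s).

(** The odd and the even part of a truncated theta series: theta(xy) theta(x/y) is the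
    limit of a 2 x 2 determinant with rows (walpha, wbeta) at x and at y. *)
Definition walpha n x : C :=
  \sum_(u < n + n) s ^ (2 * ((u%:Z - n%:Z + 1) * (u%:Z - n%:Z + 1 - 1))) * x ^ (2 * (u%:Z - n%:Z + 1) - 1).

Definition wbeta n x : C :=
  \sum_(v < (n + n).+1) s ^ (2 * ((v%:Z - n%:Z) * (v%:Z - n%:Z))) * x ^ (2 * (v%:Z - n%:Z)).

Definition wdet n x y := x * (walpha n x * wbeta n y - wbeta n x * walpha n y).

Lemma wdet_plucker n (x y u v : C) : x != 0 -> y != 0 -> u != 0 -> v != 0 ->
  wdet n x y * wdet n u v - wdet n x v * wdet n u y = u / y * (wdet n y v * wdet n x u).
Proof. by move=> x0 y0 u0 v0; exact: plucker_vec. Qed.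

(** The two sides sum the same double series over a square and over a rotated square;
    beyond the common part the terms decay faster than 4^(- |k| - |l|). *)
Lemma jsum_wdet x y : x != 0 -> y != 0 ->
  (fun n => jsum (n + n) (x * y) * jsum (n + n) (x / y) - wdet n x y) @ \oo --> (0 : C).
Proof.
move=> x0 y0.
have four : 1 <= 4 :> C by rewrite ler1n.
have [L1 L10 L1P] := jterm_small R s s0 s1 (x * y) 4 (mulf_neq0 x0 y0) four.
have [L2 L20 L2P] := jterm_small R s s0 s1 (x / y) 4 (mulf_neq0 x0 (invr_neq0 y0)) four.
apply: (@cvg_geo0 R _ (16 * (L1 * L2)) (4^-1)) => [|n].
  exact: norm_quarter_lt1.
rewrite norm_quarter.
pose f (k l : int) := jterm k (x * y) * jterm l (x / y).
pose B := L1 * L2 / 4 ^+ (n + n).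
have fB k l : (n + n <= `|k| + `|l|)%N -> `|f k l| <= B.
  move=> kl; rewrite /B ler_pdivlMr ?exprn_gt0 //.
  apply: (@le_trans _ _ (`|f k l| * 4 ^+ (`|k| + `|l|))).
    by apply: ler_wpM2l => //; rewrite ler_weXn2l.
  exact: (norm_mul_pow_le _ _ _ _ _ _ _ _ (le_trans ler01 four) (L1P k) (L2P l)).
have -> : jsum (n + n) (x * y) * jsum (n + n) (x / y) =
    \sum_(i < (n + n + (n + n)).+1) \sum_(j < (n + n + (n + n)).+1)
       f (i%:Z - (n + n)%N%:Z) (j%:Z - (n + n)%N%:Z).
  by rewrite /jsum big_distrlr.
have -> : wdet n x y = \sum_(u < n + n) \sum_(v < (n + n).+1)
      (f (u%:Z + v%:Z + 1 - (n + n)%N%:Z) (u%:Z - v%:Z + 1) +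
       f (u%:Z + v%:Z + 1 - (n + n)%N%:Z) (v%:Z - u%:Z)).
  have -> : wdet n x y = (x * walpha n x) * wbeta n y + walpha n y * (- x * wbeta n x).
    by rewrite /wdet; move: (walpha n x) (wbeta n x) (walpha n y) (wbeta n y) => *; ring.
  rewrite [x * walpha n x]mulr_sumr [- x * wbeta n x]mulr_sumr !big_distrlr.
  rewrite -big_split; apply: eq_bigr => u _ /=; rewrite -big_split; apply: eq_bigr => v _ /=.
  congr (_ + _).
    rewrite -(jterm_even _ _ _ _ s0 x0 y0) /f; congr (jterm _ _ * jterm _ _); lia.
  rewrite [LHS]mulrC -(jterm_odd _ _ _ _ s0 x0 y0) /f; congr (jterm _ _ * jterm _ _); lia.
apply: le_trans (box_sum _ f (n + n) B fB) _.
have -> : B = L1 * L2 * (4^-1 ^+ n * 4^-1 ^+ n).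
  by rewrite /B -exprVn exprD.
have -> : 16 * (L1 * L2) * 4^-1 ^+ n = (16 * 4 ^+ n) * (L1 * L2 * (4^-1 ^+ n * 4^-1 ^+ n)) :> C.
  rewrite exprVn; have e0 : 4 ^+ n != 0 :> C by rewrite expf_neq0 // pnatr_eq0.
  by field.
apply: ler_wpM2r; first by rewrite !mulr_ge0 // exprn_ge0 // invr_ge0.
rewrite -natrX -natrM ler_nat.
have n2 : (n < 2 ^ n)%N by apply: ltn_expl.
have -> : (4 ^ n = 2 ^ n * 2 ^ n)%N by rewrite -expnMn.
move: (2 ^ n)%N n2 => w nw; nia.
Qed.

Lemma cvg_gauss_jsum z : z != 0 ->
  (fun n => gauss (n + n) (n + n) * jsum (n + n) z) @ \oo --> theta1 p z.
Proof.
move=> z0.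
have h1 := cvg_theta1 R p p1 z.
have h2 := jtriple_sub_jsum R s s0 s1 z z0.
have h3 : (fun N => poch R p z N * poch R p (p / z) N -
   (jtriple R s N N z - gauss N N * jsum N z)) @ \oo --> (theta1 p z - 0 : C).
  exact: cvgB h1 h2.
rewrite subr0 in h3.
have h4 := cvg_comp _ _ cvg_double h3.
apply: cvg_trans h4; apply: near_eq_cvg; near=> n.
by rewrite /= jtripleE //; ring.
Unshelve. all: by end_near. Qed.

Lemma cvg_wdet x y : x != 0 -> y != 0 ->
  (fun n => gauss (n + n) (n + n) * gauss (n + n) (n + n) * wdet n x y) @ \oo -->
  theta1 p (x * y) * theta1 p (x / y).
Proof.
move=> x0 y0.
have xy0 : x * y != 0 by rewrite mulf_neq0.
have xy0' : x / y != 0 by rewrite mulf_neq0 // invr_eq0.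
have h1 := seq_cvgM (cvg_gauss_jsum _ xy0) (cvg_gauss_jsum _ xy0').
have [M M0 MP] := gauss_bounded R s s1.
have h2 := cvg0_mul_bounded _ (fun n => gauss (n + n) (n + n) * gauss (n + n) (n + n)) _ (M * M)
  (mulr_ge0 M0 M0) (fun n => norm_mul_le _ _ _ _ _ (MP _ _) (MP _ _)) (jsum_wdet x y x0 y0).
have h3 := seq_cvgB h1 h2; rewrite subr0 in h3.
apply: cvg_trans h3; apply: near_eq_cvg; near=> n => /=.
move: (gauss _ _) (jsum _ _) (jsum _ _) (wdet _ _ _) => a b c d.
by rewrite /=; ring.
Unshelve. all: by end_near. Qed.

(** Being a limit of 2 x 2 determinants in vectors attached to x and y, the product
    theta(xy) theta(x/y) inherits the three-term relation of minors. *)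
Lemma theta_addition_nz : addition_formula C (theta1 p).
Proof.
move=> x y u v x0 y0 u0 v0.
have c (a b : C) (a0 : a != 0) (b0 : b != 0) := cvg_wdet a b a0 b0.
have h1 := seq_cvgM (c _ _ x0 y0) (c _ _ u0 v0).
have h2 := seq_cvgM (c _ _ x0 v0) (c _ _ u0 y0).
have h3 := seq_cvgM (c _ _ y0 v0) (c _ _ x0 u0).
have h4 := seq_cvgB (seq_cvgB h1 h2) (seq_cvgM (seq_cvg_cst (u / y)) h3).
apply/eqP; rewrite -subr_eq0; apply/eqP.
refine (seq_cvg_eq h4 _) => n.
have := wdet_plucker n x y u v x0 y0 u0 v0.
move: (gauss _ _) (wdet n x y) (wdet n u v) (wdet n x v) (wdet n u y) (wdet n y v) (wdet n x u) (u / y).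
move=> g w1 w2 w3 w4 w5 w6 k e.
have -> : g * g * w1 * (g * g * w2) - g * g * w3 * (g * g * w4) - k * (g * g * w5 * (g * g * w6)) =
  (g * g) * (g * g) * ((w1 * w2 - w3 * w4) - k * (w5 * w6)) by ring.
by rewrite e subrr mulr0.
Qed.

End Addition.

Lemma trig_addition (F : fieldType) : addition_formula F (fun x => 1 - x).
Proof.
by move=> x y u v _ y0 u0 v0; field; rewrite u0 v0 y0.
Qed.

Lemma theta1_0 (R : realType) (x : R[i]) : theta1 (0 : R[i]) x = 1 - x.
Proof.
have p1 : `|0 : R[i]| < 1 by rewrite normr0.
rewrite /theta1 (pochinf_recl R 0 p1 x) mulr0 mul0r.
have -> : pochinf (0 : R[i]) 0 = 1.
  apply: (seq_cvg_eq (cvg_poch R 0 p1 0)) => n; rewrite /poch big1 // => i _.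
  by rewrite mul0r subr0.
by rewrite !mulr1.
Qed.

(** At p = 0 the theta function is 1 - x and the formula is a polynomial identity; the
    triple product needs p != 0. *)
Lemma theta_addition (R : realType) (p : R[i]) : `|p| < 1 ->
  addition_formula (R[i] : numFieldType) (theta1 p).
Proof.
move=> p1; have [->|p0] := eqVneq p 0.
  by move=> x y u v *; rewrite !theta1_0; exact: trig_addition.
have sp : sqrtC p ^+ 2 = p by rewrite sqrtCK.
have s0 : sqrtC p != 0 by rewrite sqrtC_eq0.
have s1 : `|sqrtC p| < 1.
  by rewrite -(@expr_lt1 _ 2) // -normrX sp.
by rewrite -sp; exact: theta_addition_nz.
Qed.

(** * A determinant of products of brackets *)

Lemma det_scale (F : comNzRingType) n (u v : 'I_n -> F) (M : 'I_n -> 'I_n -> F) :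
  \det (\matrix_(i, j) (u i * v j * M i j)) =
  (\prod_i u i) * (\prod_j v j) * \det (\matrix_(i, j) M i j).
Proof.
have -> : \matrix_(i, j) (u i * v j * M i j) =
  diag_mx (\row_i u i) *m (\matrix_(i, j) M i j) *m diag_mx (\row_j v j).
  by apply/matrixP => i j; rewrite mul_mx_diag mul_diag_mx !mxE; ring.
rewrite !det_mulmx !det_diag mulrAC.
by congr (_ * _ * _); apply: eq_bigr => i _; rewrite mxE.
Qed.

Lemma prod_triangle_shift (F : comNzRingType) (G : nat -> nat -> F) r :
  \prod_(1 <= t < r.+1) \prod_(1 <= s < t.+1) G t s =
  \prod_(1 <= t < r.+1) G t t *
    \prod_(1 <= t < r) \prod_(1 <= s < t.+1) G t.+1 s.
Proof.
have -> : \prod_(1 <= t < r) \prod_(1 <= s < t.+1) G t.+1 s =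
          \prod_(1 <= t < r.+1) \prod_(1 <= s < t) G t s.
  rewrite [RHS]big_add1 /=; case: r => [|r]; first by rewrite !big_geq.
  by rewrite [RHS]big_ltn // [X in _ = X * _]big_geq // mul1r.
rewrite -big_split; apply: eq_big_nat => t /andP[t1 _] /=.
by rewrite big_nat_recr //= mulrC.
Qed.

(** The bracket of two plane vectors satisfies the three-term relation. Column j of the
    matrix below is a product of brackets of x with the vectors a_t for t > j and b_t for
    1 <= t <= j, a product form of the determinants of Krattenthaler type. *)
Section Bracket.
Variable F : comNzRingType.
Implicit Types x y a b : F * F.

Definition bracket x y := x.1 * y.2 - x.2 * y.1.

Lemma bracket_plucker x y a b :
  bracket x a * bracket y b - bracket x b * bracket y a = bracket x y * bracket a b.
Proof. by rewrite /bracket; ring. Qed.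

Definition kentry (a b : nat -> F * F) r x j : F :=
  \prod_(j.+1 <= t < r) bracket x (a t) * \prod_(1 <= t < j.+1) bracket x (b t).

Definition kdet (a b x : nat -> F * F) r : F :=
  \prod_(0 <= i < r) \prod_(i.+1 <= j < r) bracket (x i) (x j) *
  \prod_(1 <= t < r) \prod_(1 <= s < t.+1) bracket (a t) (b s).

(** The three-term relation makes a combination of neighbouring columns a column of the
    matrix of size r, up to a factor that vanishes for x = y. *)
Lemma kentry_comb (a b : nat -> F * F) r x y j : (j < r)%N ->
  bracket x (a j.+1) * kentry a b r.+1 y j.+1 - bracket x (b j.+1) * kentry a b r.+1 y j =
  bracket x y * bracket (a j.+1) (b j.+1) * kentry (fun t => a t.+1) b r y j.
Proof.
move=> jr; rewrite -bracket_plucker /kentry.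
rewrite (big_nat_recr j.+1 1) //= (big_ltn (_ : (j.+1 < r.+1)%N)) //.
rewrite (big_add1 _ _ j.+1 r.+1) /=.
by ring.
Qed.
End Bracket.

(** Combining neighbouring columns with the coefficients that kill row 0 is right
    multiplication by a bidiagonal matrix L; expansion along row 0 leaves the determinant
    of size r. The diagonal of L is invertible because the brackets are nonzero. *)
Lemma kdet_nz (F : idomainType) (a b : nat -> F * F) r (x : nat -> F * F) :
  (forall i t, bracket _ (x i) (a t) != 0) ->
  \det (\matrix_(i < r, j < r) kentry _ a b r (x i) j) = kdet _ a b x r.
Proof.
elim: r a x => [|r IH] a x xa; first by rewrite det_mx00 /kdet !big_geq ?mulr1.
pose M := \matrix_(i < r.+1, j < r.+1) kentry _ a b r.+1 (x i) j.
pose L := \matrix_(i < r.+1, j < r.+1)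
  (if i == j then (if j == 0%N :> nat then 1 else bracket _ (x 0%N) (a j)) else
   if j == i.+1 :> nat then - bracket _ (x 0%N) (b j) else 0).
have detL : \det L = \prod_(1 <= t < r.+1) bracket _ (x 0%N) (a t).
  rewrite -det_tr det_trig; last first.
    apply/is_trig_mxP => i j ij; rewrite !mxE -val_eqE /=.
    by rewrite (gtn_eqF ij); case: eqP => // e; lia.
  rewrite big_ord_recl !mxE eqxx mul1r big_add1 big_mkord.
  by apply: eq_bigr => i _; rewrite !mxE eqxx.
have ML0 i : (M *m L) i ord0 = kentry _ a b r.+1 (x i) 0.
  rewrite !mxE (bigD1 ord0) //= !mxE eqxx mulr1 big1 ?addr0 // => k k0.
  by rewrite !mxE (negbTE k0) mulr0.
have MLS i (j : 'I_r) : (M *m L) i (lift ord0 j) =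
    bracket _ (x 0%N) (x i) * bracket _ (a j.+1) (b j.+1) * kentry _ (fun t => a t.+1) b r (x i) j.
  rewrite -kentry_comb // !mxE (bigD1 (lift ord0 j)) //= (bigD1 (widen_ord (leqnSn r) j)) /=; last first.
    by rewrite -val_eqE /= /bump /=; lia.
  rewrite !mxE eqxx /= big1 ?addr0 => [|k /andP[k1 k2]]; last first.
    rewrite !mxE (negbTE k1); case: eqP => [e|]; rewrite ?mulr0 //.
    by case/negP: k2; rewrite -val_eqE /=; move: e; rewrite /= /bump /=; lia.
  rewrite -val_eqE /= /bump /= add1n (ltn_eqF (ltnSn j)) eqxx /=.
  by rewrite mulrN [X in _ - X]mulrC [X in X - _]mulrC.
have detML : \det (M *m L) = \det L * (\prod_(1 <= t < r.+1) bracket _ (x 0%N) (x t) *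
    \prod_(1 <= t < r.+1) bracket _ (a t) (b t) *
    kdet _ (fun t => a t.+1) b (fun i => x i.+1) r).
  rewrite (expand_det_row _ ord0) big_ord_recl ML0 big1 ?addr0; last first.
    by move=> j _; rewrite MLS /bracket [X in X - _]mulrC subrr !mul0r.
  rewrite detL /kentry. rewrite [X in _ * X * cofactor _ _ _]big_geq // mulr1; congr (_ * _).
  rewrite /cofactor /= expr0 mul1r -IH //.
  rewrite !big_add1 !big_mkord -det_scale; congr (\det _).
  by apply/matrixP => i j; rewrite 2![LHS]mxE MLS !mxE.
have L0 : \det L != 0 by rewrite detL prodf_seq_neq0; apply/allP => t _ /=; exact: xa.
apply: (mulIf L0); rewrite -det_mulmx detML mulrC; congr (_ * _).
rewrite /kdet [in RHS]big_nat_recl // prod_triangle_shift.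
have -> : \prod_(0 <= i < r) \prod_(i.+2 <= j < r.+1) bracket F (x i.+1) (x j) =
          \prod_(0 <= i < r) \prod_(i.+1 <= j < r) bracket F (x i.+1) (x j.+1).
  by apply: eq_bigr => i _; rewrite big_add1.
by ring.
Qed.

(** Both sides are polynomials in the coordinates. Perturbing the first coordinate of
    x_i and the second one of a_t by an indeterminate makes every bracket monic of degree
    2; the indeterminate is then set to 0. *)
Lemma kdetE (F : idomainType) (a b : nat -> F * F) r (x : nat -> F * F) :
  \det (\matrix_(i < r, j < r) kentry _ a b r (x i) j) = kdet _ a b x r.
Proof.
pose x' i : {poly F} * {poly F} := ((x i).1%:P + 'X, (x i).2%:P).
pose a' i : {poly F} * {poly F} := ((a i).1%:P, (a i).2%:P + 'X).
pose b' i : {poly F} * {poly F} := ((b i).1%:P, (b i).2%:P).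
have xa' i t : bracket _ (x' i) (a' t) != 0.
  apply/eqP => /(congr1 (fun p : {poly F} => p`_2)).
  have -> : bracket _ (x' i) (a' t) =
     'X^2 + ((x i).1 + (a t).2)%:P * 'X + ((x i).1 * (a t).2 - (x i).2 * (a t).1)%:P.
    by rewrite /bracket /= polyCB !polyCM polyCD; ring.
  rewrite !coefD coefXn coefCM coefX coefC /= mulr0 !addr0 coef0.
  by move/eqP; rewrite oner_eq0.
have := kdet_nz _ a' b' r x' xa' => /(congr1 (horner_eval 0)).
have br0 (u v : {poly F} * {poly F}) : horner_eval 0 (bracket _ u v) =
   bracket _ (horner_eval 0 u.1, horner_eval 0 u.2) (horner_eval 0 v.1, horner_eval 0 v.2).
  by rewrite /bracket rmorphB !rmorphM.
have x0 i : (horner_eval 0 (x' i).1, horner_eval 0 (x' i).2) = x i.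
  by rewrite /horner_eval /= !hornerE; case: (x i).
have a0 i : (horner_eval 0 (a' i).1, horner_eval 0 (a' i).2) = a i.
  by rewrite /horner_eval /= !hornerE; case: (a i).
have b0 i : (horner_eval 0 (b' i).1, horner_eval 0 (b' i).2) = b i.
  by rewrite /horner_eval /= !hornerE; case: (b i).
have brxa i t : horner_eval 0 (bracket _ (x' i) (a' t)) = bracket _ (x i) (a t) by rewrite br0 x0 a0.
have brxb i t : horner_eval 0 (bracket _ (x' i) (b' t)) = bracket _ (x i) (b t) by rewrite br0 x0 b0.
have brxx i j : horner_eval 0 (bracket _ (x' i) (x' j)) = bracket _ (x i) (x j) by rewrite br0 !x0.
have brab i j : horner_eval 0 (bracket _ (a' i) (b' j)) = bracket _ (a i) (b j) by rewrite br0 a0 b0.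
rewrite -det_map_mx /kdet rmorphM !rmorph_prod => e.
etransitivity; first (etransitivity; last exact: e).
  congr (\det _); apply/matrixP => i j; rewrite !mxE /kentry rmorphM !rmorph_prod.
  by congr (_ * _); apply: eq_bigr => t _; symmetry; [exact: brxa | exact: brxb].
congr (_ * _); apply: eq_bigr => i _; rewrite rmorph_prod; apply: eq_bigr => j _.
  exact: brxx.
exact: brab.
Qed.

(** * Determinants of theta products *)

Lemma prod_lt_ord (F : comNzRingType) r (G : nat -> nat -> F) :
  \prod_(0 <= i < r) \prod_(i.+1 <= j < r) G i j =
  \prod_(i < r) \prod_(j < r | (i < j)%N) G i j.
Proof.
rewrite big_mkord; apply: eq_bigr => i _.
by rewrite big_geq_mkord.
Qed.

Lemma sign_triangles (F : comNzRingType) r :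
  \prod_(0 <= i < r) \prod_(i.+1 <= j < r) (-1 : F) *
  \prod_(1 <= t < r) \prod_(1 <= s < t.+1) (-1) = 1.
Proof.
elim: r => [|r IH]; first by rewrite !big_geq ?mulr1.
rewrite prod_triangle_shift big_nat_recl // -[RHS]IH.
have -> : \prod_(0 <= i < r) \prod_(i.+2 <= j < r.+1) (-1) =
          \prod_(0 <= i < r) \prod_(i.+1 <= j < r) (-1 : F).
  by apply: eq_bigr => i _; rewrite big_add1.
set a := \prod_(1 <= i < r.+1) _; set b := \prod_(0 <= i < r) _; set c := \prod_(1 <= t < r) _.
have aa : a * a = 1 by rewrite -big_split big1 //= => i _; rewrite mulrNN mulr1.
by rewrite mulrACA aa mul1r.
Qed.

Lemma prodN1_mul (F : comNzRingType) (r : nat) (G H : nat -> nat -> F) :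
  \prod_(0 <= i < r) \prod_(i.+1 <= j < r) (- G i j) *
  \prod_(1 <= t < r) \prod_(1 <= s < t.+1) (- H t s) =
  \prod_(0 <= i < r) \prod_(i.+1 <= j < r) G i j *
  \prod_(1 <= t < r) \prod_(1 <= s < t.+1) H t s.
Proof.
have e1 : \prod_(0 <= i < r) \prod_(i.+1 <= j < r) (- G i j) =
  \prod_(0 <= i < r) \prod_(i.+1 <= j < r) (-1) * \prod_(0 <= i < r) \prod_(i.+1 <= j < r) G i j.
  by rewrite -big_split; apply: eq_bigr => i _ /=; rewrite -big_split; apply: eq_bigr => j _ /=; rewrite mulN1r.
have e2 : \prod_(1 <= t < r) \prod_(1 <= s < t.+1) (- H t s) =
  \prod_(1 <= t < r) \prod_(1 <= s < t.+1) (-1) * \prod_(1 <= t < r) \prod_(1 <= s < t.+1) H t s.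
  by rewrite -big_split; apply: eq_bigr => i _ /=; rewrite -big_split; apply: eq_bigr => j _ /=; rewrite mulN1r.
by rewrite e1 e2 mulrACA sign_triangles mul1r.
Qed.

Section ThetaDet.
Variables (F : fieldType) (th : F -> F).
Hypothesis thV : forall x, x != 0 -> th x^-1 = - th x / x.
Hypothesis add : addition_formula F th.
Hypothesis sqrt : forall c : F, exists d, d ^+ 2 = c.
Hypothesis nontriv : exists2 z, z != 0 & th z != 0.

(** The theta product of the addition formula, with the scaling constant c moved into
    the first factor. *)
Definition th2 c x y := th (c * x * y) * th (x / y).
Definition tbr c x y := th2 c x y / x.

Lemma tbr_anti c x y : x != 0 -> y != 0 -> tbr c y x = - tbr c x y.
Proof.
move=> x0 y0; rewrite /tbr /th2.
have -> : y / x = (x / y)^-1 by rewrite invfM invrK mulrC.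
rewrite thV ?mulf_neq0 ?invr_eq0 //.
have -> : c * y * x = c * x * y by ring.
by field; rewrite x0 y0.
Qed.

(** The addition formula at d x, d y, d a, d b for a square root d of c. *)
Lemma tbr_plucker c x y a b : c != 0 -> x != 0 -> y != 0 -> a != 0 -> b != 0 ->
  tbr c x a * tbr c y b - tbr c x b * tbr c y a = tbr c x y * tbr c a b.
Proof.
move=> c0 x0 y0 a0 b0; have [d dc] := sqrt c.
have d0 : d != 0 by apply: contraNneq c0 => d0; rewrite -dc d0 expr0n.
have nz z : z != 0 -> d * z != 0 by move=> z0; rewrite mulf_neq0.
have := add (d * x) (d * a) (d * y) (d * b) (nz _ x0) (nz _ a0) (nz _ y0) (nz _ b0).
have dm u v : d * u * (d * v) = c * u * v by rewrite -dc; ring.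
have dv u v : d * u / (d * v) = u / v by rewrite -mulf_div divff // mul1r.
rewrite !dm !dv /tbr /th2 => e.
have -> : th (c * x * a) * th (x / a) / x * (th (c * y * b) * th (y / b) / y) -
   th (c * x * b) * th (x / b) / x * (th (c * y * a) * th (y / a) / y) =
  (th (c * x * a) * th (x / a) * (th (c * y * b) * th (y / b)) -
   th (c * x * b) * th (x / b) * (th (c * y * a) * th (y / a))) / (x * y).
  by field; rewrite x0 y0.
by rewrite e; field; rewrite x0 y0 a0.
Qed.

Lemma tbr_nontriv c : c != 0 ->
  exists e, [/\ e.1 != 0, e.2 != 0 & tbr c e.1 e.2 != 0].
Proof.
move=> c0; have [d dc] := sqrt c; have [z z0 thz] := nontriv.
have d0 : d != 0 by apply: contraNneq c0 => d0; rewrite -dc d0 expr0n.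
have e1 : d ^+ 2 * (z / d) / d = z by field.
have e2 : z / d / d^-1 = z by rewrite invrK divfK.
have zd : z / d != 0 by rewrite mulf_neq0 ?invr_eq0.
have dV : d^-1 != 0 by rewrite invr_eq0.
exists (z / d, d^-1); split => //=.
by rewrite /tbr /th2 -dc e1 e2 mulf_neq0 ?invr_eq0 // mulf_neq0.
Qed.

(** With a fixed pair e of nonzero bracket, the coordinates tbr x e_1 and tbr x e_2 turn
    the normalized theta product into a bracket of plane vectors, by the addition formula.
    The factors lam, rho and sg scale these vectors. *)
Lemma theta_det c r (lam xi : nat -> F) (rho sg eta zeta : nat -> F) : c != 0 ->
  (forall i, xi i != 0) -> (forall t, eta t != 0) -> (forall t, zeta t != 0) ->
  \det (\matrix_(i < r, j < r)
    (\prod_(j.+1 <= t < r) (lam i * rho t * tbr c (xi i) (eta t)) *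
     \prod_(1 <= t < j.+1) (lam i * sg t * tbr c (xi i) (zeta t)))) =
  \prod_(0 <= i < r) \prod_(i.+1 <= j < r) (lam i * lam j * tbr c (xi i) (xi j)) *
  \prod_(1 <= t < r) \prod_(1 <= s < t.+1) (rho t * sg s * tbr c (eta t) (zeta s)).
Proof.
move=> c0 xi0 eta0 zeta0; have [[e1 e2] /= [e10 e20 en]] := tbr_nontriv c c0.
pose vec (l x : F) : F * F := (l * tbr c x e1, l * tbr c x e2 / tbr c e1 e2).
have vecE l x m y : x != 0 -> y != 0 -> bracket _ (vec l x) (vec m y) = l * m * tbr c x y.
  move=> x0 y0; rewrite /bracket /=.
  have -> : tbr c x y = (tbr c x e1 * tbr c y e2 - tbr c x e2 * tbr c y e1) / tbr c e1 e2.
    by rewrite tbr_plucker // mulfK.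
  by field.
have := kdetE F (fun t => vec (rho t) (eta t)) (fun t => vec (sg t) (zeta t)) r
  (fun i => vec (lam i) (xi i)).
have -> : \matrix_(i < r, j < r) kentry F (fun t => vec (rho t) (eta t))
    (fun t => vec (sg t) (zeta t)) r (vec (lam i) (xi i)) j =
  \matrix_(i < r, j < r)
    (\prod_(j.+1 <= t < r) (lam i * rho t * tbr c (xi i) (eta t)) *
     \prod_(1 <= t < j.+1) (lam i * sg t * tbr c (xi i) (zeta t))).
  apply/matrixP => i j; rewrite !mxE /kentry.
  by congr (_ * _); apply: eq_bigr => t _; rewrite vecE.
move->; rewrite /kdet; congr (_ * _).
  by apply: eq_bigr => i _; apply: eq_bigr => j _; rewrite vecE.
by apply: eq_bigr => i _; apply: eq_bigr => j _; rewrite vecE.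
Qed.

(** Exchanging the arguments of the normalized theta product costs a sign and a monomial.
    The four forms fix the orders of the arguments in which the path generating functions
    present themselves, so that no power of -1 appears. *)
Section Orientations.
Variables (c : F) (r : nat) (xi : 'I_r -> F) (eta zeta : nat -> F).
Hypotheses (c0 : c != 0) (xi0 : forall i, xi i != 0).
Hypotheses (eta0 : forall t, eta t != 0) (zeta0 : forall t, zeta t != 0).

Let ext (n : nat) : F := if insub n is Some i then xi i else 1.
Let extE (i : 'I_r) : ext i = xi i. Proof. by rewrite /ext valK. Qed.
Let ext0 n : ext n != 0.
Proof. by rewrite /ext; case: insubP => [i _ _|_]; rewrite ?oner_neq0. Qed.

Let ordE (G : F -> F -> F) :
  \prod_(0 <= i < r) \prod_(i.+1 <= j < r) G (ext i) (ext j) =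
  \prod_(i < r) \prod_(j < r | (i < j)%N) G (xi i) (xi j).
Proof.
rewrite (prod_lt_ord F r (fun i j => G (ext i) (ext j))).
by apply: eq_bigr => i _; apply: eq_bigr => j _; rewrite !extE.
Qed.

Lemma theta_det1 :
  \det (\matrix_(i < r, j < r)
    (\prod_(j.+1 <= t < r) th2 c (xi i) (eta t) *
     \prod_(1 <= t < j.+1) th2 c (xi i) (zeta t))) =
  \prod_(i < r) \prod_(j < r | (i < j)%N) (xi j * th2 c (xi i) (xi j)) *
  \prod_(1 <= t < r) \prod_(1 <= s < t.+1) (th2 c (eta t) (zeta s) / eta t).
Proof.
have := theta_det c r ext ext (fun=> 1) (fun=> 1) eta zeta c0 ext0 eta0 zeta0.
rewrite (ordE (fun x y => x * y * tbr c x y)) => e.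
etransitivity; first (etransitivity; last exact: e).
  congr (\det _); apply/matrixP => i j; rewrite !mxE extE.
  by congr (_ * _); apply: eq_bigr => t _; rewrite /tbr mulr1 mulrC divfK.
congr (_ * _); apply: eq_bigr => i _; apply: eq_bigr => j _.
  by rewrite /tbr; field; exact: xi0.
by rewrite /tbr !mul1r.
Qed.

Lemma theta_det2 :
  \det (\matrix_(i < r, j < r)
    (\prod_(j.+1 <= t < r) th2 c (eta t) (xi i) *
     \prod_(1 <= t < j.+1) (th2 c (xi i) (zeta t) / xi i))) =
  \prod_(i < r) \prod_(j < r | (i < j)%N) (th2 c (xi j) (xi i) / xi j) *
  \prod_(1 <= t < r) \prod_(1 <= s < t.+1) th2 c (eta t) (zeta s).
Proof.
have := theta_det c r (fun=> 1) ext (fun t => - eta t) (fun=> 1) eta zeta c0 ext0 eta0 zeta0.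
rewrite -prodN1_mul (ordE (fun x y => - (1 * 1 * tbr c x y))) => e.
etransitivity; first (etransitivity; last exact: e).
  congr (\det _); apply/matrixP => i j; rewrite !mxE extE.
  congr (_ * _); apply: eq_bigr => t _; last by rewrite !mul1r.
  by rewrite mul1r mulNr -mulrN -tbr_anti // /tbr mulrC divfK.
congr (_ * _); apply: eq_bigr => i _; apply: eq_bigr => j _.
  by rewrite !mul1r -tbr_anti.
by rewrite mulr1 mulNr opprK /tbr mulrC divfK.
Qed.

Lemma theta_det3 :
  \det (\matrix_(i < r, j < r)
    (\prod_(j.+1 <= t < r) (th2 c (xi i) (eta t) / xi i) *
     \prod_(1 <= t < j.+1) th2 c (zeta t) (xi i))) =
  \prod_(i < r) \prod_(j < r | (i < j)%N) (th2 c (xi i) (xi j) / xi i) *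
  \prod_(1 <= t < r) \prod_(1 <= s < t.+1) th2 c (zeta s) (eta t).
Proof.
have := theta_det c r (fun=> 1) ext (fun=> 1) (fun t => - zeta t) eta zeta c0 ext0 eta0 zeta0.
rewrite (ordE (fun x y => 1 * 1 * tbr c x y)) => e.
etransitivity; first (etransitivity; last exact: e).
  congr (\det _); apply/matrixP => i j; rewrite !mxE extE.
  congr (_ * _); apply: eq_bigr => t _; first by rewrite !mul1r.
  by rewrite mul1r mulNr -mulrN -tbr_anti // /tbr mulrC divfK.
congr (_ * _); apply: eq_bigr => i _; apply: eq_bigr => j _.
  by rewrite !mul1r.
by rewrite mul1r mulNr -mulrN -tbr_anti // /tbr mulrC divfK.
Qed.

Lemma theta_det4 :
  \det (\matrix_(i < r, j < r)
    (\prod_(j.+1 <= t < r) th2 c (eta t) (xi i) *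
     \prod_(1 <= t < j.+1) th2 c (zeta t) (xi i))) =
  \prod_(i < r) \prod_(j < r | (i < j)%N) (th2 c (xi j) (xi i) / xi j) *
  \prod_(1 <= t < r) \prod_(1 <= s < t.+1) (eta t * th2 c (zeta s) (eta t)).
Proof.
have := theta_det c r (fun=> 1) ext (fun t => - eta t) (fun t => - zeta t) eta zeta c0 ext0 eta0 zeta0.
rewrite -prodN1_mul (ordE (fun x y => - (1 * 1 * tbr c x y))) => e.
etransitivity; first (etransitivity; last exact: e).
  congr (\det _); apply/matrixP => i j; rewrite !mxE extE.
  by congr (_ * _); apply: eq_bigr => t _;
     rewrite mul1r mulNr -mulrN -tbr_anti // /tbr mulrC divfK.
congr (_ * _); apply: eq_bigr => i _; apply: eq_bigr => j _.
  by rewrite !mul1r -tbr_anti.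
rewrite mulrNN -!mulrA -mulrN -mulrN -tbr_anti // /tbr.
by congr (_ * _); rewrite mulrC divfK.
Qed.

End Orientations.
End ThetaDet.
Arguments theta_det1 {F th} add sqrt nontriv {c r xi eta zeta} c0 xi0 eta0 zeta0.
Arguments theta_det2 {F th} thV add sqrt nontriv {c r xi eta zeta} c0 xi0 eta0 zeta0.
Arguments theta_det3 {F th} thV add sqrt nontriv {c r xi eta zeta} c0 xi0 eta0 zeta0.
Arguments theta_det4 {F th} thV add sqrt nontriv {c r xi eta zeta} c0 xi0 eta0 zeta0.

(** * Lattice paths *)

Section LatticePaths.
Implicit Types (u v x y : lpoint) (P Q : seq lpoint).

Definition height x : int := x.1 + x.2.

Lemma lattice_stepP u v : lattice_step u v ->
  [/\ height v = height u + 1, u.1 <= v.1 <= u.1 + 1 & u.2 <= v.2 <= u.2 + 1].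
Proof.
rewrite /lattice_step /hstep /vstep /height.
by case: u => u1 u2; case: v => v1 v2 /orP[] /eqP[-> ->] /=; split; lia.
Qed.

Lemma lattice_paths_cons u v P : lattice_paths u v P ->
  exists s, [/\ P = u :: s, path lattice_step u s & last u s = v].
Proof. by case: P => [|w s] [] //= ps [<-] lv; exists s; split. Qed.

Lemma path_nth_step u s k : path lattice_step u s -> (k < size s)%N ->
  lattice_step (nth u (u :: s) k) (nth u (u :: s) k.+1).
Proof. by move/(pathP u) => /(_ k). Qed.

Lemma path_nth_height u s k : path lattice_step u s -> (k <= size s)%N ->
  height (nth u (u :: s) k) = height u + k%:Z.
Proof.
move=> ps; elim: k => [|k IH] ks; first by rewrite addr0.
have [-> _ _] := lattice_stepP _ _ (path_nth_step _ _ _ ps ks).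
by rewrite IH ?(ltnW ks) //; lia.
Qed.

Lemma path_nth_mono u s j k : path lattice_step u s -> (j <= k <= size s)%N ->
  (nth u (u :: s) j).1 <= (nth u (u :: s) k).1 /\
  (nth u (u :: s) j).2 <= (nth u (u :: s) k).2.
Proof.
move=> ps; elim: k => [|k IH] /andP[jk ks].
  by have -> : j = 0%N by lia.
have [->|jk'] := eqVneq j k.+1; first by [].
have [|h1 h2] := IH; first by rewrite (ltnW ks) andbT; clear -jk jk'; lia.
have [_ /andP[a _] /andP[b _]] := lattice_stepP _ _ (path_nth_step _ _ _ ps ks).
by split; [apply: le_trans h1 a | apply: le_trans h2 b].
Qed.

Lemma lattice_paths_size u v P : lattice_paths u v P ->
  height v = height u + (size P).-1%:Z.
Proof.
move=> /lattice_paths_cons[s [-> ps <-]] /=.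
by rewrite -(path_nth_height u s (size s)) // -[in RHS]last_nth.
Qed.

Lemma lattice_paths_uniq u v P : lattice_paths u v P -> uniq P.
Proof.
move=> [sP _ _]; apply: (@sorted_uniq _ (fun x y => height x < height y)).
- by move=> x y z; apply: lt_trans.
- by move=> x; rewrite ltxx.
by apply: sub_sorted sP => x y /lattice_stepP[-> _ _]; rewrite ltrDl.
Qed.

Lemma discrete_ivt (d : nat -> int) n : 0 <= d 0%N -> d n <= 0 ->
  (forall k, (k < n)%N -> `|d k.+1 - d k| <= 1) -> exists2 k, (k <= n)%N & d k = 0.
Proof.
elim: n => [|n IH] d0 dn step.
  by exists 0%N => //; apply/eqP; rewrite eq_le dn d0.
have [dn0|dn0] := leP (d n) 0.
  have [|k kn dk] := IH d0 dn0; first by move=> k kn; apply: step; lia.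
  by exists k => //; lia.
by exists n.+1 => //; have := step n (ltnSn n); lia.
Qed.

Definition northwest x y := (x.1 <= y.1) && (y.2 <= x.2).

(** Compare the paths at equal height. The difference of the abscissae changes by at
    most 1 at each step; it is nonnegative where the later path starts and nonpositive
    where the first of them ends, hence it vanishes in between. *)
Lemma crossing u v u' v' P Q : lattice_paths u v P -> lattice_paths u' v' Q ->
  northwest u u' -> northwest v' v -> exists x, x \in P /\ x \in Q.
Proof.
move=> /lattice_paths_cons[s [-> ps lv]] /lattice_paths_cons[s' [-> ps' lv']].
move=> /andP[uu1 uu2] /andP[vv1 vv2].
have hP k := path_nth_height u s k ps; have hQ k := path_nth_height u' s' k ps'.
have mP j k := path_nth_mono u s j k ps; have mQ j k := path_nth_mono u' s' j k ps'.
have eP : nth u (u :: s) (size s) = v by rewrite -lv (last_nth u).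
have eQ : nth u' (u' :: s') (size s') = v' by rewrite -lv' (last_nth u').
have hv := hP _ (leqnn _); have hv' := hQ _ (leqnn _); rewrite eP in hv; rewrite eQ in hv'.
have /= [P1 P2] := mP 0%N (size s) (leqnn _); rewrite eP in P1 P2.
have /= [Q1 Q2] := mQ 0%N (size s') (leqnn _); rewrite eQ in Q1 Q2.
pose a := absz (Num.max 0 (height u' - height u)).
pose b := absz (Num.max 0 (height u - height u')).
have ab : height u + a%:Z = height u' + b%:Z by rewrite /a /b; lia.
pose n := minn (size s - a) (size s' - b).
have sa : (a <= size s)%N by move: hv hv'; rewrite /a /height in uu1 uu2 *; lia.
have sb : (b <= size s')%N by move: hv hv'; rewrite /b /height in uu1 uu2 *; lia.
pose d k := (nth u' (u' :: s') (b + k)).1 - (nth u (u :: s) (a + k)).1.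
have [||k kn|k kn dk] := discrete_ivt d n.
- rewrite /d !addn0; have [p1 p2] := mP 0%N a sa; have [q1 q2] := mQ 0%N b sb.
  have := hP a sa; have := hQ b sb; move: p1 p2 q1 q2 => /=.
  rewrite /height; move: (nth u _ _) (nth u' _ _) => pa pb.
  move: ab; rewrite /a /b /height; lia.
- rewrite /d; have sa' : (a + n <= size s)%N by rewrite /n; lia.
  have sb' : (b + n <= size s')%N by rewrite /n; lia.
  have [|p1 p2] := mP (a + n)%N (size s); first by rewrite sa' leqnn.
  have [|q1 q2] := mQ (b + n)%N (size s'); first by rewrite sb' leqnn.
  have := hP _ sa'; have := hQ _ sb'; move: p1 p2 q1 q2; rewrite eP eQ.
  have : (a + n = size s)%N \/ (b + n = size s')%N by rewrite /n; lia.
  move: hv hv' ab; rewrite /height; move: (nth u _ _) (nth u' _ _) => pa pb.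
  clear -vv1 vv2; lia.
- have ka : (a + k < size s)%N by move: kn; rewrite /n; lia.
  have kb : (b + k < size s')%N by move: kn; rewrite /n; lia.
  have [_ p _] := lattice_stepP _ _ (path_nth_step _ _ _ ps ka).
  have [_ q _] := lattice_stepP _ _ (path_nth_step _ _ _ ps' kb).
  by rewrite /d !addnS; lia.
have ka : (a + k <= size s)%N by move: kn; rewrite /n; lia.
have kb : (b + k <= size s')%N by move: kn; rewrite /n; lia.
exists (nth u (u :: s) (a + k)); split; first by rewrite mem_nth //=; lia.
have -> : nth u (u :: s) (a + k) = nth u' (u' :: s') (b + k).
  have e1 : (nth u (u :: s) (a + k)).1 = (nth u' (u' :: s') (b + k)).1.
    by move: dk; rewrite /d; lia.
  have e2 : (nth u (u :: s) (a + k)).2 = (nth u' (u' :: s') (b + k)).2.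
    by move: ab e1 (hP _ ka) (hQ _ kb); rewrite /height; clear; lia.
  by rewrite [LHS]surjective_pairing [RHS]surjective_pairing e1 e2.
by rewrite mem_nth //=; lia.
Qed.
End LatticePaths.

(** * Generating functions of lattice paths *)

Section PathGeneratingFunctions.
Implicit Types (u v x y : lpoint) (P Q : seq lpoint).

(** The paths with d steps, enumerated by their last step; sums over the set of paths
    become sums over a list. *)
Fixpoint path_list (d : nat) u v : seq (seq lpoint) :=
  if d is d'.+1 then
    [seq rcons P v | P <- path_list d' u (v.1 - 1, v.2) ++ path_list d' u (v.1, v.2 - 1)]
  else if u == v then [:: [:: u]] else [::].

Lemma lattice_step_pred w v : lattice_step w v = (w == (v.1 - 1, v.2)) || (w == (v.1, v.2 - 1)).
Proof.
rewrite /lattice_step /hstep /vstep; case: w v => w1 w2 [v1 v2] /=.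
by rewrite !xpair_eqE; apply/idP/idP => /orP[] /andP[/eqP ? /eqP ?]; apply/orP; lia.
Qed.

Lemma lattice_paths_rcons u v y P : P != [::] ->
  lattice_paths u v (rcons P y) <->
  y = v /\ (lattice_paths u (v.1 - 1, v.2) P \/ lattice_paths u (v.1, v.2 - 1) P).
Proof.
case: P => // a s _; rewrite /lattice_paths /= last_rcons rcons_path; split.
  move=> [/andP[ps e] [au] yv]; rewrite yv in e *; split => //.
  by move: e; rewrite lattice_step_pred => /orP[] /eqP e; [left|right]; rewrite -au.
move=> [-> h]; have e : lattice_step (last a s) v.
  by rewrite lattice_step_pred; case: h => -[_ _ ->]; rewrite eqxx ?orbT.
by case: h => -[ps [au] _]; split; rewrite ?ps ?e ?au.
Qed.

Lemma mem_path_list d u v P :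
  reflect (lattice_paths u v P /\ size P = d.+1) (P \in path_list d u v).
Proof.
elim: d v P => [|d IH] v P /=.
  apply: (iffP idP).
    by case: eqP => // -> ; rewrite inE => /eqP ->.
  case; case: P => [|w [|? ?]] // [_ [->] /= ->] _.
  by rewrite eqxx inE.
apply: (iffP mapP) => [[Q Qin ->]|[hP sP]].
  have {Qin}: (Q \in path_list d u (v.1 - 1, v.2)) \/ (Q \in path_list d u (v.1, v.2 - 1)).
    by move: Qin; rewrite mem_cat => /orP[]; [left|right].
  by case=> /IH[hQ sQ]; rewrite size_rcons sQ; split => //;
     apply/lattice_paths_rcons; rewrite -?size_eq0 ?sQ //; split => //; [left|right].
case: (lastP P) hP sP => [//|Q y] hP; rewrite size_rcons => -[sQ].
have Q0 : Q != [::] by rewrite -size_eq0 sQ.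
move/(lattice_paths_rcons _ _ _ _ Q0): hP => [-> h].
exists Q => //; rewrite mem_cat; apply/orP.
by case: h => h; [left|right]; apply/IH.
Qed.

Lemma path_list_uniq d u v : uniq (path_list d u v).
Proof.
elim: d v => [|d IH] v /=; first by case: ifP.
rewrite map_inj_uniq; last by apply: rcons_injl.
rewrite cat_uniq !IH andbT /=; apply/hasPn => P /mem_path_list[[_ _ lP] _].
by apply/negP => /mem_path_list[[_ _ lP'] _]; move: lP'; rewrite lP => -[]; lia.
Qed.

Definition dist u v : nat := absz (height v - height u).

Lemma mem_path_list_dist u v P : reflect (lattice_paths u v P) (P \in path_list (dist u v) u v).
Proof.
apply: (iffP (mem_path_list _ _ _ _)) => [[]//|h]; split => //.
have [s [e _ _]] := lattice_paths_cons _ _ _ h.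
have := lattice_paths_size _ _ _ h; rewrite e /= /dist => ->; lia.
Qed.

Section Weights.
Variables (C : numFieldType) (a b q p : C).
Local Notation pw := (path_weight a b q p).
Local Notation gf := (path_gf a b q p).

Lemma path_gf_list u v : gf u v = \sum_(P <- path_list (dist u v) u v) pw P.
Proof.
rewrite fsbig_seq ?path_list_uniq // /path_gf.
suff -> : lattice_paths u v = [set` path_list (dist u v) u v] by [].
by apply/seteqP; split => P /=; move/mem_path_list_dist.
Qed.

Lemma zip_behead_cat x (s1 s2 : seq lpoint) :
  zip (s1 ++ x :: s2) (behead (s1 ++ x :: s2)) =
  zip (rcons s1 x) (behead (rcons s1 x)) ++ zip (x :: s2) s2.
Proof.
elim: s1 => [//|y s1 IH].
by case: s1 IH => [|z s1] //= ->.
Qed.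

Lemma path_weight_cat x (s1 s2 : seq lpoint) :
  pw (s1 ++ x :: s2) = pw (rcons s1 x) * pw (x :: s2).
Proof. by rewrite /path_weight zip_behead_cat big_cat. Qed.

Lemma path_weight1 x : pw [:: x] = 1.
Proof. by rewrite /path_weight big_nil. Qed.

Lemma path_weight_rcons x y (s : seq lpoint) :
  pw (rcons (rcons s x) y) = pw (rcons s x) * (if hstep x y then edge_weight a b q p y.1 y.2 else 1).
Proof.
rewrite -(cats1 _ y) cat_rcons path_weight_cat; congr (_ * _).
by rewrite /path_weight /= big_cons big_nil; case: ifP => _; rewrite ?mulr1.
Qed.

Lemma path_gf_id u : gf u u = 1.
Proof.
by rewrite path_gf_list /dist subrr /= eqxx big_seq1 path_weight1.
Qed.

Lemma path_gf_empty u v : ~~ ((u.1 <= v.1) && (u.2 <= v.2)) -> gf u v = 0.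
Proof.
move=> uv; rewrite path_gf_list big_seq big1 // => P /mem_path_list_dist h.
case/negP: uv; have [s [_ ps lv]] := lattice_paths_cons _ _ _ h.
have := path_nth_mono u s 0 (size s) ps (leqnn _).
by rewrite -(last_nth u) lv /= => -[-> ->].
Qed.

Lemma path_gf_rec u v : height u < height v ->
  gf u v = gf u (v.1 - 1, v.2) * edge_weight a b q p v.1 v.2 + gf u (v.1, v.2 - 1).
Proof.
move=> uv; rewrite !path_gf_list.
have [d dE] : exists d, dist u v = d.+1.
  by exists (dist u v).-1; move: uv; rewrite /dist /height; lia.
have -> : dist u (v.1 - 1, v.2) = d.
  by move: uv dE; rewrite /dist /height /=; lia.
have -> : dist u (v.1, v.2 - 1) = d.
  by move: uv dE; rewrite /dist /height /=; lia.
rewrite dE /= map_cat big_cat /= !big_map mulr_suml.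
have nonempty w P : P \in path_list d u w -> exists s, P = rcons s w.
  move=> /mem_path_list[[_ _ lP] sP]; case: (lastP P) lP sP => // s y.
  by rewrite last_rcons => -> _; exists s.
congr (_ + _); rewrite big_seq [RHS]big_seq; apply: eq_bigr => P /nonempty[s ->].
  rewrite path_weight_rcons /hstep /= subrK.
  by case: v {uv dE nonempty} => v1 v2 /=; rewrite eqxx.
rewrite path_weight_rcons /hstep /=.
case: v {uv dE nonempty} => v1 v2 /=; rewrite xpair_eqE.
by case: eqP => [|_]; rewrite /= ?mulr1 // => e; exfalso; lia.
Qed.
End Weights.

(** * Exchanging the tails of two paths *)

Definition tail_swap x P Q := take (index x P) P ++ drop (index x Q) Q.

Lemma index_split x P : x \in P ->
  exists s1 s2, [/\ P = s1 ++ x :: s2, x \notin s1,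
    take (index x P) P = s1 & drop (index x P) P = x :: s2].
Proof.
move=> xP; exists (take (index x P) P), (drop (index x P).+1 P).
have xi : (index x P < size P)%N by rewrite index_mem.
have dE : drop (index x P) P = x :: drop (index x P).+1 P.
  by rewrite (drop_nth x) // nth_index.
split => //; first by rewrite -dE cat_take_drop.
by apply/negP => /index_ltn; rewrite ltnn.
Qed.

Lemma index_cat_cons x (s1 s2 : seq lpoint) : x \notin s1 -> index x (s1 ++ x :: s2) = size s1.
Proof. by move=> xs; rewrite index_cat (negbTE xs) /= eqxx addn0. Qed.

Lemma lattice_paths_cat u v x (s1 s2 : seq lpoint) :
  lattice_paths u v (s1 ++ x :: s2) <->
  lattice_paths u x (rcons s1 x) /\ lattice_paths x v (x :: s2).
Proof.
rewrite /lattice_paths /=; case: s1 => [|y s1] /=.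
  by split=> [[ps [e] lv]|[[_ [e] _] [ps _ lv]]]; subst x; do ?split.
rewrite rcons_path cat_path last_cat /= last_rcons.
by split=> [[/and3P[h1 h2 h3] e1 e2]|[[/andP[h1 h2] e1 _] [h3 _ e2]]]; rewrite ?h1 ?h2 ?h3; do ?split.
Qed.

Lemma tail_swapE x (s1 s2 t1 t2 : seq lpoint) : x \notin s1 -> x \notin t1 ->
  tail_swap x (s1 ++ x :: s2) (t1 ++ x :: t2) = s1 ++ x :: t2.
Proof.
move=> xs xt; rewrite /tail_swap !index_cat_cons // take_size_cat //.
by rewrite drop_size_cat.
Qed.

Lemma tail_swap_paths x u v u' v' P Q : x \in P -> x \in Q ->
  lattice_paths u v P -> lattice_paths u' v' Q -> lattice_paths u v' (tail_swap x P Q).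
Proof.
move=> /index_split[s1 [s2 [-> xs _ _]]] /index_split[t1 [t2 [-> xt _ _]]].
rewrite tail_swapE // => /lattice_paths_cat[h _] /lattice_paths_cat[_ h'].
exact/lattice_paths_cat.
Qed.

Lemma tail_swapK x P Q : x \in P -> x \in Q ->
  tail_swap x (tail_swap x P Q) (tail_swap x Q P) = P.
Proof.
move=> /index_split[s1 [s2 [-> xs _ _]]] /index_split[t1 [t2 [-> xt _ _]]].
by rewrite !tail_swapE.
Qed.

Lemma mem_tail_swap x P Q : x \in P -> x \in Q -> x \in tail_swap x P Q.
Proof.
move=> /index_split[s1 [s2 [-> xs _ _]]] /index_split[t1 [t2 [-> xt _ _]]].
by rewrite tail_swapE // mem_cat inE eqxx orbT.
Qed.

Lemma tail_swap_count x y P Q : x \in P -> x \in Q ->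
  (count_mem y (tail_swap x P Q) + count_mem y (tail_swap x Q P) =
   count_mem y P + count_mem y Q)%N.
Proof.
move=> /index_split[s1 [s2 [-> xs _ _]]] /index_split[t1 [t2 [-> xt _ _]]].
by rewrite !tail_swapE // !count_cat /=; lia.
Qed.

Lemma tail_swap_weight (C : numFieldType) (a b q p : C) x P Q : x \in P -> x \in Q ->
  path_weight a b q p (tail_swap x P Q) * path_weight a b q p (tail_swap x Q P) =
  path_weight a b q p P * path_weight a b q p Q.
Proof.
move=> /index_split[s1 [s2 [-> xs _ _]]] /index_split[t1 [t2 [-> xt _ _]]].
by rewrite !tail_swapE // !path_weight_cat; ring.
Qed.
End PathGeneratingFunctions.

(** * The Lindstrom-Gessel-Viennot lemma *)

Lemma perm_mono_id r (s : 'S_r) :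
  (forall i j : 'I_r, (i < j)%N -> (s i < s j)%N) -> s = 1%g.
Proof.
have ge (t : 'S_r) : (forall i j : 'I_r, (i < j)%N -> (t i < t j)%N) ->
    forall i : 'I_r, (i <= t i)%N.
  move=> tm; case=> n; elim: n => [//|n IH] nr.
  by apply: leq_ltn_trans (IH (ltnW nr)) _; apply: tm.
move=> sm; apply/permP => i; rewrite perm1; apply/val_inj/eqP; rewrite eqn_leq ge // andbT.
have vm : forall i j : 'I_r, (i < j)%N -> ((s^-1)%g i < (s^-1)%g j)%N.
  move=> k j kj; rewrite ltnNge; apply/negP; rewrite leq_eqVlt => /orP[/eqP/val_inj|] h.
    by move: kj; rewrite (perm_inj h) ltnn.
  by have := sm _ _ h; rewrite !permKV ltnNge (ltnW kj).
by have := ge _ vm (s i); rewrite permK.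
Qed.

(** The lemma is proved for objects of a finite type T, where occ records the points of
    an object, A j i says that it runs from source j to target i, and sw x exchanges the
    parts after a common point x. *)
Section AbstractLGV.
Variables (r : nat) (T : finType) (X : choiceType) (x0 : X) (F : numFieldType).
Variables (occ : T -> X -> bool) (A : 'I_r -> 'I_r -> pred T) (w : T -> F).
Variable sw : X -> T -> T -> T.
Hypothesis swA : forall x P Q i i' j j', occ P x -> occ Q x ->
  A j i P -> A j' i' Q -> A j i' (sw x P Q).
Hypothesis sw_occ : forall x y P Q i i' j j', occ P x -> occ Q x ->
  A j i P -> A j' i' Q ->
  (occ (sw x P Q) y + occ (sw x Q P) y = occ P y + occ Q y)%N.
Hypothesis occ_sw : forall x P Q i i' j j', occ P x -> occ Q x ->
  A j i P -> A j' i' Q -> occ (sw x P Q) x.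
Hypothesis sw_w : forall x P Q i i' j j', occ P x -> occ Q x ->
  A j i P -> A j' i' Q -> w (sw x P Q) * w (sw x Q P) = w P * w Q.
Hypothesis swK : forall x P Q i i' j j', occ P x -> occ Q x ->
  A j i P -> A j' i' Q -> sw x (sw x P Q) (sw x Q P) = P.
Hypothesis cross : forall (i i' j j' : 'I_r) P Q, (i < i')%N -> (j < j')%N ->
  A j i' P -> A j' i Q -> exists x, occ P x && occ Q x.

Local Notation fam := {ffun 'I_r -> T}.

Definition visits (f : fam) x : nat := (\sum_i occ (f i) x)%N.
Definition clash (f : fam) : bool := `[< exists x, (1 < visits f x)%N >].
(** The clash point depends only on the numbers of visits. The exchange of tails
    preserves these numbers, so the chosen point and the two chosen indices are stable
    under it, which makes the exchange an involution. *)
Definition clash_pt (f : fam) : X := xget x0 [set x | (1 < visits f x)%N].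
Definition clash_i (f : fam) : option 'I_r := [pick i | occ (f i) (clash_pt f)].
Definition clash_j (f : fam) : option 'I_r :=
  [pick j | occ (f j) (clash_pt f) && (Some j != clash_i f)].

Definition swap_fam (f : fam) i j x : fam :=
  [ffun k => if k == i then sw x (f j) (f i) else if k == j then sw x (f i) (f j) else f k].

Definition exchange (sf : 'S_r * fam) : 'S_r * fam :=
  match clash_i sf.2, clash_j sf.2 with
  | Some i, Some j => ((tperm i j * sf.1)%g, swap_fam sf.2 i j (clash_pt sf.2))
  | _, _ => sf
  end.

Definition valid (s : 'S_r) (f : fam) := [forall i, A (s i) i (f i)].

Lemma clashP (f : fam) : clash f -> exists i j,
  [/\ clash_i f = Some i, clash_j f = Some j, i != j,
     occ (f i) (clash_pt f) & occ (f j) (clash_pt f)].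
Proof.
move=> /asboolP cf; have v2 : (1 < visits f (clash_pt f))%N.
  by case: cf => y hy; rewrite /clash_pt; case: xgetP => [z -> hz|/(_ y)] //.
set x := clash_pt f in v2 *.
rewrite /clash_j /clash_i -/x; case: pickP => [i oi|no]; last first.
  by move: v2; rewrite /visits big1 // => i _; rewrite no.
case: pickP => [j /andP[oj ij]|no].
  by exists i, j; split => //; apply: contraNneq ij => ->.
move: v2; rewrite /visits (bigD1 i) //= big1 ?oi // => k ki.
by have := no k; rewrite (inj_eq Some_inj) ki andbT => ->.
Qed.

Lemma exchange_swap s (f : fam) : valid s f -> clash f ->
  [/\ valid (exchange (s, f)).1 (exchange (s, f)).2, clash (exchange (s, f)).2,
      exchange (exchange (s, f)) = (s, f) &
      (-1) ^+ (exchange (s, f)).1 * (\prod_i w ((exchange (s, f)).2 i)) = - ((-1) ^+ s * \prod_i w (f i))].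
Proof.
move=> /forallP va cf; have [i [j [ei ej ij oi oj]]] := clashP f cf.
have pE : exchange (s, f) = ((tperm i j * s)%g, swap_fam f i j (clash_pt f)).
  by rewrite /exchange /= ei ej.
rewrite pE /=; set x := clash_pt f in oi oj pE *; set g := swap_fam f i j x.
have ai := va i; have aj := va j.
have gi : g i = sw x (f j) (f i) by rewrite ffunE eqxx.
have gj : g j = sw x (f i) (f j) by rewrite ffunE eqxx eq_sym (negbTE ij).
have gk k : k != i -> k != j -> g k = f k.
  by move=> ki kj; rewrite ffunE (negbTE ki) (negbTE kj).
have sum_split (h : 'I_r -> nat) : (\sum_k h k = h i + h j + \sum_(k | (k != i) && (k != j)) h k)%N.
  by rewrite (bigD1 i) //= (bigD1 j) ?(eq_sym j) //= addnA.
have prod_split (h : 'I_r -> F) : \prod_k h k = h i * h j * \prod_(k | (k != i) && (k != j)) h k.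
  by rewrite (bigD1 i) //= (bigD1 j) ?(eq_sym j) //= mulrA.
have vis y : visits g y = visits f y.
  rewrite /visits !sum_split gi gj; congr (_ + _)%N.
    by rewrite addnC (sw_occ _ _ _ _ _ _ _ _ oi oj ai aj).
  by apply: eq_bigr => k /andP[ki kj]; rewrite gk.
have xg : clash_pt g = x.
  by rewrite /x /clash_pt; congr (xget _ _); apply/seteqP; split => y /=; rewrite vis.
have og k : occ (g k) x = occ (f k) x.
  have [->|ki] := eqVneq k i; first by rewrite gi oi (occ_sw _ _ _ _ _ _ _ oj oi aj ai).
  have [->|kj] := eqVneq k j; first by rewrite gj oj (occ_sw _ _ _ _ _ _ _ oi oj ai aj).
  by rewrite gk.
have cig : clash_i g = Some i.
  by rewrite -ei /clash_i xg; apply: eq_pick => k; exact: og.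
have cjg : clash_j g = Some j.
  by rewrite -ej /clash_j xg cig ei; apply: eq_pick => k; rewrite /= og.
split.
- apply/forallP => k; rewrite permM.
  have [->|ki] := eqVneq k i; first by rewrite tpermL gi; exact: swA oj oi aj ai.
  have [->|kj] := eqVneq k j; first by rewrite tpermR gj; exact: swA oi oj ai aj.
  by rewrite tpermD 1?eq_sym // gk.
- by apply/asboolP; move/asboolP: cf => [y hy]; exists y; rewrite vis.
- rewrite /exchange /= cig cjg xg mulgA tperm2 mul1g; congr (_, _).
  apply/ffunP => k; rewrite ffunE gi gj.
  case: eqVneq => [->|ki]; first by rewrite (swK _ _ _ _ _ _ _ oi oj ai aj).
  case: eqVneq => [->|kj]; first by rewrite (swK _ _ _ _ _ _ _ oj oi aj ai).
  by rewrite gk.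
- rewrite odd_permM odd_tperm ij signr_addb mulN1r mulNr; congr (- (_ * _)).
  rewrite !prod_split gi gj mulrC [RHS]mulrC; congr (_ * _).
    by apply: eq_bigr => k /andP[ki kj]; rewrite gk.
  by rewrite (sw_w _ _ _ _ _ _ _ oj oi aj ai) mulrC.
Qed.

(** The Leibniz formula is a signed sum over families with permuted targets. Exchanging
    tails at a clash point cancels the families that clash; by the crossing hypothesis a
    family without a clash belongs to the identity. *)
Lemma lgv_det :
  \det (\matrix_(i < r, j < r) \sum_(P | A j i P) w P) =
  \sum_(f : fam | valid 1 f && ~~ clash f) \prod_i w (f i).
Proof.
pose term (sf : 'S_r * fam) : F := (-1) ^+ sf.1 * \prod_i w (sf.2 i).
have -> : \det (\matrix_(i < r, j < r) \sum_(P | A j i P) w P) =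
   \sum_(sf : 'S_r * fam | valid sf.1 sf.2) term sf.
  rewrite -(pair_big_dep xpredT valid (fun s f => term (s, f))) /=.
  apply: eq_bigr => s _; rewrite /term /= -mulr_sumr; congr (_ * _).
  under eq_bigr => i _ do rewrite mxE.
  etransitivity; first exact: (bigA_distr_big_dep (fun i P => A (s i) i P) (fun _ P => w P)).
  apply: eq_bigl => f.
  by rewrite /valid; apply/familyP/forallP.
rewrite (bigID (fun sf => clash sf.2)) /= [X in X + _](_ : _ = 0) ?add0r; last first.
  set S := \sum_(_ | _) _.
  have SN : S = - S.
    rewrite {1}/S (reindex_onto exchange exchange) /=; last first.
      by move=> [s f] /andP[va cf]; have [_ _ e _] := exchange_swap s f va cf.
    rewrite -sumrN; apply: eq_big => [[s f]|[s f]] /=.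
      apply/idP/idP => [/andP[/andP[va cf] /eqP e]|/andP[va cf]].
        have := exchange_swap (exchange (s, f)).1 (exchange (s, f)).2 va cf.
        by rewrite -surjective_pairing e => -[-> ->].
      by have [-> -> -> _] := exchange_swap s f va cf; rewrite eqxx.
    move=> /andP[/andP[va cf] /eqP e].
    have := exchange_swap (exchange (s, f)).1 (exchange (s, f)).2 va cf.
    rewrite -surjective_pairing e /= => -[va' cf' _ _].
    by have [_ _ _] := exchange_swap s f va' cf'.
  apply/eqP; have : S + S == 0 by rewrite {2}SN subrr.
  by rewrite -mulr2n mulrn_eq0.
rewrite (eq_bigl (fun sf : 'S_r * fam => (sf.1 == 1%g) && (valid 1 sf.2 && ~~ clash sf.2))).
  rewrite -(pair_big_dep (fun s : 'S_r => s == 1%g) (fun s f => valid 1 f && ~~ clash f)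
    (fun s f => term (s, f))) /= big_pred1_eq.
  by apply: eq_bigr => f _; rewrite /term /= odd_perm1 mul1r.
move=> [s f] /=; apply/idP/idP => [/andP[va ncf]|/andP[/eqP -> //]].
suff s1 : s = 1%g by rewrite -s1 va ncf s1 eqxx.
apply: perm_mono_id => i i' ii'; rewrite ltnNge leq_eqVlt; apply/negP => /orP[/eqP/val_inj|] h.
  by move: ii'; rewrite (perm_inj h) ltnn.
move/forallP: va => va; have [x xx] := cross i i' _ _ _ _ ii' h (va i') (va i); case/andP: xx => h1 h2.
case/negP: ncf; apply/asboolP; exists x.
have ne : i' != i by rewrite neq_ltn ii' orbT.
by rewrite /visits (bigD1 i) //= (bigD1 i') //= h1 h2.
Qed.
End AbstractLGV.

Section ConcreteLGV.
Variables (F : numFieldType) (a b q p : F) (r : nat) (u v : 'I_r -> lpoint).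
Hypothesis u_northwest : forall i j : 'I_r, (i <= j)%N -> northwest (u i) (u j).
Hypothesis v_northwest : forall i j : 'I_r, (i <= j)%N -> northwest (v i) (v j).

(** The abstract lemma is applied to the finite type of all paths that join some starting
    point to some end point. *)
Let L j i := path_list (dist (u j) (v i)) (u j) (v i).
Let LL := flatten [seq L j i | j <- enum 'I_r, i <- enum 'I_r].
Let T := seq_sub LL.
Let A (j i : 'I_r) (P : T) := val P \in L j i.
Let occ (P : T) (x : lpoint) := x \in val P.
Let w (P : T) := path_weight a b q p (val P).
Let sw x (P Q : T) : T := insubd P (tail_swap x (val P) (val Q)).

Let LP (j i : 'I_r) P : reflect (lattice_paths (u j) (v i) P) (P \in L j i).
Proof. exact: mem_path_list_dist. Qed.

Let subL j i P : P \in L j i -> P \in LL.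
Proof.
move=> h; apply/flattenP; exists (L j i) => //.
by apply/allpairsP; exists (j, i); split; rewrite ?mem_enum.
Qed.

Let swE x P Q i i' j j' : occ P x -> occ Q x -> A j i P -> A j' i' Q ->
  val (sw x P Q) = tail_swap x (val P) (val Q) /\ A j i' (sw x P Q).
Proof.
move=> oP oQ /LP hP /LP hQ.
have h : tail_swap x (val P) (val Q) \in L j i'.
  by apply/LP; exact: tail_swap_paths oP oQ hP hQ.
have e : val (sw x P Q) = tail_swap x (val P) (val Q).
  by rewrite /sw val_insubd (subL _ _ _ h).
by split=> //; rewrite /A e.
Qed.

Let sum_sub (f : seq lpoint -> F) j i :
  \sum_(P <- L j i) f P = \sum_(P : T | A j i P) f (val P).
Proof.
rewrite -[RHS]big_filter -[RHS](big_map val xpredT f).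
apply: perm_big; apply: uniq_perm; first exact: path_list_uniq.
  by rewrite map_inj_uniq ?filter_uniq ?index_enum_uniq //; exact: val_inj.
move=> P; apply/idP/mapP => [h|[x]].
  exists (SeqSub (subL _ _ _ h)) => //.
  by rewrite mem_filter mem_index_enum andbT.
by rewrite mem_filter => /andP[h _] ->.
Qed.

Let validP (f : {ffun 'I_r -> T}) :
  reflect (forall i, lattice_paths (u i) (v i) (val (f i))) (valid r T A 1%g f).
Proof.
apply: (iffP forallP) => h i; first by have := h i; rewrite perm1 => /LP.
by rewrite perm1; apply/LP.
Qed.

Let clashN (f : {ffun 'I_r -> T}) : ~~ clash r T lpoint occ f ->
  forall i j, i != j -> forall x, ~ (x \in val (f i) /\ x \in val (f j)).
Proof.
move=> nc i j ij x [xi xj]; case/negP: nc; apply/asboolP; exists x.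
by rewrite /visits (bigD1 i) //= (bigD1 j) 1?eq_sym //= /occ xi xj.
Qed.

Let Nclash (f : {ffun 'I_r -> T}) :
  (forall i j, i != j -> forall x, ~ (x \in val (f i) /\ x \in val (f j))) ->
  ~~ clash r T lpoint occ f.
Proof.
move=> nc; apply/negP => cf.
have [i [j [_ _ ij oi oj]]] := clashP r T lpoint (0, 0) occ f cf.
exact: (nc i j ij _ (conj oi oj)).
Qed.

Theorem lgv : nonintersecting_gf a b q p u v = path_det a b q p u v.
Proof.
have -> : path_det a b q p u v = \det (\matrix_(i < r, j < r) \sum_(P | A j i P) w P).
  by congr (\det _); apply/matrixP => i j; rewrite !mxE path_gf_list sum_sub.
rewrite (lgv_det r T lpoint (0, 0) F occ A w sw).
- pose val_fam (f : {ffun 'I_r -> T}) : {ffun 'I_r -> seq lpoint} := [ffun i => val (f i)].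
  pose good (f : {ffun 'I_r -> T}) := valid r T A 1%g f && ~~ clash r T lpoint occ f.
  have inj : injective val_fam.
    move=> f g /ffunP e; apply/ffunP => i; apply: val_inj.
    by have := e i; rewrite !ffunE.
  have un : uniq [seq val_fam f | f <- enum good] by rewrite map_inj_uniq ?enum_uniq.
  rewrite /nonintersecting_gf.
  have -> : nonintersecting_paths u v = [set` [seq val_fam f | f <- enum good]].
    apply/seteqP; split => [P [hP nP]|P /= /mapP[f]]; last first.
      rewrite mem_enum => /andP[/validP h /clashN nc] ->; split.
        by move=> i; rewrite ffunE.
      by move=> i j ij x; rewrite !ffunE; exact: nc.
    apply/mapP; pose f : {ffun 'I_r -> T} :=
      [ffun i => SeqSub (subL i i (P i) (introT (LP i i _) (hP i)))].
    have fE i : val (f i) = P i by rewrite ffunE.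
    exists f; last by apply/ffunP => i; rewrite ffunE fE.
    rewrite mem_enum; apply/andP; split; first by apply/validP => i; rewrite fE.
    by apply: Nclash => i j ij x; rewrite !fE; exact: nP.
  rewrite -fsbig_seq // big_map big_enum /=.
  by apply: eq_bigr => f _; apply: eq_bigr => i _; rewrite ffunE.
- by move=> x P Q i i' j j' oP oQ aP aQ; have [] := swE _ _ _ _ _ _ _ oP oQ aP aQ.
- move=> x y P Q i i' j j' oP oQ aP aQ.
  have [e1 a1] := swE _ _ _ _ _ _ _ oP oQ aP aQ.
  have [e2 a2] := swE _ _ _ _ _ _ _ oQ oP aQ aP.
  have cnt j0 i0 S : A j0 i0 S -> (occ S y : nat) = count_mem y (val S).
    by move=> /LP h; rewrite count_uniq_mem // (lattice_paths_uniq _ _ _ h).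
  rewrite (cnt _ _ _ a1) (cnt _ _ _ a2) (cnt _ _ _ aP) (cnt _ _ _ aQ) e1 e2.
  exact: tail_swap_count.
- move=> x P Q i i' j j' oP oQ aP aQ.
  by have [e1 a1] := swE _ _ _ _ _ _ _ oP oQ aP aQ; rewrite /occ e1 mem_tail_swap.
- move=> x P Q i i' j j' oP oQ aP aQ.
  have [e1 a1] := swE _ _ _ _ _ _ _ oP oQ aP aQ.
  have [e2 a2] := swE _ _ _ _ _ _ _ oQ oP aQ aP.
  by rewrite /w e1 e2 tail_swap_weight.
- move=> x P Q i i' j j' oP oQ aP aQ.
  have [e1 a1] := swE _ _ _ _ _ _ _ oP oQ aP aQ.
  have [e2 a2] := swE _ _ _ _ _ _ _ oQ oP aQ aP.
  have o1 : occ (sw x P Q) x by rewrite /occ e1 mem_tail_swap.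
  have o2 : occ (sw x Q P) x by rewrite /occ e2 mem_tail_swap.
  have [e _] := swE _ _ _ _ _ _ _ o1 o2 a1 a2.
  by apply: val_inj; rewrite e e1 e2 tail_swapK.
- move=> i i' j j' P Q ii' jj' /LP hP /LP hQ.
  have [x [xP xQ]] := crossing _ _ _ _ _ _ hP hQ (u_northwest _ _ (ltnW jj')) (v_northwest _ _ (ltnW ii')).
  by exists x; rewrite /occ xP xQ.
Qed.
End ConcreteLGV.

(** * Shifted factorials on a lattice of arguments *)

Section ShiftedFactorials.
Variables (C : numFieldType) (q p : C).
Hypothesis q0 : q != 0.
Local Notation th := (theta1 p).

Definition thq x (n : int) : C := th (x * q ^ n).
(** As a function of n this is the solution of f (n + 1) = f n * theta (x q^n), f 0 = 1 on
    all integers; every shifted factorial of base x q^s is a quotient of two values. *)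
Definition shf x (n : int) : C := tpoch1 q p x n.

Lemma thqE x n : thq x n = th (x * q ^ n). Proof. by []. Qed.

Section Base.
Variable x : C.
Hypothesis xnz : forall n, thq x n != 0.

Lemma shf_neq0 n : shf x n != 0.
Proof.
case: n => n; rewrite /shf /= ?invr_eq0 prodf_seq_neq0; apply/allP => k _ /=.
  exact: (xnz k%:Z).
exact: (xnz (Negz n + k%:Z)).
Qed.

Lemma shfS n : shf x (n + 1) = shf x n * thq x n.
Proof.
case: n => n.
  by rewrite -PoszD addn1 /shf /= big_nat_recr.
have e : thq x (Negz n) * \prod_(0 <= k < n) thq x (Negz n + 1 + k%:Z) =
         \prod_(0 <= k < n.+1) thq x (Negz n + k%:Z).
  rewrite big_nat_recl // addr0; congr (_ * _); apply: eq_bigr => k _.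
  by congr (thq x _); lia.
have h m : Negz m = - (m.+1%:Z) by [].
rewrite /shf /= -/(thq x _) -[\prod_(0 <= k < n.+1) _]e invfM mulrAC mulVf ?xnz // mul1r.
case: n {e} => [|n]; first by rewrite /= !big_geq // invr1.
have -> : Negz n.+1 + 1 = Negz n by rewrite !NegzE; lia.
by [].
Qed.

Lemma shf_shift s n : tpoch1 q p (x * q ^ s) n = shf x (s + n) / shf x s.
Proof.
have thE m : th (x * q ^ s * q ^ m) = thq x (s + m) by rewrite /thq expfzDr // mulrA.
case: n => n.
  apply: (mulIf (shf_neq0 s)); rewrite divfK ?shf_neq0 //.
  elim: n => [|n IH]; first by rewrite addr0 /= big_geq // mul1r.
  have -> : s + n.+1%:Z = s + n%:Z + 1 by lia.
  by rewrite shfS -IH /= big_nat_recr //= (thE n%:Z) mulrAC.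
rewrite /=; apply: (mulIf (shf_neq0 s)); rewrite divfK ?shf_neq0 //.
have pnz m : \prod_(0 <= k < m) thq x (s + Negz n + k%:Z) != 0.
  by rewrite prodf_seq_neq0; apply/allP => k _ /=; apply: xnz.
have -> : \prod_(0 <= k < n.+1) th (x * q ^ s * q ^ (Negz n + k%:Z)) =
   \prod_(0 <= k < n.+1) thq x (s + Negz n + k%:Z).
  by apply: eq_bigr => k _; rewrite thE addrA.
apply: (mulfI (pnz n.+1)); rewrite mulVKf ?pnz //.
have -> : s = s + Negz n + n.+1%:Z by rewrite NegzE; lia.
have -> : s + Negz n + n.+1%:Z + Negz n = s + Negz n by rewrite NegzE; lia.
move: (s + Negz n) => t; elim: (n.+1) => [|m IH].
  by rewrite big_geq // mul1r addr0.
have -> : t + m.+1%:Z = t + m%:Z + 1 by lia.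
by rewrite shfS IH big_nat_recr //= mulrAC.
Qed.
End Base.

(** For n > 0 this is (q;q,p)_{n-1}. The base 1 has no solution of the recursion on all
    integers since theta 1 = 0; instead the reciprocal iegam, extended by 0, satisfies it
    everywhere, like the reciprocal of the gamma function. *)
Definition egam (n : int) : C := \prod_(1 <= k < absz n) th (q ^+ k).
Definition iegam (n : int) : C := if 0 < n then (egam n)^-1 else 0.

Hypothesis qnz : forall n : int, 0 < n -> th (q ^ n) != 0.
Hypothesis th1 : th 1 = 0.

Lemma egam_neq0 n : egam n != 0.
Proof.
rewrite /egam prodf_seq_neq0; apply/allP => k /=; rewrite mem_index_iota => /andP[k1 _].
by apply: (qnz k%:Z); lia.
Qed.

Lemma egamS n : 0 < n -> egam (n + 1) = egam n * th (q ^ n).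
Proof.
case: n => [[//|n]|//] _; rewrite -PoszD addn1 /egam /=.
by rewrite big_nat_recr.
Qed.

Lemma egam_1 : egam 1 = 1. Proof. by rewrite /egam big_geq. Qed.

Lemma iegamE n : 0 < n -> iegam n = (egam n)^-1.
Proof. by rewrite /iegam => ->. Qed.

Lemma iegam_0 n : n <= 0 -> iegam n = 0.
Proof. by rewrite /iegam leNgt => /negbTE ->. Qed.

Lemma iegamS n : iegam n = th (q ^ n) * iegam (n + 1).
Proof.
have [n0|n0] := ltP 0 n.
  rewrite !iegamE ?egamS //; last by lia.
  by rewrite invfM mulrA mulrAC divff ?mul1r // ?qnz.
rewrite iegam_0 //; have [->|nn] := eqVneq n 0; first by rewrite expr0z th1 mul0r.
by rewrite iegam_0 ?mulr0 //; lia.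
Qed.

(** For n < 0 the factor theta 1 = 0 occurs in the product, and both sides vanish. *)
Lemma tpoch1_q n : (tpoch1 q p q n)^-1 = iegam (1 + n).
Proof.
case: n => n.
  rewrite iegamE; last by lia.
  rewrite /egam -PoszD /= add1n big_add1 /=; congr (_^-1); apply: eq_bigr => k _.
  by rewrite exprS.
rewrite iegam_0; last by lia.
apply/eqP; rewrite invr_eq0 /= invr_eq0 prodf_seq_eq0; apply/hasP.
exists n; first by rewrite mem_index_iota /=.
have -> : Negz n + n%:Z = -1 by rewrite NegzE; lia.
by rewrite /= exprN1 divff // th1.
Qed.

(** For s <= 0 < s + n the factor theta 1 = 0 occurs in the product, and iegam s = 0. *)
Lemma tpoch1_qs s n : 0 < s + n -> tpoch1 q p (q ^ s) n = egam (s + n) * iegam s.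
Proof.
have thE m : th (q ^ s * q ^ m) = th (q ^ (s + m)) by rewrite expfzDr.
case: n => n sn.
  have [s0|s0] := ltP 0 s; last first.
    rewrite iegam_0 // mulr0 /=; apply/eqP; rewrite prodf_seq_eq0; apply/hasP.
    exists `|s|%N; first by rewrite mem_index_iota /=; lia.
    rewrite /= (thE `|s|%N%:Z); have -> : s + `|s|%N%:Z = 0 by lia.
    by rewrite expr0z th1.
  rewrite iegamE //; apply: (mulIf (egam_neq0 s)); rewrite divfK ?egam_neq0 //.
  elim: n {sn} => [|n IH]; first by rewrite addr0 /= big_geq // mul1r.
  have -> : s + n.+1%:Z = s + n%:Z + 1 by lia.
  rewrite egamS; last by lia.
  by rewrite -IH /= big_nat_recr //= (thE n%:Z) mulrAC.
have s0 : 0 < s by move: sn; rewrite NegzE; lia.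
rewrite iegamE //= ; apply: (mulIf (egam_neq0 s)); rewrite divfK ?egam_neq0 //.
have -> : \prod_(0 <= k < n.+1) th (q ^ s * q ^ (Negz n + k%:Z)) =
   \prod_(0 <= k < n.+1) th (q ^ (s + Negz n + k%:Z)).
  by apply: eq_bigr => k _; rewrite thE addrA.
have pnz m : \prod_(0 <= k < m) th (q ^ (s + Negz n + k%:Z)) != 0.
  by rewrite prodf_seq_neq0; apply/allP => k _ /=; apply: (qnz (s + Negz n + k%:Z)); lia.
apply: (mulfI (pnz n.+1)); rewrite mulVKf ?pnz //.
have -> : egam s = egam (s + Negz n + n.+1%:Z) by congr egam; rewrite NegzE; lia.
move: (s + Negz n) sn => t t0; elim: (n.+1) => [|m IH].
  by rewrite big_geq // mul1r addr0.
have -> : t + m.+1%:Z = t + m%:Z + 1 by lia.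
rewrite egamS; last by lia.
by rewrite IH big_nat_recr //= mulrAC.
Qed.
End ShiftedFactorials.

(** * The generating function of the paths between two points *)

(** The recursion of the closed form as identities of rational functions: the s are the
    values of shifted factorials that two neighbouring end points share, the t are the
    theta values by which they differ, and the other variables stand for the powers of q and
    the base 1 factorials. *)
Lemma horizontal_step_factor (F : numFieldType) (e1 e2 e g i1 i2 s0 s1 s2 s3 s4 s5 s6 s7 s8 s9 s10 s11
    s12 s13 s14 s15 s16 t0 t1 t2 t3 t4 t5 t6 t7 t8 t9 t10 t11 t12 t13 t14 : F) :
  e2 != 0 -> s9 != 0 -> s10 != 0 -> s11 != 0 -> s12 != 0 -> s13 != 0 -> s14 != 0 ->
  s15 != 0 -> s16 != 0 -> t5 != 0 -> t6 != 0 -> t7 != 0 -> t8 != 0 -> t9 != 0 ->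
  t10 != 0 -> t11 != 0 -> t12 != 0 -> t13 != 0 -> t14 != 0 ->
  e1 * g * i2 * i1 *
  (s1 * s0 / (s12 * t10 * (s13 * t11))) *
  (s4 * (s3 * t1 * t0) * s2 / (s14 * t12 * s15 * (s16 * t13 * t14))) *
  (s8 * s7 * s6 * s5 / (s9 * t9 * s10 * (s11 * t7) * s11)) *
  (e * (t2 * t3 * (t12 * t4))) =
  e1 / e2 * (g * (t2 * i2) * i1) *
  (s1 * s0 / (s12 * t10 * s13)) *
  (s4 * s3 * s2 / (s14 * s15 * s16)) *
  (s8 * t6 * t5 * (s7 * t4) * s6 * s5 / (s9 * t9 * s10 * (s11 * t7 * t8) * (s11 * t7))) *
  (t3 * t0 * t1 * t8 * t7 / (t11 * t14 * t13 * t5 * t6) * (e2 * e)).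
Proof. by intros; field; do ?[apply/andP; split]. Qed.

Lemma vertical_step_factor (F : numFieldType) (e1 g i1 i2 s0 s1 s2 s3 s4 s5 s6 s7 s8 s9 s10 s11
    s12 s13 s14 s15 s16 t0 t1 t2 t7 t9 t10 t11 t12 t13 t14 : F) :
  s9 != 0 -> s10 != 0 -> s11 != 0 -> s12 != 0 -> s13 != 0 -> s14 != 0 ->
  s15 != 0 -> s16 != 0 -> t7 != 0 -> t9 != 0 ->
  t10 != 0 -> t11 != 0 -> t12 != 0 -> t13 != 0 -> t14 != 0 ->
  e1 * g * i2 * i1 *
  (s1 * s0 / (s12 * t10 * (s13 * t11))) *
  (s4 * (s3 * t1 * t0) * s2 / (s14 * t12 * s15 * (s16 * t13 * t14))) *
  (s8 * s7 * s6 * s5 / (s9 * t9 * s10 * (s11 * t7) * s11)) *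
  (t2 * t10 * (t14 * t9)) =
  e1 * (g * i2 * (t2 * i1)) *
  (s1 * s0 / (s12 * (s13 * t11))) *
  (s4 * (s3 * t1 * t0) * s2 / (s14 * t12 * s15 * (s16 * t13))) *
  (s8 * s7 * s6 * s5 / (s9 * s10 * (s11 * t7) * s11)).
Proof. by intros; field; do ?[apply/andP; split]. Qed.

Opaque shf thq egam iegam.

Section ClosedForm.
Variables (C : numFieldType) (a b q p : C).
Local Notation th := (theta1 p).
Hypotheses (a0 : a != 0) (b0 : b != 0) (q0 : q != 0).
Hypothesis th1 : th 1 = 0.
Hypothesis add : addition_formula C th.
Hypothesis sqrt : forall c : C, exists d, d ^+ 2 = c.
Hypothesis gen : generic a b q p.
Local Notation A := (shf C q p a).
Local Notation B := (shf C q p b).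
Local Notation G := (shf C q p (a / b)).
Local Notation ta := (thq C q p a).
Local Notation tb := (thq C q p b).
Local Notation tg := (thq C q p (a / b)).
Local Notation t1 := (thq C q p 1).
Local Notation egam := (egam C q p).
Local Notation iegam := (iegam C q p).

Lemma ta_nz n : ta n != 0. Proof. by case: gen => _ h _ _; rewrite thqE. Qed.
Lemma tb_nz n : tb n != 0. Proof. by case: gen => _ _ h _; rewrite thqE. Qed.
Lemma tg_nz n : tg n != 0. Proof. by case: gen => _ _ _ h; rewrite thqE mulrAC. Qed.
Lemma A_nz n : A n != 0. Proof. exact: (shf_neq0 _ _ _ _ ta_nz). Qed.
Lemma B_nz n : B n != 0. Proof. exact: (shf_neq0 _ _ _ _ tb_nz). Qed.
Lemma G_nz n : G n != 0. Proof. exact: (shf_neq0 _ _ _ _ tg_nz). Qed.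
Lemma AS n : A (n + 1) = A n * ta n. Proof. exact: (shfS _ _ _ q0 _ ta_nz). Qed.
Lemma BS n : B (n + 1) = B n * tb n. Proof. exact: (shfS _ _ _ q0 _ tb_nz). Qed.
Lemma GS n : G (n + 1) = G n * tg n. Proof. exact: (shfS _ _ _ q0 _ tg_nz). Qed.

(** The addition formula at s q^(n+m-l), s q^k, s q^m and b q^(n+l) / s, where s^2 = a q^l.
    It is the recursion of the closed form after cancellation of the common factors. *)
Lemma theta_four (l k n m : int) :
  t1 (n - l + (m - k)) * ta (n + k + m) * (tb (n + l + m) * tg (m - n)) =
  q ^ (m - k) * (t1 (n - l) * ta (n + 2 * m) * (tb (n + l + k) * tg (k - n))) +
  t1 (m - k) * ta (l + k + m) * (tb (2 * n + m) * tg (m - l)).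
Proof.
have [s sE] := sqrt (a * q ^ l).
have aql : a * q ^ l != 0 by rewrite mulf_neq0 ?expfz_neq0.
have s0 : s != 0 by apply: contraNneq aql => e; rewrite -sE e expr0n.
have nz e : s * q ^ e != 0 by rewrite mulf_neq0 ?expfz_neq0.
have v0 : b * q ^ (n + l) / s != 0 by rewrite !mulf_neq0 ?invr_eq0 ?expfz_neq0.
have := add (s * q ^ (n + m - l)) (s * q ^ k) (s * q ^ m) (b * q ^ (n + l) / s) (nz _) (nz _) (nz _) v0.
have ss e f : s * q ^ e * (s * q ^ f) = a * q ^ (l + e + f).
  by rewrite !expfzDr // !mulrA -sE; ring.
have sd e f : s * q ^ e / (s * q ^ f) = q ^ (e - f).
  by rewrite -mulf_div divff // mul1r expfzDr // -invr_expz.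
have sv e : s * q ^ e * (b * q ^ (n + l) / s) = b * q ^ (n + l + e).
  by rewrite [in RHS]expfzDr //; field.
have sw e : s * q ^ e / (b * q ^ (n + l) / s) = a / b * q ^ (e - n).
  have -> : q ^ (e - n) = q ^ e / q ^ n by rewrite expfzDr // -invr_expz.
  have -> : a = s ^+ 2 / q ^ l by rewrite sE mulfK ?expfz_neq0.
  by rewrite expfzDr //; field; rewrite s0 b0 !expfz_neq0.
rewrite !ss !sd !sv !sw => e.
have {e} := e.
have tE x e f : e = f -> th (x * q ^ e) = thq C q p x f by move=> ->; rewrite thqE.
have t1E e f : e = f -> th (q ^ e) = t1 f by move=> ->; rewrite thqE mul1r.
rewrite (tE a (l + (n + m - l) + k) (n + k + m)) ?(t1E (n + m - l - k) (n - l + (m - k)))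
    ?(tE b (n + l + m) (n + l + m)) ?(tE (a / b) (m - n) (m - n))
    ?(tE b (n + l + (n + m - l)) (2 * n + m)) ?(tE (a / b) (n + m - l - n) (m - l))
    ?(tE a (l + m + k) (l + k + m)) ?(t1E (m - k) (m - k)) ?(tE b (n + l + k) (n + l + k))
    ?(tE (a / b) (k - n) (k - n)) ?(tE a (l + (n + m - l) + m) (n + 2 * m))
    ?(t1E (n + m - l - m) (n - l)); try ring.
move=> /eqP; rewrite subr_eq => /eqP e.
by rewrite [t1 _ * _]mulrC e; ring.
Qed.
Lemma edge_weightE (n m : int) : edge_weight a b q p n m =
  ta (n + 2 * m) * tb (2 * n) * tb (2 * n - 1) * tg (1 - n) * tg (- n) /
  (ta n * tb (2 * n + m) * tb (2 * n + m - 1) * tg (1 + m - n) * tg (m - n)) * q ^ m.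
Proof.
have gE e : a * q ^ e / b = a / b * q ^ e by rewrite mulrAC.
by rewrite !thqE /edge_weight /theta !big_cons !big_nil !gE !mulr1 !mulrA.
Qed.

(** The closed form of the generating function from (l, k) to (n, m): an elliptic binomial
    coefficient. It vanishes through iegam unless l <= n and k <= m. *)
Definition wpath (l k n m : int) : C :=
  q ^ ((n - l) * k) *
  (egam (1 + (n - l) + (m - k)) * iegam (1 + (n - l)) * iegam (1 + (m - k))) *
  (A (1 + n + k + m) * A (1 + l) / (A (1 + l + k + m) * A (1 + n))) *
  (B (1 + n + l + m) * B (1 + 2 * n) * B (1 + k + 2 * l) /
   (B (1 + n + l + k) * B (1 + 2 * l) * B (1 + 2 * n + m))) *
  (G (1 + m - n) * G (k - n) * G (1 - l) * G (- l) /
   (G (1 + m - l) * G (k - l) * G (1 - n) * G (- n))).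

Lemma AS' s t : t = s + 1 -> A t = A s * ta s. Proof. by move=> ->; exact: AS. Qed.
Lemma BS' s t : t = s + 1 -> B t = B s * tb s. Proof. by move=> ->; exact: BS. Qed.
Lemma GS' s t : t = s + 1 -> G t = G s * tg s. Proof. by move=> ->; exact: GS. Qed.

Lemma wpath_rec (l k n m : int) : 0 < (n - l) + (m - k) ->
  wpath l k n m = wpath l k (n - 1) m * edge_weight a b q p n m + wpath l k n (m - 1).
Proof.
move=> nm; rewrite edge_weightE /wpath.
have q1nz e : 0 < e -> th (q ^ e) != 0 by case: gen => h _ _ _; exact: h.
have gS : egam (1 + (n - l) + (m - k)) = egam (n - l + (m - k)) * t1 (n - l + (m - k)).
  by rewrite thqE mul1r -egamS //; congr egam; ring.
have iS (e f : int) : f = 1 + e -> iegam e = t1 e * iegam f.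
  by move=> ->; rewrite thqE mul1r addrC; exact: (iegamS _ _ _ q0 q1nz th1).
rewrite gS.
have -> : egam (1 + (n - 1 - l) + (m - k)) = egam (n - l + (m - k)) by congr egam; ring.
have -> : egam (1 + (n - l) + (m - 1 - k)) = egam (n - l + (m - k)) by congr egam; ring.
have -> : iegam (1 + (n - 1 - l)) = t1 (n - l) * iegam (1 + (n - l)).
  by rewrite -iS //; congr iegam; ring.
have -> : iegam (1 + (m - 1 - k)) = t1 (m - k) * iegam (1 + (m - k)).
  by rewrite -iS //; congr iegam; ring.
have -> : q ^ ((n - 1 - l) * k) = q ^ ((n - l) * k) / q ^ k.
  by rewrite invr_expz -expfzDr //; congr (q ^ _); ring.
have e0 : q ^ m = q ^ k * q ^ (m - k) by rewrite -expfzDr //; congr (q ^ _); ring.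
rewrite e0 (AS' (n + k + m) (1 + n + k + m)) ?(AS' (l + k + m) (1 + l + k + m)) ?(AS' n (1 + n)); try ring.
rewrite (BS' (n + l + m) (1 + n + l + m)) ?(BS' (2 * n) (1 + 2 * n)) ?(BS' (2 * n - 1) (2 * n)); try ring.
rewrite (BS' (n + l + k) (1 + n + l + k)) ?(BS' (2 * n + m) (1 + 2 * n + m)) ?(BS' (2 * n + m - 1) (2 * n + m)); try ring.
rewrite (GS' (m - n) (1 + m - n)) ?(GS' (m - l) (1 + m - l)) ?(GS' (- n) (1 - n)); try ring.
have AE s t : s = t -> A s = A t by move=> ->.
have BE s t : s = t -> B s = B t by move=> ->.
have GE s t : s = t -> G s = G t by move=> ->.
rewrite (AE (1 + (n - 1) + k + m) (n + k + m)) ?(AE (1 + (n - 1)) n); try ring.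
rewrite (BE (1 + (n - 1) + l + m) (n + l + m)) ?(BE (1 + 2 * (n - 1)) (2 * n - 1)); try ring.
rewrite (BE (1 + (n - 1) + l + k) (n + l + k)) ?(BE (1 + 2 * (n - 1) + m) (2 * n + m - 1)); try ring.
have -> : G (1 + m - (n - 1)) = G (m - n) * tg (m - n) * tg (1 + m - n).
  by rewrite -(GS' (m - n) (1 + m - n)) ?(GS' (1 + m - n) (1 + m - (n - 1))) //; ring.
have -> : G (k - (n - 1)) = G (k - n) * tg (k - n) by apply: GS'; ring.
have -> : G (1 - (n - 1)) = G (- n) * tg (- n) * tg (1 - n).
  by rewrite -(GS' (- n) (1 - n)) ?(GS' (1 - n) (1 - (n - 1))) //; ring.
have -> : G (- (n - 1)) = G (- n) * tg (- n) by apply: GS'; ring.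
rewrite (AE (1 + n + k + (m - 1)) (n + k + m)) ?(AE (1 + l + k + (m - 1)) (l + k + m)); try ring.
rewrite (BE (1 + n + l + (m - 1)) (n + l + m)); last by ring.
have -> : B (1 + 2 * n + (m - 1)) = B (2 * n + m - 1) * tb (2 * n + m - 1).
  by rewrite -(BS' _ (2 * n + m)); [congr B|]; ring.
rewrite (GE (1 + (m - 1) - n) (m - n)) ?(GE (1 + (m - 1) - l) (m - l)); try ring.
(* K collects the factors that the three terms of the recursion share. *)
have := theta_four l k n m.
set T0 := t1 (n - l + (m - k)); set T1 := q ^ (m - k) * _; set T2 := t1 (m - k) * _ * _ => e4.
pose K := q ^ ((n - l) * k) * egam (n - l + (m - k)) * iegam (1 + (n - l)) * iegam (1 + (m - k)) *
  (A (n + k + m) * A (1 + l) / (A (l + k + m) * ta (l + k + m) * (A n * ta n))) *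
  (B (n + l + m) * (B (2 * n - 1) * tb (2 * n - 1) * tb (2 * n)) * B (1 + k + 2 * l) /
   (B (n + l + k) * tb (n + l + k) * B (1 + 2 * l) *
    (B (2 * n + m - 1) * tb (2 * n + m - 1) * tb (2 * n + m)))) *
  (G (m - n) * G (k - n) * G (1 - l) * G (- l) /
   (G (m - l) * tg (m - l) * G (k - l) * (G (- n) * tg (- n)) * G (- n))).
transitivity (K * (T0 * ta (n + k + m) * (tb (n + l + m) * tg (m - n)))); first by rewrite /K; ring.
rewrite e4 mulrDr /K /T1 /T2; congr (_ + _).
  move: (A_nz (l + k + m)) (A_nz n) (B_nz (n + l + k)) (B_nz (1 + 2 * l)) (B_nz (2 * n + m - 1)).
  move: (G_nz (m - l)) (G_nz (k - l)) (G_nz (- n)).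
  move: (ta_nz (l + k + m)) (ta_nz n) (tb_nz (n + l + k)) (tb_nz (2 * n + m - 1)) (tb_nz (2 * n + m)).
  move: (tg_nz (1 + m - n)) (tg_nz (m - n)) (tg_nz (- n)) (tg_nz (1 - n)) (tg_nz (m - l)) (expfz_neq0 k q0).
  move: (tg (1 + m - n)) (tg (m - n)) (tg (- n)) (tg (1 - n)) (tg (m - l)) (q ^ k)
    (ta (l + k + m)) (ta n) (tb (n + l + k)) (tb (2 * n + m - 1)) (tb (2 * n + m))
    (G (m - l)) (G (k - l)) (G (- n)) (A (l + k + m)) (A n) (B (n + l + k)) (B (1 + 2 * l)) (B (2 * n + m - 1)).
  move: (q ^ _) (egam _) (iegam _) (iegam _) (A _) (A _) (B _) (B _) (B _) (tb _) (tb _) (G _) (G _) (G _) (G _) (q ^ _) (t1 _) (ta _) (tg _).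
  by clear; intros; apply horizontal_step_factor.
move: (tb_nz (2 * n + m)) (tg_nz (m - l)) (ta_nz (l + k + m)).
move: (A_nz (l + k + m)) (A_nz n) (B_nz (n + l + k)) (B_nz (1 + 2 * l)) (B_nz (2 * n + m - 1)).
move: (G_nz (m - l)) (G_nz (k - l)) (G_nz (- n)) (ta_nz n) (tb_nz (n + l + k)) (tb_nz (2 * n + m - 1)) (tg_nz (- n)).
move: (tg (- n)) (tg (m - l))
    (ta (l + k + m)) (ta n) (tb (n + l + k)) (tb (2 * n + m - 1)) (tb (2 * n + m))
    (G (m - l)) (G (k - l)) (G (- n)) (A (l + k + m)) (A n) (B (n + l + k)) (B (1 + 2 * l)) (B (2 * n + m - 1)).
move: (q ^ _) (egam _) (iegam _) (iegam _) (A _) (A _) (B _) (B _) (B _) (tb _) (tb _) (G _) (G _) (G _) (G _) (t1 _).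
by clear; intros; apply vertical_step_factor.
Qed.

Lemma wpath_id l k : wpath l k l k = 1.
Proof.
rewrite /wpath !subrr mul0r expr0z !addr0 iegamE // egam_1 invr1 !mulr1 mul1r.
have -> : 1 + l + l + k = 1 + k + 2 * l by ring.
have -> : 1 + 2 * l + k = 1 + k + 2 * l by ring.
have := A_nz (1 + l + k + k); have := A_nz (1 + l); have := B_nz (1 + 2 * l).
have := B_nz (1 + k + 2 * l); have := G_nz (1 + k - l); have := G_nz (k - l).
have := G_nz (1 - l); have := G_nz (- l).
move: (G _) (G _) (G _) (G _) (B _) (B _) (A _) (A _) => x1 x2 x3 x4 x5 x6 x7 x8 *.
by field; do ?[apply/andP; split].
Qed.

(** Closed form and generating function satisfy the same recursion in the end point,
    by removal of the last step. On the line n - l + m - k = 0 both vanish except at the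
    starting point. *)
Lemma path_gfE (l k n m : int) : 0 <= (n - l) + (m - k) ->
  path_gf a b q p (l, k) (n, m) = wpath l k n m.
Proof.
have [d] : exists d : nat, d = absz (n - l + (m - k)) by exists (absz (n - l + (m - k))).
elim: d n m => [|d IH] n m dE nm.
  have [nl|nl] := eqVneq n l.
    have mk : m = k by lia.
    by rewrite nl mk path_gf_id wpath_id.
  rewrite path_gf_empty; last by rewrite /=; lia.
  rewrite /wpath; have [h|h] := lerP n l.
    by rewrite (iegam_0 _ _ _ _ (_ : 1 + (n - l) <= 0)); [rewrite !(mulr0, mul0r) | lia].
  by rewrite (iegam_0 _ _ _ _ (_ : 1 + (m - k) <= 0)); [rewrite !(mulr0, mul0r) | lia].
rewrite path_gf_rec; last by rewrite /height /=; lia.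
rewrite /= !IH; first (rewrite -wpath_rec //); lia.
Qed.
End ClosedForm.
Arguments path_gfE {C a b q p} a0 b0 q0 th1 add sqrt gen l k n m.

(** * Telescoping products and sums *)

Section Telescope.
Variable (C : comNzRingType).
Implicit Types (f h : int -> C) (s x : int) (j r : nat).

(** In these lemmas the low range 1 <= t <= j refers a value to column 0 and the tail
    range j < t < r to the last column of a matrix of size r. *)
Lemma telescope_up f h s j x : (forall n, f (n + 1) = f n * h n) -> x = s + j%:Z ->
  f x = f s * \prod_(1 <= t < j.+1) h (s + t%:Z - 1).
Proof.
move=> H ->; elim: j => [|j IH]; first by rewrite addr0 big_geq // mulr1.
have e : s + j.+1%:Z = s + j%:Z + 1 by lia.
by rewrite big_nat_recr //= mulrA -IH e addrK -H.
Qed.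

Lemma telescope_down f h s j x : (forall n, f n = h n * f (n + 1)) -> x = s - j%:Z ->
  f x = f s * \prod_(1 <= t < j.+1) h (s - t%:Z).
Proof.
move=> H ->; elim: j => [|j IH]; first by rewrite subr0 big_geq // mulr1.
have e : s - j%:Z = s - j.+1%:Z + 1 by lia.
by rewrite big_nat_recr //= mulrA -IH e mulrC -H.
Qed.

Lemma telescope_up_tail f h s j r x : (j < r)%N ->
  (forall n, f (n + 1) = f n * h n) -> x = s - j%:Z ->
  f x = f (s - r%:Z + 1) * \prod_(j.+1 <= t < r) h (s - t%:Z).
Proof.
move=> jr H ->; have [d ->] : exists d, r = (j + d).+1 by exists (r - j.+1)%N; lia.
elim: d => [|d IH]; first by rewrite addn0 big_geq // mulr1; congr f; lia.
rewrite IH addnS [in RHS]big_nat_recr /=; last by lia.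
have -> : s - (j + d).+1%:Z + 1 = s - (j + d).+2%:Z + 1 + 1 by lia.
rewrite H -!mulrA; congr (_ * _); rewrite mulrC; congr (_ * h _); lia.
Qed.

Lemma telescope_down_tail f h s j r x : (j < r)%N ->
  (forall n, f n = h n * f (n + 1)) -> x = s + j%:Z ->
  f x = f (s + r%:Z - 1) * \prod_(j.+1 <= t < r) h (s + t%:Z - 1).
Proof.
move=> jr H ->; have [d ->] : exists d, r = (j + d).+1 by exists (r - j.+1)%N; lia.
elim: d => [|d IH]; first by rewrite addn0 big_geq // mulr1; congr f; lia.
rewrite IH addnS [in RHS]big_nat_recr /=; last by lia.
rewrite H; have -> : s + (j + d).+1%:Z - 1 + 1 = s + (j + d).+2%:Z - 1 by lia.
rewrite [h _ * _]mulrC -!mulrA; congr (_ * _); rewrite mulrC; congr (_ * h _); lia.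
Qed.

Lemma prod_triangle_ord r (H : nat -> nat -> C) :
  \prod_(1 <= t < r) \prod_(1 <= s < t.+1) H t s =
  \prod_(i < r) \prod_(1 <= s < i.+1) H i s.
Proof.
case: r => [|r]; first by rewrite big_geq // big_ord0.
by rewrite big_ord_recl [X in _ = X * _]big_geq // mul1r big_add1 big_mkord.
Qed.

Lemma prod_lt_snd r (x : 'I_r -> C) :
  \prod_(i < r) \prod_(j < r | (i < j)%N) x j = \prod_(j < r) x j ^+ j.
Proof.
rewrite (exchange_big_dep predT) //=; apply: eq_bigr => j _.
by rewrite -(big_ord_widen r (fun=> x j)) ?(ltnW (ltn_ord j)) // prodr_const card_ord.
Qed.

Lemma prod_lt_fst r (x : 'I_r -> C) :
  \prod_(i < r) \prod_(j < r | (i < j)%N) x i = \prod_(i < r) x i ^+ (r - i.+1).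
Proof.
apply: eq_bigr => i _.
rewrite -(big_geq_mkord i.+1 r predT (fun=> x i)) prodr_const_nat.
by [].
Qed.

End Telescope.

Section TelescopeField.
Variables (F : fieldType) (f h : int -> F).
Hypotheses (fS : forall n, f (n + 1) = f n * h n) (f0 : forall n, f n != 0).

Let fV n : (f n)^-1 = h n * (f (n + 1))^-1.
Proof.
have := f0 (n + 1); rewrite fS mulf_eq0 negb_or => /andP[n0 n1].
by rewrite invfM mulrCA mulfV ?mulr1.
Qed.

Lemma telescope_inv s (j : nat) x : x = s - j%:Z ->
  (f x)^-1 = (f s)^-1 * \prod_(1 <= t < j.+1) h (s - t%:Z).
Proof. exact: (telescope_down _ (fun x => (f x)^-1) h s j x fV). Qed.

Lemma telescope_inv_tail s (j r : nat) x : (j < r)%N -> x = s + j%:Z ->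
  (f x)^-1 = (f (s + r%:Z - 1))^-1 * \prod_(j.+1 <= t < r) h (s + t%:Z - 1).
Proof. by move=> jr; exact: (telescope_down_tail _ (fun x => (f x)^-1) h s j r x jr fV). Qed.

Lemma prod_up s (j : nat) : \prod_(1 <= t < j.+1) h (s + t%:Z - 1) = f (s + j%:Z) / f s.
Proof. by rewrite (telescope_up _ f h s j _ fS erefl) mulrAC mulfV ?mul1r. Qed.

Lemma prod_dn s (j : nat) : \prod_(1 <= t < j.+1) h (s - t%:Z) = f s / f (s - j%:Z).
Proof. by rewrite (telescope_inv s j _ erefl) mulrA mulfV ?mul1r. Qed.
End TelescopeField.

Lemma idxE r (i : 'I_r) : idx i = i%:Z + 1.
Proof. by rewrite /idx; lia. Qed.

Lemma sum_idx r : \sum_(i < r) idx i = ('C(r.+1, 2))%:Z.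
Proof.
elim: r => [|r IH]; first by rewrite big_ord0.
rewrite big_ord_recr /= [LHS](_ : _ = 'C(r.+1, 2)%:Z + r.+1%:Z); last by rewrite -IH.
by rewrite [in RHS]binS bin1 PoszD.
Qed.

Lemma sum_idx2 r : \sum_(i < r) (idx i * idx i) = 2 * ('C(r.+1, 3))%:Z + ('C(r.+1, 2))%:Z.
Proof.
elim: r => [|r IH]; first by rewrite big_ord0.
rewrite big_ord_recr [LHS](_ : _ = \sum_(i < r) idx i * idx i + r.+1%:Z * r.+1%:Z) //.
have e : 2 * ('C(r.+1, 2))%:Z = r.+1%:Z * r%:Z.
  have := mul_bin_diag r.+1 1; rewrite bin1 /= => e.
  by rewrite (_ : r.+1%:Z * r%:Z = (r.+1 * r)%N%:Z) // e PoszM.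
rewrite IH (binS r.+1 2) (binS r.+1 1) bin1.
rewrite (PoszD 'C(r.+1, 3) 'C(r.+1, 2)) (PoszD 'C(r.+1, 2) r.+1).
have -> : r.+1%:Z * r.+1%:Z = r.+1%:Z * r%:Z + r.+1%:Z.
  have -> : r.+1%:Z = r%:Z + 1 by lia.
  by ring.
by rewrite -e; ring.
Qed.

(** Apart from the parameters of the rows, the exponents of q are quadratic in the index. *)
Lemma sum_quad r (x y z : int) :
  \sum_(i < r) (x + y * idx i + z * (idx i * idx i)) =
  x * r%:Z + y * ('C(r.+1, 2))%:Z + z * (2 * ('C(r.+1, 3))%:Z + ('C(r.+1, 2))%:Z).
Proof.
rewrite !big_split /= -!mulr_sumr sum_idx sum_idx2 sumr_const card_ord.
by rewrite -[x *+ r]mulr_natr natz.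
Qed.

Lemma bin2E r : r%:Z * r%:Z = 2 * ('C(r.+1, 2))%:Z - r%:Z.
Proof.
have := mul_bin_diag r.+1 1; rewrite bin1 /= => e.
have -> : 2 * ('C(r.+1, 2))%:Z = (r.+1 * r)%N%:Z by rewrite e PoszM.
by rewrite PoszM (_ : r.+1%:Z = r%:Z + 1) ?mulrDl ?mul1r ?addrK //; lia.
Qed.

Lemma bin3E r : ('C(r.+2, 3))%:Z = ('C(r.+1, 3))%:Z + ('C(r.+1, 2))%:Z.
Proof. by rewrite (binS r.+1 2) (PoszD 'C(r.+1, 3) 'C(r.+1, 2)). Qed.

Lemma prod3_eq (F : comNzRingType) r (x : F) (F1 F2 F3 H : 'I_r -> F) :
  (forall i, H i = F1 i * F2 i * F3 i) ->
  x * \prod_(i < r) F1 i * \prod_(i < r) F2 i * \prod_(i < r) F3 i = x * \prod_(i < r) H i.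
Proof.
move=> HE; rewrite (eq_bigr _ (fun i _ => HE i)) !big_split /= -!mulrA; by [].
Qed.

Lemma prod4_eq (F : comNzRingType) r (x : F) (F1 F2 F3 F4 H : 'I_r -> F) :
  (forall i, H i = F1 i * F2 i * F3 i * F4 i) ->
  x * \prod_(i < r) F1 i * \prod_(i < r) F2 i * \prod_(i < r) F3 i * \prod_(i < r) F4 i =
  x * \prod_(i < r) H i.
Proof.
move=> HE; rewrite (eq_bigr _ (fun i _ => HE i)) !big_split /= -!mulrA; by [].
Qed.

Lemma bin2S r : ('C(r.+1, 2))%:Z = ('C(r, 2))%:Z + r%:Z.
Proof. by rewrite (binS r 1) bin1 (PoszD 'C(r, 2) r). Qed.

Lemma bin3S r : ('C(r.+1, 3))%:Z = ('C(r, 3))%:Z + ('C(r, 2))%:Z.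
Proof. by rewrite (binS r 2) (PoszD 'C(r, 3) 'C(r, 2)). Qed.

Lemma mul_bin2 r : r%:Z * ('C(r, 2))%:Z = 3 * ('C(r, 3))%:Z + 2 * ('C(r, 2))%:Z.
Proof.
elim: r => [|r IH]; first by rewrite !bin0n mul0r.
rewrite bin2S bin3S (_ : r.+1%:Z = r%:Z + 1); last by lia.
have e : r%:Z * r%:Z = 2 * ('C(r, 2))%:Z + r%:Z by have := bin2E r; rewrite bin2S => ->; ring.
by rewrite !mulrDl !mulrDr IH e; ring.
Qed.

Lemma prod_expz (F : fieldType) (q : F) r (e : 'I_r -> int) : q != 0 ->
  \prod_(i < r) q ^ (e i) = q ^ (\sum_(i < r) e i).
Proof.
move=> q0; elim/big_rec2: _ => [|i x y _ ->]; first by rewrite expr0z.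
by rewrite expfzDr.
Qed.

(** * Shifted factorials as quotients of lattice values *)

Section Conversions.
Variables (C : numFieldType) (a b q p : C).
Local Notation th := (theta1 p).
Hypotheses (q0 : q != 0) (th1 : th 1 = 0) (gen : generic a b q p).
Local Notation A := (shf C q p a).
Local Notation B := (shf C q p b).
Local Notation G := (shf C q p (a / b)).

Lemma tpoch_a s n : tpoch q p [:: a * q ^ s] n = A (s + n) / A s.
Proof.
by rewrite /tpoch big_seq1 (shf_shift _ _ _ q0 _ (ta_nz _ _ _ _ _ gen)).
Qed.

Lemma tpoch_b s n : tpoch q p [:: b * q ^ s] n = B (s + n) / B s.
Proof.
by rewrite /tpoch big_seq1 (shf_shift _ _ _ q0 _ (tb_nz _ _ _ _ _ gen)).
Qed.

Lemma tpoch_g s n : tpoch q p [:: a * q ^ s / b] n = G (s + n) / G s.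
Proof.
by rewrite /tpoch big_seq1 mulrAC (shf_shift _ _ _ q0 _ (tg_nz _ _ _ _ _ gen)).
Qed.

Lemma tpoch_gg s t n : tpoch q p [:: a * q ^ s / b; a * q ^ t / b] n =
  (G (s + n) / G s) * (G (t + n) / G t).
Proof.
rewrite /tpoch big_cons big_seq1; congr (_ * _).
  by rewrite -tpoch_g /tpoch big_seq1.
by rewrite -tpoch_g /tpoch big_seq1.
Qed.

Let qnz : forall n : int, 0 < n -> th (q ^ n) != 0.
Proof. by case: gen. Qed.

Lemma tpoch_1 s n : 0 < s + n -> tpoch q p [:: q ^ s] n = egam C q p (s + n) * iegam C q p s.
Proof. by move=> sn; rewrite /tpoch big_seq1 (tpoch1_qs C q p q0 qnz th1). Qed.

Lemma tpoch_q n : (tpoch q p [:: q] n)^-1 = iegam C q p (1 + n).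
Proof. by rewrite /tpoch big_seq1 (tpoch1_q C q p q0 th1). Qed.

Lemma theta_pair x y : theta p [:: x; y] = th x * th y.
Proof. by rewrite /theta big_cons big_seq1. Qed.

Lemma iegam_step n : iegam C q p n = thq C q p 1 n * iegam C q p (n + 1).
Proof. by rewrite thqE mul1r; exact: (iegamS C q p q0 qnz th1). Qed.

Lemma prod_egam_dn s (j : nat) : 0 < s - j%:Z ->
  \prod_(1 <= t < j.+1) thq C q p 1 (s - t%:Z) = egam C q p s / egam C q p (s - j%:Z).
Proof.
have g0 n := egam_neq0 C q p q0 qnz n.
elim: j => [|j IH] sj; first by rewrite big_geq // subr0 divff.
rewrite big_nat_recr //= IH; last by lia.
have -> : s - j%:Z = s - j.+1%:Z + 1 by lia.
have tn : thq C q p 1 (s - j.+1%:Z) != 0 by rewrite thqE mul1r qnz.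
rewrite egamS // thqE mul1r; rewrite thqE mul1r in tn.
have := g0 (s - j.+1%:Z); move: (egam C q p (s - j.+1%:Z)) (egam C q p s) (th _) tn => x y z hz hx.
by field; rewrite hx hz.
Qed.

End Conversions.
Arguments prod_up {F f h} fS f0 s j.
Arguments prod_dn {F f h} fS f0 s j.
Arguments tpoch_1 {C a b q p} q0 th1 gen s n.
Arguments tpoch_q {C q p} q0 th1 n.
Arguments tpoch_a {C a b q p} q0 gen s n.
Arguments tpoch_b {C a b q p} q0 gen s n.
Arguments tpoch_g {C a b q p} q0 gen s n.
Arguments tpoch_gg {C a b q p} q0 gen s t n.
Arguments prod_egam_dn {C a b q p} q0 gen s j.

(** * Assembling the determinants *)

(** Generalizes the values of f in the goal, identifying those whose arguments agree by
    linear arithmetic. *)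
Tactic Notation "collapse" constr(f) :=
  repeat match goal with |- context [f ?e] =>
    let g := fresh "z" in set g := (f e);
    repeat match goal with |- context [f ?e'] =>
      rewrite (_ : f e' = g); [| rewrite /g; congr f; clear; lia] end;
    move: g => g
  end.

Tactic Notation "collapse" constr(f) "with" constr(H) :=
  repeat match goal with |- context [f ?e] =>
    let g := fresh "z" in let hg := fresh "hz" in
    move: (H e); set g := (f e);
    repeat match goal with |- context [f ?e'] =>
      rewrite (_ : f e' = g); [| rewrite /g; congr f; clear; lia] end;
    move: g => g hg
  end.

Lemma prod_nat_split (F : comNzRingType) m n (f g h : nat -> F) :
  (forall t, f t = g t * h t) ->
  \prod_(m <= t < n) f t = \prod_(m <= t < n) g t * \prod_(m <= t < n) h t.
Proof. by move=> e; rewrite -big_split; apply: eq_bigr. Qed.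

Arguments prod_nat_split {F m n f g h}.

Section Assembly.
Variables (F : fieldType) (q : F).
Hypothesis q0 : q != 0.

Lemma prod_nat_splitq m n e (f g h : nat -> F) :
  (forall t, f t = q ^ e * (g t * h t)) ->
  \prod_(m <= t < n) f t = q ^ (e * (n - m)%N%:Z) *
    (\prod_(m <= t < n) g t * \prod_(m <= t < n) h t).
Proof.
move=> fE; rewrite (prod_nat_split fE) prodr_const_nat exprnP exprz_exp.
by rewrite -big_split.
Qed.

Variable r : nat.
Implicit Types (T U : 'I_r -> 'I_r -> F) (y : 'I_r -> int).

Lemma pairs_snd T U y :
  (forall i j, T i j = q ^ (y j) * U i j) ->
  \prod_(i < r) \prod_(j < r | (i < j)%N) T i j =
  \prod_(i < r) q ^ (y i * (idx i - 1)) * \prod_(i < r) \prod_(j < r | (i < j)%N) U i j.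
Proof.
move=> TE; rewrite (eq_bigr _ (fun i _ => eq_bigr _ (fun j _ => TE i j))).
rewrite (eq_bigr _ (fun i _ => big_split _ _ _ _ _)) big_split /= prod_lt_snd; congr (_ * _).
by apply: eq_bigr => i _; rewrite exprnP exprz_exp; congr (q ^ (_ * _)); rewrite /idx; lia.
Qed.

Lemma pairs_fst T U y :
  (forall i j, T i j = q ^ (y i) * U i j) ->
  \prod_(i < r) \prod_(j < r | (i < j)%N) T i j =
  \prod_(i < r) q ^ (y i * (r%:Z - idx i)) * \prod_(i < r) \prod_(j < r | (i < j)%N) U i j.
Proof.
move=> TE; rewrite (eq_bigr _ (fun i _ => eq_bigr _ (fun j _ => TE i j))).
rewrite (eq_bigr _ (fun i _ => big_split _ _ _ _ _)) big_split /= prod_lt_fst; congr (_ * _).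
apply: eq_bigr => i _; rewrite exprnP exprz_exp; congr (q ^ (_ * _)).
by have := ltn_ord i; rewrite /idx; lia.
Qed.

(** Row and column factors leave the determinant, the triangular product D is collected
    along its rows, and all powers of q are gathered into one exponent. *)
Lemma det_assemble (M K : 'I_r -> 'I_r -> F) (er ec x : 'I_r -> int) (d : nat -> int)
    (row col : 'I_r -> F) (diag : nat -> F) (D : nat -> nat -> F) T U :
  (forall i j, M i j = (q ^ (er i) * row i) * (q ^ (ec j) * col j) * K i j) ->
  \det (\matrix_(i < r, j < r) K i j) =
    \prod_(i < r) \prod_(j < r | (i < j)%N) T i j *
    \prod_(1 <= t < r) \prod_(1 <= s < t.+1) D t s ->
  \prod_(i < r) \prod_(j < r | (i < j)%N) T i j =
    \prod_(i < r) q ^ (x i) * \prod_(i < r) \prod_(j < r | (i < j)%N) U i j ->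
  (forall t, \prod_(1 <= s < t.+1) D t s = q ^ (d t) * diag t) ->
  \det (\matrix_(i < r, j < r) M i j) =
    q ^ (\sum_(i < r) (er i + ec i + x i + d i)) *
    \prod_(i < r) \prod_(j < r | (i < j)%N) U i j *
    \prod_(i < r) (row i * col i * diag i).
Proof.
move=> ME KE TE DE.
rewrite (_ : (\matrix_(i, j) M i j) =
  \matrix_(i, j) ((q ^ (er i) * row i) * (q ^ (ec j) * col j) * K i j)); last first.
  by apply/matrixP => i j; rewrite !mxE ME.
rewrite det_scale KE TE prod_triangle_ord (eq_bigr _ (fun i _ => DE (nat_of_ord i))).
have -> : q ^ (\sum_(i < r) (er i + ec i + x i + d i)) = \prod_(i < r) q ^ (er i) *
    \prod_(i < r) q ^ (ec i) * \prod_(i < r) q ^ (x i) * \prod_(i < r) q ^ (d i).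
  by rewrite -prod_expz // -!big_split; apply: eq_bigr => i _; rewrite !expfzDr.
by rewrite !big_split /=; ring.
Qed.

Lemma det_assemble3 (M : 'I_r -> 'I_r -> F) (e : int)
    (H F1 F2 F3 : 'I_r -> F) (g : 'I_r -> int) (U : F) :
  \det (\matrix_(i < r, j < r) M i j) = q ^ (\sum_(i < r) g i) * U * \prod_(i < r) H i ->
  \sum_(i < r) g i = e -> (forall i, H i = F1 i * F2 i * F3 i) ->
  \det (\matrix_(i < r, j < r) M i j) =
  q ^ e * U * \prod_(i < r) F1 i * \prod_(i < r) F2 i * \prod_(i < r) F3 i.
Proof. by move=> -> -> HE; rewrite (prod3_eq _ _ _ _ _ _ _ HE). Qed.

Lemma det_assemble4 (M : 'I_r -> 'I_r -> F) (e : int)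
    (H F1 F2 F3 F4 : 'I_r -> F) (g : 'I_r -> int) (U : F) :
  \det (\matrix_(i < r, j < r) M i j) = q ^ (\sum_(i < r) g i) * U * \prod_(i < r) H i ->
  \sum_(i < r) g i = e -> (forall i, H i = F1 i * F2 i * F3 i * F4 i) ->
  \det (\matrix_(i < r, j < r) M i j) =
  q ^ e * U * \prod_(i < r) F1 i * \prod_(i < r) F2 i * \prod_(i < r) F3 i * \prod_(i < r) F4 i.
Proof. by move=> -> -> HE; rewrite (prod4_eq _ _ _ _ _ _ _ _ HE). Qed.

End Assembly.
Arguments prod_nat_splitq {F q m n e f g h}.
Arguments pairs_snd {F q} q0 {r T U} y.
Arguments pairs_fst {F q} q0 {r T U} y.
Arguments det_assemble {F q} q0 {r M K} er ec {x} d row col diag {D T U}.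
Arguments det_assemble3 {F q r M e H F1 F2 F3 g U}.
Arguments det_assemble4 {F q r M e H F1 F2 F3 F4 g U}.

(** The theta products at monomials in q are products of two values of thq. *)
Section Arguments.
Variables (C : numFieldType) (q p : C).
Hypothesis q0 : q != 0.
Local Notation tp := (th2 C (theta1 p)).
Local Notation thq := (thq C q p).
Implicit Types (x y z : C) (e f g : int).

Lemma th2_11 x e f g : tp (x * q ^ e) (q ^ f) (q ^ g) = thq x (e + f + g) * thq 1 (f - g).
Proof.
rewrite /th2 !thqE mul1r; congr (theta1 p _ * theta1 p _).
  by rewrite -!mulrA -!expfzDr ?addrA.
by rewrite invr_expz -expfzDr.
Qed.

Lemma th2_y1 x y e f g :
  tp (x * q ^ e) (y * q ^ f) (q ^ g) = thq (x * y) (e + f + g) * thq y (f - g).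
Proof.
rewrite /th2 !thqE; congr (theta1 p _ * theta1 p _).
  by rewrite mulrACA -!mulrA -!expfzDr ?addrA.
by rewrite invr_expz -mulrA -expfzDr.
Qed.

Lemma th2_1z x z e f g :
  tp (x * q ^ e) (q ^ f) (z * q ^ g) = thq (x * z) (e + f + g) * thq z^-1 (f - g).
Proof.
rewrite /th2 !thqE; congr (theta1 p _ * theta1 p _).
  by rewrite -[x * _ * _]mulrA mulrACA -!mulrA -!expfzDr ?addrA.
by rewrite invfM invr_expz mulrCA -expfzDr.
Qed.
End Arguments.
Arguments th2_11 {C q p} q0 x e f g.
Arguments th2_y1 {C q p} q0 x y e f g.
Arguments th2_1z {C q p} q0 x z e f g.

Lemma prod_rev_shift (F : comNzRingType) r (f : int -> F) (s : int) :
  \prod_(i < r) f (s - i%:Z) = \prod_(i < r) f (s - r%:Z + 1 + i%:Z).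
Proof.
rewrite (reindex_inj rev_ord_inj) /=; apply: eq_bigr => i _; congr f.
by have := ltn_ord i; lia.
Qed.

Lemma prod_replace_factor (F : comNzRingType) r (f g h h' : 'I_r -> F) :
  \prod_(i < r) h i = \prod_(i < r) h' i ->
  \prod_(i < r) (f i * g i * h i) = \prod_(i < r) (f i * g i * h' i).
Proof. by move=> e; rewrite !big_split e. Qed.
Arguments prod_replace_factor {F r f g h h'}.

(** * Common notation for the six evaluations *)

(** In each case, [th2A] and [th2B] identify the brackets of the row parameter xi with
    eta and with zeta as products of two values of thq, and [th2D] does so for eta with
    zeta. The entry lemma splits the closed form into row factors, column factors and these
    brackets. The diagonal lemma collects the brackets of eta_t with all zeta_s, s <= t, into
    one factor for each index t, the exponent lemma sums the powers of q, and the theorem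
    compares the remaining values index by index. *)
Section Evaluations.
Variables (C : numFieldType) (a b q p : C).
Local Notation th := (theta1 p).
Hypotheses (a0 : a != 0) (b0 : b != 0) (q0 : q != 0).
Hypothesis th1 : th 1 = 0.
Hypothesis thV : forall x, x != 0 -> th x^-1 = - th x / x.
Hypothesis add : addition_formula C th.
Hypothesis sqrt : forall c : C, exists d, d ^+ 2 = c.
Hypothesis gen : generic a b q p.
Local Notation A := (shf C q p a).
Local Notation B := (shf C q p b).
Local Notation G := (shf C q p (a / b)).
Local Notation ta := (thq C q p a).
Local Notation tb := (thq C q p b).
Local Notation tg := (thq C q p (a / b)).
Local Notation t1 := (thq C q p 1).
Local Notation egam := (egam C q p).
Local Notation iegam := (iegam C q p).
Local Notation th2 := (th2 C th).

Let nontriv : exists2 z, z != 0 & th z != 0.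
Proof. by exists q => //; case: gen => /(_ 1) h _ _ _; rewrite -[q]expr1z h. Qed.

Let A_n n : A n != 0 := A_nz C a b q p gen n.
Let B_n n : B n != 0 := B_nz C a b q p gen n.
Let G_n n : G n != 0 := G_nz C a b q p gen n.
Let A_S n : A (n + 1) = A n * ta n := AS C a b q p q0 gen n.
Let B_S n : B (n + 1) = B n * tb n := BS C a b q p q0 gen n.
Let G_S n : G (n + 1) = G n * tg n := GS C a b q p q0 gen n.
Let iegam_S n : iegam n = t1 n * iegam (n + 1) := iegam_step C a b q p q0 th1 gen n.
Let egam_n n : egam n != 0.
Proof. by apply: (egam_neq0 C q p q0); case: gen. Qed.
Let q_n e : q ^ e != 0 := expfz_neq0 e q0.

Ltac nonzero := rewrite ?mulf_neq0 ?invr_eq0 ?q_n.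

Ltac shifted_factorials_to_values :=
  rewrite !invfM (tpoch_q q0 th1) !(tpoch_a q0 gen) !(tpoch_b q0 gen);
  rewrite !(tpoch_gg q0 gen) !(tpoch_g q0 gen).

Ltac compare_entries :=
  do ?[move: (\prod_(_ <= t < _) _) => ?]; do ?[move: (q ^ _) => ?];
  collapse egam; collapse iegam; collapse A; collapse B; collapse G; by ring.

Ltac compare_values :=
  collapse egam with egam_n; collapse iegam;
  collapse A with A_n; collapse B with B_n; collapse G with G_n;
  by field; do ?[apply/andP; split].

(** * End points on a vertical line *)

Section VerticalEnds.
Variables (r : nat) (l k n : int) (m : 'I_r -> int).
Hypothesis pos : forall i, 0 <= n - l + m i - k.

(** The factors of the closed form that involve m_i together with j are values of A and
    iegam, which telescope to the last column, and of B and 1 / G, which telescope to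
    column 0. Their quotients pair up to theta products of base c at q^(m_i): A and iegam
    to those with eta, B and 1 / G to those with zeta. *)
Let c := a * q ^ (1 + n).
Let xi (i : 'I_r) := q ^ (m i).
Let eta (t : nat) := q ^ (k - t%:Z - 1).
Let zeta (t : nat) := b / a * q ^ (l + t%:Z).

Let th2A i t : th2 c (xi i) (eta t) =
  ta (n + k + m i - t%:Z) * t1 (2 + m i - k + t%:Z - 1).
Proof.
rewrite /c /xi /eta /zeta (th2_11 q0).
by congr (ta _ * t1 _); lia.
Qed.

Let th2B i t : th2 c (xi i) (zeta t) =
  tb (2 + n + l + m i + t%:Z - 1) * tg (m i - l - t%:Z).
Proof.
rewrite /c /xi /eta /zeta (th2_1z q0).
rewrite (_ : a * (b / a) = b); last by field; rewrite ?a0 ?b0.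
rewrite (_ : (b / a)^-1 = a / b); last by field; rewrite ?a0 ?b0.
by congr (tb _ * tg _); lia.
Qed.

Let th2D t s : th2 c (eta t) (zeta s) / eta t =
  q ^ (1 + t%:Z - k) * (tb (1 + n + k + l - t%:Z + s%:Z - 1) * tg (k - l - t%:Z - 1 - s%:Z)).
Proof.
rewrite /c /xi /eta /zeta (th2_1z q0).
rewrite (_ : a * (b / a) = b); last by field; rewrite ?a0 ?b0.
rewrite (_ : (b / a)^-1 = a / b); last by field; rewrite ?a0 ?b0.
rewrite invr_expz mulrC.
by congr (q ^ _ * (tb _ * tg _)); lia.
Qed.

Let rowf (i : 'I_r) := egam (1 + n - l + m i - k) * iegam (1 + m i - k + r%:Z) *
  (A (1 + n + k + m i - r%:Z) / A (1 + l + k + m i)) *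
  (B (2 + n + l + m i) / B (1 + 2 * n + m i)) * (G (1 + m i - n) / G (m i - l)).
Let colf (J : int) := iegam (1 + n - l - J) * (A (1 + l + J) / A (1 + n)) *
  (B (1 + 2 * n) * B (1 + k + 2 * l + J) / (B (1 + n + l + k) * B (1 + 2 * l + 2 * J))) *
  (G (k - J - n) * G (1 - l - J) * G (- l - J) / (G (k - l - 2 * J) * G (1 - n) * G (- n))).
Let diagf (t : nat) := B (1 + n + k + l) / B (1 + n + k + l - t%:Z) *
  (G (k - l - t%:Z - 1) / G (k - l - 2 * t%:Z - 1)).

Lemma entry_vertical_ends (i j : 'I_r) : path_gf a b q p (l + idx j, k - idx j) (n, m i) =
  (q ^ 0 * rowf i) * (q ^ ((n - l - idx j) * (k - idx j)) * colf (idx j)) *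
  (\prod_(j.+1 <= t < r) th2 c (xi i) (eta t) * \prod_(1 <= t < j.+1) th2 c (xi i) (zeta t)).
Proof.
rewrite (path_gfE a0 b0 q0 th1 add sqrt gen); last by have := pos i; lia.
rewrite (idxE _ j); have jr := ltn_ord j.
rewrite (prod_nat_split (th2A i)) (prod_nat_split (th2B i)).
rewrite /wpath (_ : q ^ ((n - (l + (j%:Z + 1))) * (k - (j%:Z + 1))) =
  q ^ 0 * q ^ ((n - l - (j%:Z + 1)) * (k - (j%:Z + 1)))); last first.
  rewrite -!expfzDr //; congr (q ^ _); ring.
rewrite (telescope_up_tail _ A ta (n + k + m i) _ _
  (1 + n + (k - (j%:Z + 1)) + m i) jr A_S); last by lia.
rewrite (telescope_down_tail _ iegam t1 (2 + m i - k) _ _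
  (1 + (m i - (k - (j%:Z + 1)))) jr iegam_S); last by lia.
rewrite (telescope_up _ B tb (2 + n + l + m i) j
  (1 + n + (l + (j%:Z + 1)) + m i) B_S); last by lia.
rewrite !invfM.
rewrite (telescope_inv _ G tg G_S G_n (m i - l) j
  (1 + m i - (l + (j%:Z + 1)))); last by lia.
rewrite /rowf /colf !invfM.
move: (j%:Z) (m i) => *; compare_entries.
Qed.

Lemma diagonal_vertical_ends (t : nat) :
  \prod_(1 <= s < t.+1) (th2 c (eta t) (zeta s) / eta t) = q ^ ((1 + t%:Z - k) * t%:Z) * diagf t.
Proof.
rewrite (prod_nat_splitq (th2D t)) subn1 /diagf; congr (_ * _).
rewrite (prod_up B_S B_n).
rewrite (prod_dn G_S G_n).
by congr (B _ / B _ * (G _ / G _)); lia.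
Qed.

Lemma exponent_vertical_ends :
  \sum_(i < r) (0 + (n - l - idx i) * (k - idx i) + m i * (idx i - 1) + (1 + i%:Z - k) * i%:Z) =
  3 * 'C(r.+1, 3)%:Z + 'C(r.+2, 3)%:Z + r%:Z * (n - l) * k
           - (n - l) * 'C(r.+1, 2)%:Z - r%:Z ^+ 2 * k
           + \sum_(i < r) (idx i - 1) * m i.
Proof.
rewrite [LHS](eq_bigr (fun i : 'I_r => ((n - l + 1) * k + (k - (n - l) - 1 - 2 * k - k) * idx i +
  2 * (idx i * idx i)) + (idx i - 1) * m i)); last first.
  by move=> i _; rewrite (_ : i%:Z = idx i - 1); [ring | rewrite /idx; lia].
by rewrite big_split /= sum_quad bin3E expr2 bin2E; ring.
Qed.

Theorem path_det_vertical_ends :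
  path_det a b q p (fun i : 'I_r => (l + idx i, k - idx i)) (fun i => (n, m i)) =
  q ^ (3 * 'C(r.+1, 3)%:Z + 'C(r.+2, 3)%:Z + r%:Z * (n - l) * k
       - (n - l) * 'C(r.+1, 2)%:Z - r%:Z ^+ 2 * k
       + \sum_(i < r) (idx i - 1) * m i) *
  (\prod_(i < r) \prod_(j < r | (i < j)%N)
     theta p [:: q ^ (m i - m j); a * q ^ (1 + n + m i + m j)]) *
  (\prod_(i < r)
    ((tpoch q p [:: q ^ (1 + n - l - idx i)] (m i - k + idx i) *
      tpoch q p [:: a * q ^ (1 + n + 2 * k - r%:Z - idx i)]
        (m i - k + idx i) *
      tpoch q p [:: a * q ^ (1 + l + 2 * k - idx i)] (n - l - r%:Z)) /
     (tpoch q p [:: q] (m i - k + r%:Z) *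
      tpoch q p [:: a * q ^ (1 + l + 2 * k - idx i)] (m i - k + idx i) *
      tpoch q p [:: a * q ^ (1 + l + idx i)] (n - l - idx i)))) *
  (\prod_(i < r)
    ((tpoch q p [:: b * q ^ (2 + n + k + l - idx i)] (m i - k + idx i) *
      tpoch q p [:: b * q ^ (1 + 2 * l + 2 * idx i)]
        (2 * n - 2 * l - 2 * idx i)) /
     (tpoch q p [:: b * q ^ (1 + 2 * n + k - idx i)] (m i - k + idx i) *
      tpoch q p [:: b * q ^ (1 + 2 * l + k + idx i)]
        (2 * n - 2 * l - 2 * idx i)))) *
  (\prod_(i < r)
    ((tpoch q p [:: a * q ^ (1 + k - n - idx i) / b] (m i - k + idx i) *
      tpoch q p [:: a * q ^ (1 - n) / b; a * q ^ (- n) / b]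
        (n - l - idx i)) /
     (tpoch q p [:: a * q ^ (k - l - idx i) / b] (m i - k + idx i) *
      tpoch q p [:: a * q ^ (1 + k - n - idx i) / b;
                    a * q ^ (k - n - idx i) / b] (n - l - idx i)))).
Proof.
have c0 : c != 0 by rewrite /c; nonzero.
have xi0 i : xi i != 0 by exact: q_n.
have eta0 t : eta t != 0 by rewrite /eta; nonzero.
have zeta0 t : zeta t != 0 by rewrite /zeta; nonzero.
rewrite /path_det.
have pairsE (i j : 'I_r) : xi j * th2 c (xi i) (xi j) =
    q ^ (m j) * theta p [:: q ^ (m i - m j); a * q ^ (1 + n + m i + m j)].
  rewrite theta_pair /c /xi (th2_11 q0) !thqE mul1r.
  rewrite [th _ * _]mulrC; congr (_ * (th (q ^ _) * th (_ * q ^ _))); lia.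
have main := det_assemble q0 (fun i => 0) (fun j => (n - l - idx j) * (k - idx j))
  (fun t => (1 + t%:Z - k) * t%:Z) rowf (fun j => colf (idx j)) diagf entry_vertical_ends
  (theta_det1 add sqrt nontriv c0 xi0 eta0 zeta0)
  (pairs_snd q0 m pairsE) diagonal_vertical_ends.
apply: (det_assemble3 main exponent_vertical_ends).
move=> i; rewrite (tpoch_1 q0 th1 gen); last by have := pos i; rewrite /idx; lia.
shifted_factorials_to_values.
rewrite /rowf /colf /diagf.
rewrite (idxE _ i).
move: (m i) (i%:Z) (r%:Z) => M J r'.
compare_values.
Qed.
End VerticalEnds.

(** * End points on a horizontal line *)

Section HorizontalEnds.
Variables (r : nat) (l k m : int) (n : 'I_r -> int).
Hypothesis pos : forall i, 0 <= n i - l + m - k.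

(** Here A and G telescope to the last column and give the theta products with eta,
    whereas B and iegam telescope to column 0 and give those with zeta. *)
Let c := b * q ^ (1 + m).
Let xi (i : 'I_r) := q ^ (n i).
Let eta (t : nat) := a / b * q ^ (k - 1 - t%:Z).
Let zeta (t : nat) := q ^ (l + t%:Z).

Let th2A i t : th2 c (eta t) (xi i) =
  ta (n i + k + m - t%:Z) * tg (k - n i - 1 - t%:Z).
Proof.
rewrite /c /xi /eta /zeta (th2_y1 q0).
rewrite (_ : b * (a / b) = a); last by field; rewrite ?a0 ?b0.
by congr (ta _ * tg _); lia.
Qed.

Let th2B i t : th2 c (xi i) (zeta t) / xi i =
  q ^ (- n i) * (tb (2 + n i + l + m + t%:Z - 1) * t1 (n i - l - t%:Z)).
Proof.
rewrite /c /xi /eta /zeta (th2_11 q0).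
rewrite invr_expz mulrC.
by congr (q ^ _ * (tb _ * t1 _)); lia.
Qed.

Let th2D t s : th2 c (eta t) (zeta s) =
  ta (1 + m + k + l - t%:Z + s%:Z - 1) * tg (k - l - t%:Z - 1 - s%:Z).
Proof.
rewrite /c /xi /eta /zeta (th2_y1 q0).
rewrite (_ : b * (a / b) = a); last by field; rewrite ?a0 ?b0.
by congr (ta _ * tg _); lia.
Qed.

Let rowf (i : 'I_r) := egam (1 + n i - l + m - k) * iegam (n i - l) *
  (A (1 + n i + k + m - r%:Z) / A (1 + n i)) *
  (B (2 + n i + l + m) * B (1 + 2 * n i) / (B (1 + n i + l + k) * B (1 + 2 * n i + m))) *
  (G (1 + m - n i) * G (k - n i - r%:Z) / (G (1 - n i) * G (- n i))).
Let colf (J : int) := iegam (1 + m - k + J) * (A (1 + l + J) / A (1 + l + k + m)) *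
  (B (1 + k + 2 * l + J) / B (1 + 2 * l + 2 * J)) *
  (G (1 - l - J) * G (- l - J) / (G (1 + m - l - J) * G (k - l - 2 * J))).
Let diagf (t : nat) := A (1 + m + k + l) / A (1 + m + k + l - t%:Z) *
  (G (k - l - t%:Z - 1) / G (k - l - 2 * t%:Z - 1)).

Lemma entry_horizontal_ends (i j : 'I_r) : path_gf a b q p (l + idx j, k - idx j) (n i, m) =
  (q ^ (n i * (k - 1)) * rowf i) * (q ^ (- (l + idx j) * (k - idx j)) * colf (idx j)) *
  (\prod_(j.+1 <= t < r) th2 c (eta t) (xi i) * \prod_(1 <= t < j.+1) (th2 c (xi i) (zeta t) / xi i)).
Proof.
rewrite (path_gfE a0 b0 q0 th1 add sqrt gen); last by have := pos i; lia.
rewrite (idxE _ j); have jr := ltn_ord j.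
rewrite (prod_nat_split (th2A i)) (prod_nat_splitq (th2B i)).
rewrite /wpath (_ : q ^ ((n i - (l + (j%:Z + 1))) * (k - (j%:Z + 1))) =
  q ^ (n i * (k - 1)) * q ^ (- (l + (j%:Z + 1)) * (k - (j%:Z + 1))) *
  q ^ ((- n i) * (j.+1 - 1)%N%:Z)); last first.
  rewrite -!expfzDr //; congr (q ^ _).
  rewrite (_ : (j.+1 - 1)%N%:Z = j%:Z); last by lia.
  by ring.
rewrite (telescope_up_tail _ A ta (n i + k + m) _ _
  (1 + n i + (k - (j%:Z + 1)) + m) jr A_S); last by lia.
rewrite (telescope_up_tail _ G tg (k - n i - 1) _ _
  ((k - (j%:Z + 1)) - n i) jr G_S); last by lia.
rewrite (telescope_down _ iegam t1 (n i - l) j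
  (1 + (n i - (l + (j%:Z + 1)))) iegam_S); last by lia.
rewrite (telescope_up _ B tb (2 + n i + l + m) j
  (1 + n i + (l + (j%:Z + 1)) + m) B_S); last by lia.
rewrite /rowf /colf !invfM.
move: (j%:Z) (n i) => *; compare_entries.
Qed.

Lemma diagonal_horizontal_ends (t : nat) :
  \prod_(1 <= s < t.+1) th2 c (eta t) (zeta s) = q ^ 0 * diagf t.
Proof.
rewrite (prod_nat_split (th2D t)) expr0z mul1r /diagf.
rewrite (prod_up A_S A_n).
rewrite (prod_dn G_S G_n).
by congr (A _ / A _ * (G _ / G _)); lia.
Qed.

Let diagr (i : 'I_r) := A (1 + m + k + l) / A (2 + m + k + l - r%:Z + i%:Z) *
  (G (k - l - i%:Z - 1) / G (k - l - 2 * i%:Z - 1)).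

(** The product of the determinant formula runs through the values A (1 + m + k + l - i);
    the stated formula lists them in the opposite order. *)
Lemma diagonal_reversed : \prod_(i < r) diagf i = \prod_(i < r) diagr i.
Proof.
have rev := prod_rev_shift C r (fun x => (A x)^-1) (1 + m + k + l).
have e : 1 + m + k + l - r%:Z + 1 = 2 + m + k + l - r%:Z by lia.
rewrite e in rev.
by rewrite big_split [RHS]big_split /= !big_split /= rev.
Qed.

Lemma exponent_horizontal_ends :
  \sum_(i < r) (n i * (k - 1) + - (l + idx i) * (k - idx i) + - n i * (idx i - 1) + 0) =
  2 * 'C(r.+1, 3)%:Z + (l - k + 1) * 'C(r.+1, 2)%:Z - r%:Z * l * k
           + \sum_(i < r) (k - idx i) * n i.
Proof.
rewrite [LHS](eq_bigr (fun i : 'I_r => (- (l * k) + (l - k) * idx i + 1 * (idx i * idx i)) +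
  (k - idx i) * n i)); last by move=> i _; ring.
by rewrite big_split /= sum_quad; ring.
Qed.

Theorem path_det_horizontal_ends :
  path_det a b q p (fun i : 'I_r => (l + idx i, k - idx i)) (fun i => (n i, m)) =
  q ^ (2 * 'C(r.+1, 3)%:Z + (l - k + 1) * 'C(r.+1, 2)%:Z - r%:Z * l * k
       + \sum_(i < r) (k - idx i) * n i) *
  (\prod_(i < r) \prod_(j < r | (i < j)%N)
     theta p [:: q ^ (n j - n i); b * q ^ (1 + m + n i + n j)]) *
  (\prod_(i < r)
    ((tpoch q p [:: q ^ (n i - l)] (m - k + 1) *
      tpoch q p [:: a * q ^ (n i + 2 * k - idx i)]
        (m - k + 1 - r%:Z + idx i) *
      tpoch q p [:: a * q ^ (l + 2 * k)] (n i - l - idx i)) /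
     (tpoch q p [:: q] (m - k + idx i) *
      tpoch q p [:: a * q ^ (l + 2 * k)] (m - k + 1 - r%:Z + idx i) *
      tpoch q p [:: a * q ^ (1 + l + idx i)] (n i - l - idx i)))) *
  (\prod_(i < r)
    ((tpoch q p [:: b * q ^ (1 + n i + k + l)] (m - k + 1) *
      tpoch q p [:: b * q ^ (1 + 2 * l + 2 * idx i)]
        (2 * n i - 2 * l - 2 * idx i)) /
     (tpoch q p [:: b * q ^ (1 + 2 * n i + k - idx i)] (m - k + idx i) *
      tpoch q p [:: b * q ^ (1 + 2 * l + k + idx i)]
        (2 * n i - 2 * l - 2 * idx i)))) *
  (\prod_(i < r)
    ((tpoch q p [:: a * q ^ (k - n i) / b] (m - k + 1) *
      tpoch q p [:: a * q ^ (1 - n i) / b; a * q ^ (- n i) / b]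
        (n i - l - idx i)) /
     (tpoch q p [:: a * q ^ (k - l - idx i) / b] (m - k + 1) *
      tpoch q p [:: a * q ^ (k - n i) / b] (n i - l + 1 - 2 * idx i) *
      tpoch q p [:: a * q ^ (k - r%:Z - n i) / b]
        (n i - l + r%:Z - 2 * idx i)))).
Proof.
have c0 : c != 0 by rewrite /c; nonzero.
have xi0 i : xi i != 0 by exact: q_n.
have eta0 t : eta t != 0 by rewrite /eta; nonzero.
have zeta0 t : zeta t != 0 by rewrite /zeta; nonzero.
rewrite /path_det.
have pairsE (i j : 'I_r) : th2 c (xi j) (xi i) / xi j =
    q ^ (- n j) * theta p [:: q ^ (n j - n i); b * q ^ (1 + m + n i + n j)].
  rewrite theta_pair /c /xi (th2_11 q0) !thqE mul1r ?invr_expz ?opprK mulrC.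
  rewrite [th _ * _]mulrC; congr (_ * (th (q ^ _) * th (_ * q ^ _))); lia.
have main := det_assemble q0 (fun i => n i * (k - 1)) (fun j => - (l + idx j) * (k - idx j))
  (fun t => 0) rowf (fun j => colf (idx j)) diagf entry_horizontal_ends
  (theta_det2 thV add sqrt nontriv c0 xi0 eta0 zeta0)
  (pairs_snd q0 (fun i => - n i) pairsE) diagonal_horizontal_ends.
rewrite (prod_replace_factor diagonal_reversed) in main.
apply: (det_assemble3 main exponent_horizontal_ends).
move=> i; rewrite (tpoch_1 q0 th1 gen); last by have := pos i; rewrite /idx; lia.
shifted_factorials_to_values.
rewrite /rowf /colf /diagr.
rewrite (idxE _ i).
move: (n i) (i%:Z) (r%:Z) => M J r'.
compare_values.
Qed.
End HorizontalEnds.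

(** * End points on an antidiagonal *)

Section AntidiagonalEnds.
Variables (r : nat) (l k m : int) (n : 'I_r -> int).
Hypothesis pos : 0 <= m - l - k.

(** Here G and the iegam of the vertical distance give the theta products with eta, and
    1 / G and the iegam of the horizontal distance those with zeta. *)
Let c := a / b * q ^ m.
Let xi (i : 'I_r) := q ^ (- n i).
Let eta (t : nat) := q ^ (k - m - t%:Z - 1).
Let zeta (t : nat) := q ^ (- l - t%:Z).

Let th2A i t : th2 c (xi i) (eta t) / xi i =
  q ^ (n i) * (tg (k - n i - 1 - t%:Z) * t1 (2 + m - n i - k + t%:Z - 1)).
Proof.
rewrite /c /xi /eta /zeta (th2_11 q0).
rewrite invr_expz mulrC.
by congr (q ^ _ * (tg _ * t1 _)); lia.
Qed.

Let th2B i t : th2 c (zeta t) (xi i) =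
  tg (m - n i - l - t%:Z) * t1 (n i - l - t%:Z).
Proof.
rewrite /c /xi /eta /zeta (th2_11 q0).
by congr (tg _ * t1 _); lia.
Qed.

Let th2D t s : th2 c (zeta s) (eta t) =
  tg (k - l - t%:Z - 1 - s%:Z) * t1 (m - l - k + t%:Z + 1 - s%:Z).
Proof.
rewrite /c /xi /eta /zeta (th2_11 q0).
by congr (tg _ * t1 _); lia.
Qed.

Let rowf (i : 'I_r) := iegam (1 + m - n i - k + r%:Z) * iegam (n i - l) *
  (A (1 + l + k + m - n i) * A (1 + n i))^-1 *
  (B (1 + 2 * n i) / (B (1 + n i + l + k) * B (1 + n i + m))) *
  (G (1 + m - 2 * n i) * G (k - n i - r%:Z) / (G (m - n i - l) * G (1 - n i) * G (- n i))).
Let colf (J : int) := egam (1 + m - l - k) * (A (1 + k + m - J) * A (1 + l + J)) *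
  (B (1 + l + m + J) * B (1 + k + 2 * l + J) / B (1 + 2 * l + 2 * J)) *
  (G (1 - l - J) * G (- l - J) / G (k - l - 2 * J)).
Let diagf (t : nat) := G (k - l - t%:Z - 1) / G (k - l - 2 * t%:Z - 1) *
  (egam (m - l - k + t%:Z + 1) / egam (m - l - k + 1)).

Lemma entry_antidiagonal_ends (i j : 'I_r) : path_gf a b q p (l + idx j, k - idx j) (n i, m - n i) =
  (q ^ (n i * (k - r%:Z)) * rowf i) * (q ^ (- (l + idx j) * (k - idx j)) * colf (idx j)) *
  (\prod_(j.+1 <= t < r) (th2 c (xi i) (eta t) / xi i) * \prod_(1 <= t < j.+1) th2 c (zeta t) (xi i)).
Proof.
rewrite (path_gfE a0 b0 q0 th1 add sqrt gen); last by have := pos; lia.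
rewrite (idxE _ j); have jr := ltn_ord j.
rewrite (prod_nat_splitq (th2A i)) (prod_nat_split (th2B i)).
rewrite /wpath (_ : q ^ ((n i - (l + (j%:Z + 1))) * (k - (j%:Z + 1))) =
  q ^ (n i * (k - r%:Z)) * q ^ (- (l + (j%:Z + 1)) * (k - (j%:Z + 1))) *
  q ^ (n i * (r - j.+1)%N%:Z)); last first.
  rewrite -!expfzDr //; congr (q ^ _).
  rewrite (_ : (r - j.+1)%N%:Z = r%:Z - j%:Z - 1); last by lia.
  by ring.
rewrite (telescope_down_tail _ iegam t1 (2 + m - n i - k) _ _
  (1 + ((m - n i) - (k - (j%:Z + 1)))) jr iegam_S); last by lia.
rewrite (telescope_up_tail _ G tg (k - n i - 1) _ _
  ((k - (j%:Z + 1)) - n i) jr G_S); last by lia.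
rewrite (telescope_down _ iegam t1 (n i - l) j
  (1 + (n i - (l + (j%:Z + 1)))) iegam_S); last by lia.
rewrite !invfM.
rewrite (telescope_inv _ G tg G_S G_n (m - n i - l) j
  (1 + (m - n i) - (l + (j%:Z + 1)))); last by lia.
rewrite /rowf /colf !invfM.
move: (j%:Z) (n i) => *; compare_entries.
Qed.

Lemma diagonal_antidiagonal_ends (t : nat) :
  \prod_(1 <= s < t.+1) th2 c (zeta s) (eta t) = q ^ 0 * diagf t.
Proof.
rewrite (prod_nat_split (th2D t)) expr0z mul1r /diagf.
rewrite (prod_dn G_S G_n).
rewrite (prod_egam_dn q0 gen); last by have := pos; lia.
by congr (G _ / G _ * (egam _ / egam _)); lia.
Qed.

Lemma exponent_antidiagonal_ends :
  \sum_(i < r) (n i * (k - r%:Z) + - (l + idx i) * (k - idx i) + n i * (r%:Z - idx i) + 0) =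
  2 * 'C(r.+1, 3)%:Z + (l - k + 1) * 'C(r.+1, 2)%:Z - r%:Z * l * k
           + \sum_(i < r) (k - idx i) * n i.
Proof.
rewrite [LHS](eq_bigr (fun i : 'I_r => (- (l * k) + (l - k) * idx i + 1 * (idx i * idx i)) +
  (k - idx i) * n i)); last by move=> i _; ring.
by rewrite big_split /= sum_quad; ring.
Qed.

Theorem path_det_antidiagonal_ends :
  path_det a b q p (fun i : 'I_r => (l + idx i, k - idx i)) (fun i => (n i, m - n i)) =
  q ^ (2 * 'C(r.+1, 3)%:Z + (l - k + 1) * 'C(r.+1, 2)%:Z - r%:Z * l * k
       + \sum_(i < r) (k - idx i) * n i) *
  (\prod_(i < r) \prod_(j < r | (i < j)%N)
     theta p [:: q ^ (n j - n i); a * q ^ (m - n i - n j) / b]) *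
  (\prod_(i < r)
    ((tpoch q p [:: q ^ (n i - l)] (m - n i - k + idx i) *
      tpoch q p [:: a * q ^ (n i + 2 * k - idx i)] (m - n i - k + 1) *
      tpoch q p [:: a * q ^ (l + 2 * k)] (n i - l - idx i)) /
     (tpoch q p [:: q] (m - n i - k + r%:Z) *
      tpoch q p [:: a * q ^ (l + 2 * k)] (m - n i - k + 1) *
      tpoch q p [:: a * q ^ (1 + l + idx i)] (n i - l - idx i)))) *
  (\prod_(i < r)
    ((tpoch q p [:: b * q ^ (1 + n i + k + l)] (m - n i - k + idx i) *
      tpoch q p [:: b * q ^ (1 + 2 * l + 2 * idx i)]
        (2 * n i - 2 * l - 2 * idx i)) /
     (tpoch q p [:: b * q ^ (1 + 2 * n i + k - idx i)]
        (m - n i - k + idx i) *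
      tpoch q p [:: b * q ^ (1 + 2 * l + k + idx i)]
        (2 * n i - 2 * l - 2 * idx i)))) *
  (\prod_(i < r)
    (tpoch q p [:: a * q ^ (1 + k - n i - idx i) / b]
       (m - n i - k + idx i) /
     tpoch q p [:: a * q ^ (k - l - idx i) / b] (m - n i - k + idx i))) *
  (\prod_(i < r)
    (tpoch q p [:: a * q ^ (1 - n i) / b; a * q ^ (- n i) / b]
       (n i - l - idx i) /
     (tpoch q p [:: a * q ^ (1 + k - n i - idx i) / b] (n i - l - idx i) *
      tpoch q p [:: a * q ^ (k - r%:Z - n i) / b]
        (n i - l + r%:Z - 2 * idx i)))).
Proof.
have c0 : c != 0 by rewrite /c; nonzero.
have xi0 i : xi i != 0 by exact: q_n.
have eta0 t : eta t != 0 by rewrite /eta; nonzero.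
have zeta0 t : zeta t != 0 by rewrite /zeta; nonzero.
rewrite /path_det.
have pairsE (i j : 'I_r) : th2 c (xi i) (xi j) / xi i =
    q ^ n i * theta p [:: q ^ (n j - n i); a * q ^ (m - n i - n j) / b].
  rewrite theta_pair /c /xi (th2_11 q0) !thqE mul1r ?invr_expz ?opprK mulrC.
  rewrite [a * q ^ _ / b]mulrAC.
  rewrite [th _ * _]mulrC; congr (_ * (th (q ^ _) * th (_ * q ^ _))); lia.
have main := det_assemble q0 (fun i => n i * (k - r%:Z)) (fun j => - (l + idx j) * (k - idx j))
  (fun t => 0) rowf (fun j => colf (idx j)) diagf entry_antidiagonal_ends
  (theta_det3 thV add sqrt nontriv c0 xi0 eta0 zeta0)
  (pairs_fst q0 n pairsE) diagonal_antidiagonal_ends.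
apply: (det_assemble4 main exponent_antidiagonal_ends).
move=> i; rewrite (tpoch_1 q0 th1 gen); last by have := pos; rewrite /idx; lia.
shifted_factorials_to_values.
rewrite /rowf /colf /diagf.
rewrite (idxE _ i).
move: (n i) (i%:Z) (r%:Z) => M J r'.
compare_values.
Qed.
End AntidiagonalEnds.

(** * Starting points on a vertical line *)

Section VerticalStarts.
Variables (r : nat) (l n m : int) (k : 'I_r -> int).
Hypothesis pos : forall i, 0 <= n - l + m - k i.

(** The starting points are the parameters, so the matrix is transposed: rows are indexed
    by starting points, and end points play the part of the columns. Here G and 1 / B
    give the theta products with eta, and 1 / A and iegam those with zeta. *)
Let c := a * q ^ l.
Let xi (i : 'I_r) := q ^ (k i).
Let eta (t : nat) := b^-1 * q ^ (- n - l - t%:Z - 1).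
Let zeta (t : nat) := q ^ (m - t%:Z).

Let th2A i t : th2 c (xi i) (eta t) / xi i =
  q ^ (- k i) * (tg (k i - n - 1 - t%:Z) * tb (2 + n + l + k i + t%:Z - 1)).
Proof.
rewrite /c /xi /eta /zeta (th2_1z q0).
rewrite (_ : b^-1^-1 = b); last by field; rewrite ?a0 ?b0.
rewrite invr_expz mulrC.
by congr (q ^ _ * (tg _ * tb _)); lia.
Qed.

Let th2B i t : th2 c (zeta t) (xi i) =
  ta (l + k i + m - t%:Z) * t1 (m - k i - t%:Z).
Proof.
rewrite /c /xi /eta /zeta (th2_11 q0).
by congr (ta _ * t1 _); lia.
Qed.

Let th2D t s : th2 c (zeta s) (eta t) =
  tg (m - n - t%:Z - 1 - s%:Z) * tb (m + n + l + t%:Z + 1 - s%:Z).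
Proof.
rewrite /c /xi /eta /zeta (th2_1z q0).
rewrite (_ : b^-1^-1 = b); last by field; rewrite ?a0 ?b0.
by congr (tg _ * tb _); lia.
Qed.

Let rowf (i : 'I_r) := egam (1 + n - l + m - k i) * iegam (m - k i) *
  (A (1 + n + k i + m) / A (l + k i + m)) *
  (B (1 + k i + 2 * l) / B (1 + n + l + k i + r%:Z)) *
  (G (k i - n - r%:Z) / G (k i - l)).
Let colf (J : int) := iegam (1 + n + J - l) * (A (1 + l) / A (1 + n + J)) *
  (B (1 + n + l + m) * B (1 + 2 * n + 2 * J) / (B (1 + 2 * l) * B (1 + 2 * n + m + J))) *
  (G (1 + m - n - 2 * J) * G (1 - l) * G (- l) /
   (G (1 + m - J - l) * G (1 - n - J) * G (- n - J))).
Let diagf (t : nat) := G (m - n - t%:Z - 1) / G (m - n - 2 * t%:Z - 1) *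
  (B (m + n + l + t%:Z + 1) / B (m + n + l + 1)).

Lemma entry_vertical_starts (i j : 'I_r) : path_gf a b q p (l, k i) (n + idx j, m - idx j) =
  (q ^ (k i * (n - l + r%:Z)) * rowf i) * (q ^ 0 * colf (idx j)) *
  (\prod_(j.+1 <= t < r) (th2 c (xi i) (eta t) / xi i) * \prod_(1 <= t < j.+1) th2 c (zeta t) (xi i)).
Proof.
rewrite (path_gfE a0 b0 q0 th1 add sqrt gen); last by have := pos i; lia.
rewrite (idxE _ j); have jr := ltn_ord j.
rewrite (prod_nat_splitq (th2A i)) (prod_nat_split (th2B i)).
rewrite /wpath (_ : q ^ (((n + (j%:Z + 1)) - l) * k i) =
  q ^ (k i * (n - l + r%:Z)) * q ^ 0 * q ^ ((- k i) * (r - j.+1)%N%:Z)); last first.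
  rewrite -!expfzDr //; congr (q ^ _).
  rewrite (_ : (r - j.+1)%N%:Z = r%:Z - j%:Z - 1); last by lia.
  by ring.
rewrite (telescope_down _ iegam t1 (m - k i) j
  (1 + ((m - (j%:Z + 1)) - k i)) iegam_S); last by lia.
rewrite (telescope_up_tail _ G tg (k i - n - 1) _ _
  (k i - (n + (j%:Z + 1))) jr G_S); last by lia.
rewrite !invfM.
rewrite (telescope_inv _ A ta A_S A_n (l + k i + m) j
  (1 + l + k i + (m - (j%:Z + 1)))); last by lia.
rewrite (telescope_inv_tail _ B tb B_S B_n (2 + n + l + k i) _ _
  (1 + (n + (j%:Z + 1)) + l + k i) jr); last by lia.
rewrite /rowf /colf !invfM.
move: (j%:Z) (k i) => *; compare_entries.
Qed.

Lemma diagonal_vertical_starts (t : nat) :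
  \prod_(1 <= s < t.+1) th2 c (zeta s) (eta t) = q ^ 0 * diagf t.
Proof.
rewrite (prod_nat_split (th2D t)) expr0z mul1r /diagf.
rewrite (prod_dn G_S G_n).
rewrite (prod_dn B_S B_n).
by congr (G _ / G _ * (B _ / B _)); lia.
Qed.

Lemma exponent_vertical_starts :
  \sum_(i < r) (k i * (n - l + r%:Z) + 0 + - k i * (r%:Z - idx i) + 0) =
  \sum_(i < r) (n - l + idx i) * k i.
Proof.
by apply: eq_bigr => i _; ring.
Qed.

Theorem path_det_vertical_starts :
  path_det a b q p (fun i : 'I_r => (l, k i)) (fun i => (n + idx i, m - idx i)) =
  q ^ (\sum_(i < r) (n - l + idx i) * k i) *
  (\prod_(i < r) \prod_(j < r | (i < j)%N)
     theta p [:: q ^ (k i - k j); a * q ^ (l + k i + k j)]) *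
  (\prod_(i < r)
    ((tpoch q p [:: q ^ (1 + n + idx i - l)] (m - k i - idx i) *
      tpoch q p [:: a * q ^ (1 + n + 2 * k i)] (m - k i) *
      tpoch q p [:: a * q ^ (1 + l + 2 * k i)] (n - l)) /
     (tpoch q p [:: q] (m - k i - 1) *
      tpoch q p [:: a * q ^ (1 + l + 2 * k i)] (m - k i - 1) *
      tpoch q p [:: a * q ^ (1 + l)] (n - l + idx i)))) *
  (\prod_(i < r)
    ((tpoch q p [:: b * q ^ (1 + n + k i + l + r%:Z)]
        (m - k i - r%:Z - 1 + idx i) *
      tpoch q p [:: b * q ^ (1 + 2 * l)] (2 * n - 2 * l + 2 * idx i)) /
     (tpoch q p [:: b * q ^ (1 + 2 * n + k i)] (m - k i + idx i) *
      tpoch q p [:: b * q ^ (1 + 2 * l + k i)] (2 * n - 2 * l)))) *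
  (\prod_(i < r)
    ((tpoch q p [:: a * q ^ (1 + k i - n) / b] (m - k i - idx i - 1) *
      tpoch q p [:: a * q ^ (1 - n - idx i) / b;
                    a * q ^ (- n - idx i) / b] (n - l + idx i)) /
     (tpoch q p [:: a * q ^ (1 + k i - l) / b] (m - k i - idx i) *
      tpoch q p [:: a * q ^ (1 + k i - n) / b] (n - l) *
      tpoch q p [:: a * q ^ (k i - r%:Z - n) / b] (n - l + r%:Z)))).
Proof.
have c0 : c != 0 by rewrite /c; nonzero.
have xi0 i : xi i != 0 by exact: q_n.
have eta0 t : eta t != 0 by rewrite /eta; nonzero.
have zeta0 t : zeta t != 0 by rewrite /zeta; nonzero.
rewrite /path_det -det_tr (_ : trmx _ =
    \matrix_(i < r, j < r) path_gf a b q p (l, k i) (n + idx j, m - idx j)); last first.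
  by apply/matrixP => i j; rewrite !mxE.
have pairsE (i j : 'I_r) : th2 c (xi i) (xi j) / xi i =
    q ^ (- k i) * theta p [:: q ^ (k i - k j); a * q ^ (l + k i + k j)].
  rewrite theta_pair /c /xi (th2_11 q0) !thqE mul1r ?invr_expz ?opprK mulrC.
  rewrite [th _ * _]mulrC; congr (_ * (th (q ^ _) * th (_ * q ^ _))); lia.
have main := det_assemble q0 (fun i => k i * (n - l + r%:Z)) (fun j => 0)
  (fun t => 0) rowf (fun j => colf (idx j)) diagf entry_vertical_starts
  (theta_det3 thV add sqrt nontriv c0 xi0 eta0 zeta0)
  (pairs_fst q0 (fun i => - k i) pairsE) diagonal_vertical_starts.
apply: (det_assemble3 main exponent_vertical_starts).
move=> i; rewrite (tpoch_1 q0 th1 gen); last by have := pos i; rewrite /idx; lia.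
shifted_factorials_to_values.
rewrite /rowf /colf /diagf.
rewrite (idxE _ i).
move: (k i) (i%:Z) (r%:Z) => M J r'.
compare_values.
Qed.
End VerticalStarts.

(** * Starting points on a horizontal line *)

Section HorizontalStarts.
Variables (r : nat) (k n m : int) (l : 'I_r -> int).
Hypothesis pos : forall i, 0 <= n - l i + m - k.

(** Here 1 / B and the iegam of the horizontal distance give the theta products with eta,
    and 1 / A and 1 / G those with zeta, again after transposition. *)
Let c := b * q ^ k.
Let xi (i : 'I_r) := q ^ (l i).
Let eta (t : nat) := q ^ (n + t%:Z + 1).
Let zeta (t : nat) := a / b * q ^ (m - t%:Z).

Let th2A i t : th2 c (eta t) (xi i) =
  tb (2 + n + l i + k + t%:Z - 1) * t1 (2 + n - l i + t%:Z - 1).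
Proof.
rewrite /c /xi /eta /zeta (th2_11 q0).
by congr (tb _ * t1 _); lia.
Qed.

Let th2B i t : th2 c (zeta t) (xi i) =
  ta (l i + k + m - t%:Z) * tg (m - l i - t%:Z).
Proof.
rewrite /c /xi /eta /zeta (th2_y1 q0).
rewrite (_ : b * (a / b) = a); last by field; rewrite ?a0 ?b0.
by congr (ta _ * tg _); lia.
Qed.

Let th2D t s : eta t * th2 c (zeta s) (eta t) =
  q ^ (n + t%:Z + 1) * (ta (k + m + n + t%:Z + 1 - s%:Z) * tg (m - n - t%:Z - 1 - s%:Z)).
Proof.
rewrite /c /xi /eta /zeta (th2_y1 q0).
rewrite (_ : b * (a / b) = a); last by field; rewrite ?a0 ?b0.
by congr (q ^ _ * (ta _ * tg _)); lia.
Qed.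

Let rowf (i : 'I_r) := egam (1 + n - l i + m - k) * iegam (1 + n - l i + r%:Z) *
  (A (1 + l i) / A (l i + k + m)) *
  (B (1 + n + l i + m) * B (1 + k + 2 * l i) / (B (1 + n + l i + k + r%:Z) * B (1 + 2 * l i))) *
  (G (1 - l i) * G (- l i) / (G (m - l i) * G (k - l i))).
Let colf (J : int) := iegam (1 + m - J - k) * (A (1 + n + k + m) / A (1 + n + J)) *
  (B (1 + 2 * n + 2 * J) / B (1 + 2 * n + m + J)) *
  (G (1 + m - n - 2 * J) * G (k - n - J) / (G (1 - n - J) * G (- n - J))).
Let diagf (t : nat) := A (k + m + n + t%:Z + 1) / A (k + m + n + 1) *
  (G (m - n - t%:Z - 1) / G (m - n - 2 * t%:Z - 1)).

Lemma entry_horizontal_starts (i j : 'I_r) : path_gf a b q p (l i, k) (n + idx j, m - idx j) =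
  (q ^ (- l i * k) * rowf i) * (q ^ ((n + idx j) * k) * colf (idx j)) *
  (\prod_(j.+1 <= t < r) th2 c (eta t) (xi i) * \prod_(1 <= t < j.+1) th2 c (zeta t) (xi i)).
Proof.
rewrite (path_gfE a0 b0 q0 th1 add sqrt gen); last by have := pos i; lia.
rewrite (idxE _ j); have jr := ltn_ord j.
rewrite (prod_nat_split (th2A i)) (prod_nat_split (th2B i)).
rewrite /wpath (_ : q ^ (((n + (j%:Z + 1)) - l i) * k) =
  q ^ (- l i * k) * q ^ ((n + (j%:Z + 1)) * k)); last first.
  rewrite -!expfzDr //; congr (q ^ _); ring.
rewrite (telescope_down_tail _ iegam t1 (2 + n - l i) _ _
  (1 + ((n + (j%:Z + 1)) - l i)) jr iegam_S); last by lia.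
rewrite !invfM.
rewrite (telescope_inv_tail _ B tb B_S B_n (2 + n + l i + k) _ _
  (1 + (n + (j%:Z + 1)) + l i + k) jr); last by lia.
rewrite (telescope_inv _ A ta A_S A_n (l i + k + m) j
  (1 + l i + k + (m - (j%:Z + 1)))); last by lia.
rewrite (telescope_inv _ G tg G_S G_n (m - l i) j
  (1 + (m - (j%:Z + 1)) - l i)); last by lia.
rewrite /rowf /colf !invfM.
move: (j%:Z) (l i) => *; compare_entries.
Qed.

Lemma diagonal_horizontal_starts (t : nat) :
  \prod_(1 <= s < t.+1) (eta t * th2 c (zeta s) (eta t)) = q ^ ((n + t%:Z + 1) * t%:Z) * diagf t.
Proof.
rewrite (prod_nat_splitq (th2D t)) subn1 /diagf; congr (_ * _).
rewrite (prod_dn A_S A_n).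
rewrite (prod_dn G_S G_n).
by congr (A _ / A _ * (G _ / G _)); lia.
Qed.

Lemma exponent_horizontal_starts :
  \sum_(i < r) (- l i * k + (n + idx i) * k + - l i * (idx i - 1) + (n + i%:Z + 1) * i%:Z) =
  (n + r%:Z + k) * 'C(r, 2)%:Z - 'C(r, 3)%:Z + (n + 1) * r%:Z * k
           - \sum_(i < r) (k + idx i - 1) * l i.
Proof.
rewrite [LHS](eq_bigr (fun i : 'I_r => (n * k - n + (k + n - 1) * idx i + 1 * (idx i * idx i)) -
  (k + idx i - 1) * l i)); last first.
  by move=> i _; rewrite (_ : i%:Z = idx i - 1); [ring | rewrite /idx; lia].
by rewrite sumrB sum_quad bin3S (bin2S r) !mulrDl mul_bin2; ring.
Qed.

Theorem path_det_horizontal_starts :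
  path_det a b q p (fun i : 'I_r => (l i, k)) (fun i => (n + idx i, m - idx i)) =
  q ^ ((n + r%:Z + k) * 'C(r, 2)%:Z - 'C(r, 3)%:Z + (n + 1) * r%:Z * k
       - \sum_(i < r) (k + idx i - 1) * l i) *
  (\prod_(i < r) \prod_(j < r | (i < j)%N)
     theta p [:: q ^ (l j - l i); b * q ^ (k + l i + l j)]) *
  (\prod_(i < r)
    ((tpoch q p [:: q ^ (1 + n + r%:Z - l i)] (m - k - r%:Z) *
      tpoch q p [:: a * q ^ (1 + n + 2 * k + idx i)] (m - k - 1) *
      tpoch q p [:: a * q ^ (1 + l i + 2 * k)] (n + idx i - l i)) /
     (tpoch q p [:: q] (m - k - idx i) *
      tpoch q p [:: a * q ^ (1 + l i + 2 * k)] (m - k - 1) *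
      tpoch q p [:: a * q ^ (1 + l i)] (n + idx i - l i)))) *
  (\prod_(i < r)
    ((tpoch q p [:: b * q ^ (1 + n + k + r%:Z + l i)] (m - k - r%:Z) *
      tpoch q p [:: b * q ^ (1 + 2 * l i)]
        (2 * n + 2 * idx i - 2 * l i)) /
     (tpoch q p [:: b * q ^ (1 + 2 * n + k + 2 * idx i)] (m - k - idx i) *
      tpoch q p [:: b * q ^ (1 + k + 2 * l i)]
        (2 * n + 2 * idx i - 2 * l i)))) *
  (\prod_(i < r)
    ((tpoch q p [:: a * q ^ (1 + k - n - idx i) / b] (m - k - 1) *
      tpoch q p [:: a * q ^ (1 - n - idx i) / b;
                    a * q ^ (- n - idx i) / b] (n + idx i - l i)) /
     (tpoch q p [:: a * q ^ (1 + k - l i) / b] (m - k - 1) *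
      tpoch q p [:: a * q ^ (1 + k - n - idx i) / b;
                    a * q ^ (k - n - idx i) / b] (n + idx i - l i)))).
Proof.
have c0 : c != 0 by rewrite /c; nonzero.
have xi0 i : xi i != 0 by exact: q_n.
have eta0 t : eta t != 0 by rewrite /eta; nonzero.
have zeta0 t : zeta t != 0 by rewrite /zeta; nonzero.
rewrite /path_det -det_tr (_ : trmx _ =
    \matrix_(i < r, j < r) path_gf a b q p (l i, k) (n + idx j, m - idx j)); last first.
  by apply/matrixP => i j; rewrite !mxE.
have pairsE (i j : 'I_r) : th2 c (xi j) (xi i) / xi j =
    q ^ (- l j) * theta p [:: q ^ (l j - l i); b * q ^ (k + l i + l j)].
  rewrite theta_pair /c /xi (th2_11 q0) !thqE mul1r ?invr_expz ?opprK mulrC.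
  rewrite [th _ * _]mulrC; congr (_ * (th (q ^ _) * th (_ * q ^ _))); lia.
have main := det_assemble q0 (fun i => - l i * k) (fun j => (n + idx j) * k)
  (fun t => (n + t%:Z + 1) * t%:Z) rowf (fun j => colf (idx j)) diagf entry_horizontal_starts
  (theta_det4 thV add sqrt nontriv c0 xi0 eta0 zeta0)
  (pairs_snd q0 (fun i => - l i) pairsE) diagonal_horizontal_starts.
apply: (det_assemble3 main exponent_horizontal_starts).
move=> i; rewrite (tpoch_1 q0 th1 gen); last by have := pos i; rewrite /idx; lia.
shifted_factorials_to_values.
rewrite /rowf /colf /diagf.
rewrite (idxE _ i).
move: (l i) (i%:Z) (r%:Z) => M J r'.
compare_values.
Qed.
End HorizontalStarts.

(** * Starting points on an antidiagonal *)

Section AntidiagonalStarts.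
Variables (r : nat) (k n m : int) (l : 'I_r -> int).
Hypothesis pos : 0 <= n + m - k.

(** Here G and the iegam of the horizontal distance give the theta products with eta, and
    1 / G and the iegam of the vertical distance those with zeta, again after
    transposition. *)
Let c := a / b * q ^ k.
Let xi (i : 'I_r) := q ^ (- l i).
Let eta (t : nat) := q ^ (- n - t%:Z - 1).
Let zeta (t : nat) := q ^ (m - k - t%:Z).

Let th2A i t : th2 c (xi i) (eta t) / xi i =
  q ^ (l i) * (tg (k - l i - n - 1 - t%:Z) * t1 (2 + n - l i + t%:Z - 1)).
Proof.
rewrite /c /xi /eta /zeta (th2_11 q0).
rewrite invr_expz mulrC.
by congr (q ^ _ * (tg _ * t1 _)); lia.
Qed.

Let th2B i t : th2 c (zeta t) (xi i) =
  tg (m - l i - t%:Z) * t1 (m - k + l i - t%:Z).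
Proof.
rewrite /c /xi /eta /zeta (th2_11 q0).
by congr (tg _ * t1 _); lia.
Qed.

Let th2D t s : th2 c (zeta s) (eta t) =
  tg (m - n - t%:Z - 1 - s%:Z) * t1 (n + m - k + t%:Z + 1 - s%:Z).
Proof.
rewrite /c /xi /eta /zeta (th2_11 q0).
by congr (tg _ * t1 _); lia.
Qed.

Let rowf (i : 'I_r) := iegam (1 + n - l i + r%:Z) * iegam (m - k + l i) *
  (A (1 + n + k + m - l i) * A (1 + l i)) *
  (B (1 + n + l i + m) * B (1 + k + l i) / B (1 + 2 * l i)) *
  (G (k - l i - n - r%:Z) * G (1 - l i) * G (- l i) / (G (m - l i) * G (k - 2 * l i))).
Let colf (J : int) := egam (1 + n + m - k) * (A (1 + k + m - J) * A (1 + n + J))^-1 *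
  (B (1 + 2 * n + 2 * J) / (B (1 + n + k + J) * B (1 + 2 * n + m + J))) *
  (G (1 + m - n - 2 * J) / (G (1 - n - J) * G (- n - J))).
Let diagf (t : nat) := G (m - n - t%:Z - 1) / G (m - n - 2 * t%:Z - 1) *
  (egam (n + m - k + t%:Z + 1) / egam (n + m - k + 1)).

Lemma entry_antidiagonal_starts (i j : 'I_r) : path_gf a b q p (l i, k - l i) (n + idx j, m - idx j) =
  (q ^ ((n - l i) * (k - l i) - l i * r%:Z) * rowf i) * (q ^ (idx j * k) * colf (idx j)) *
  (\prod_(j.+1 <= t < r) (th2 c (xi i) (eta t) / xi i) * \prod_(1 <= t < j.+1) th2 c (zeta t) (xi i)).
Proof.
rewrite (path_gfE a0 b0 q0 th1 add sqrt gen); last by have := pos; lia.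
rewrite (idxE _ j); have jr := ltn_ord j.
rewrite (prod_nat_splitq (th2A i)) (prod_nat_split (th2B i)).
rewrite /wpath (_ : q ^ (((n + (j%:Z + 1)) - l i) * (k - l i)) =
  q ^ ((n - l i) * (k - l i) - l i * r%:Z) * q ^ ((j%:Z + 1) * k) * q ^ (l i * (r - j.+1)%N%:Z)); last first.
  rewrite -!expfzDr //; congr (q ^ _).
  rewrite (_ : (r - j.+1)%N%:Z = r%:Z - j%:Z - 1); last by lia.
  by ring.
rewrite (telescope_down_tail _ iegam t1 (2 + n - l i) _ _
  (1 + ((n + (j%:Z + 1)) - l i)) jr iegam_S); last by lia.
rewrite (telescope_up_tail _ G tg (k - l i - n - 1) _ _
  ((k - l i) - (n + (j%:Z + 1))) jr G_S); last by lia.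
rewrite (telescope_down _ iegam t1 (m - k + l i) j
  (1 + ((m - (j%:Z + 1)) - (k - l i))) iegam_S); last by lia.
rewrite !invfM.
rewrite (telescope_inv _ G tg G_S G_n (m - l i) j
  (1 + (m - (j%:Z + 1)) - l i)); last by lia.
rewrite /rowf /colf !invfM.
move: (j%:Z) (l i) => *; compare_entries.
Qed.

Lemma diagonal_antidiagonal_starts (t : nat) :
  \prod_(1 <= s < t.+1) th2 c (zeta s) (eta t) = q ^ 0 * diagf t.
Proof.
rewrite (prod_nat_split (th2D t)) expr0z mul1r /diagf.
rewrite (prod_dn G_S G_n).
rewrite (prod_egam_dn q0 gen); last by have := pos; lia.
by congr (G _ / G _ * (egam _ / egam _)); lia.
Qed.

Lemma exponent_antidiagonal_starts :
  \sum_(i < r) ((n - l i) * (k - l i) - l i * r%:Z + idx i * k + l i * (r%:Z - idx i) + 0) =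
  k * 'C(r.+1, 2)%:Z + r%:Z * n * k
           - \sum_(i < r) (n + k + idx i - l i) * l i.
Proof.
rewrite [LHS](eq_bigr (fun i : 'I_r => (n * k + k * idx i + 0 * (idx i * idx i)) -
  (n + k + idx i - l i) * l i)); last by move=> i _; ring.
by rewrite sumrB sum_quad; ring.
Qed.

Theorem path_det_antidiagonal_starts :
  path_det a b q p (fun i : 'I_r => (l i, k - l i)) (fun i => (n + idx i, m - idx i)) =
  q ^ (k * 'C(r.+1, 2)%:Z + r%:Z * n * k
       - \sum_(i < r) (n + k + idx i - l i) * l i) *
  (\prod_(i < r) \prod_(j < r | (i < j)%N)
     theta p [:: q ^ (l j - l i); a * q ^ (k - l i - l j) / b]) *
  (\prod_(i < r)
    ((tpoch q p [:: q ^ (1 + n + r%:Z - l i)]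
        (m - k - r%:Z + l i + idx i - 1) *
      tpoch q p [:: a * q ^ (1 + n + 2 * k - 2 * l i)] (m - k + l i) *
      tpoch q p [:: a * q ^ (1 + 2 * k - l i)] (n - l i)) /
     (tpoch q p [:: q] (m - k + l i - 1) *
      tpoch q p [:: a * q ^ (1 + 2 * k - l i)] (m - k + l i - idx i) *
      tpoch q p [:: a * q ^ (1 + l i)] (n + idx i - l i)))) *
  (\prod_(i < r)
    ((tpoch q p [:: b * q ^ (1 + n + k + idx i)] (m - k + l i - idx i) *
      tpoch q p [:: b * q ^ (1 + 2 * l i)]
        (2 * n + 2 * idx i - 2 * l i)) /
     (tpoch q p [:: b * q ^ (1 + 2 * n + k - l i)] (m - k + l i + idx i) *
      tpoch q p [:: b * q ^ (1 + k + l i)] (2 * n - 2 * l i)))) *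
  (\prod_(i < r)
    (tpoch q p [:: a * q ^ (1 + k - n - l i) / b]
       (m - k + l i - idx i - 1) /
     tpoch q p [:: a * q ^ (1 + k - 2 * l i) / b] (m - k + l i - 1))) *
  (\prod_(i < r)
    (tpoch q p [:: a * q ^ (1 - n - idx i) / b;
                   a * q ^ (- n - idx i) / b] (n + idx i - l i) /
     (tpoch q p [:: a * q ^ (1 + k - n - l i) / b] (n - l i) *
      tpoch q p [:: a * q ^ (k - n - r%:Z - l i) / b]
        (n + r%:Z - l i)))).
Proof.
have c0 : c != 0 by rewrite /c; nonzero.
have xi0 i : xi i != 0 by exact: q_n.
have eta0 t : eta t != 0 by rewrite /eta; nonzero.
have zeta0 t : zeta t != 0 by rewrite /zeta; nonzero.
rewrite /path_det -det_tr (_ : trmx _ =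
    \matrix_(i < r, j < r) path_gf a b q p (l i, k - l i) (n + idx j, m - idx j)); last first.
  by apply/matrixP => i j; rewrite !mxE.
have pairsE (i j : 'I_r) : th2 c (xi i) (xi j) / xi i =
    q ^ l i * theta p [:: q ^ (l j - l i); a * q ^ (k - l i - l j) / b].
  rewrite theta_pair /c /xi (th2_11 q0) !thqE mul1r ?invr_expz ?opprK mulrC.
  rewrite [a * q ^ _ / b]mulrAC.
  rewrite [th _ * _]mulrC; congr (_ * (th (q ^ _) * th (_ * q ^ _))); lia.
have main := det_assemble q0 (fun i => (n - l i) * (k - l i) - l i * r%:Z) (fun j => idx j * k)
  (fun t => 0) rowf (fun j => colf (idx j)) diagf entry_antidiagonal_starts
  (theta_det3 thV add sqrt nontriv c0 xi0 eta0 zeta0)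
  (pairs_fst q0 l pairsE) diagonal_antidiagonal_starts.
apply: (det_assemble4 main exponent_antidiagonal_starts).
move=> i; rewrite (tpoch_1 q0 th1 gen); last by have := pos; rewrite /idx; lia.
shifted_factorials_to_values.
rewrite /rowf /colf /diagf.
rewrite (idxE _ i).
move: (l i) (i%:Z) (r%:Z) => M J r'.
compare_values.
Qed.
End AntidiagonalStarts.

End Evaluations.

(** * The six generating functions *)

Theorem proposition2p1 (R : realType) (a b q p : R[i])
    (a_neq0 : a != 0) (b_neq0 : b != 0) (q_neq0 : q != 0) (p_lt1 : `|p| < 1)
    (gen : generic a b q p) (r : nat) (r_ge1 : (1 <= r)%N) :
  (* (a) *)
  (forall (l k n : int) (m : 'I_r -> int),
    weakly_decreasing m ->
    (forall i, 0 <= n - l + m i - k) ->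
    let u := fun i : 'I_r => (l + idx i, k - idx i) in
    let v := fun i : 'I_r => (n, m i) in
    nonintersecting_gf a b q p u v = path_det a b q p u v /\
    path_det a b q p u v =
      q ^ (3 * 'C(r.+1, 3)%:Z + 'C(r.+2, 3)%:Z + r%:Z * (n - l) * k
           - (n - l) * 'C(r.+1, 2)%:Z - r%:Z ^+ 2 * k
           + \sum_(i < r) (idx i - 1) * m i) *
      (\prod_(i < r) \prod_(j < r | (i < j)%N)
         theta p [:: q ^ (m i - m j); a * q ^ (1 + n + m i + m j)]) *
      (\prod_(i < r)
        ((tpoch q p [:: q ^ (1 + n - l - idx i)] (m i - k + idx i) *
          tpoch q p [:: a * q ^ (1 + n + 2 * k - r%:Z - idx i)]
            (m i - k + idx i) *
          tpoch q p [:: a * q ^ (1 + l + 2 * k - idx i)] (n - l - r%:Z)) /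
         (tpoch q p [:: q] (m i - k + r%:Z) *
          tpoch q p [:: a * q ^ (1 + l + 2 * k - idx i)] (m i - k + idx i) *
          tpoch q p [:: a * q ^ (1 + l + idx i)] (n - l - idx i)))) *
      (\prod_(i < r)
        ((tpoch q p [:: b * q ^ (2 + n + k + l - idx i)] (m i - k + idx i) *
          tpoch q p [:: b * q ^ (1 + 2 * l + 2 * idx i)]
            (2 * n - 2 * l - 2 * idx i)) /
         (tpoch q p [:: b * q ^ (1 + 2 * n + k - idx i)] (m i - k + idx i) *
          tpoch q p [:: b * q ^ (1 + 2 * l + k + idx i)]
            (2 * n - 2 * l - 2 * idx i)))) *
      (\prod_(i < r)
        ((tpoch q p [:: a * q ^ (1 + k - n - idx i) / b] (m i - k + idx i) *
          tpoch q p [:: a * q ^ (1 - n) / b; a * q ^ (- n) / b]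
            (n - l - idx i)) /
         (tpoch q p [:: a * q ^ (k - l - idx i) / b] (m i - k + idx i) *
          tpoch q p [:: a * q ^ (1 + k - n - idx i) / b;
                        a * q ^ (k - n - idx i) / b] (n - l - idx i)))))
  /\
  (* (b) *)
  (forall (l k m : int) (n : 'I_r -> int),
    weakly_increasing n ->
    (forall i, 0 <= n i - l + m - k) ->
    let u := fun i : 'I_r => (l + idx i, k - idx i) in
    let v := fun i : 'I_r => (n i, m) in
    nonintersecting_gf a b q p u v = path_det a b q p u v /\
    path_det a b q p u v =
      q ^ (2 * 'C(r.+1, 3)%:Z + (l - k + 1) * 'C(r.+1, 2)%:Z - r%:Z * l * k
           + \sum_(i < r) (k - idx i) * n i) *
      (\prod_(i < r) \prod_(j < r | (i < j)%N)
         theta p [:: q ^ (n j - n i); b * q ^ (1 + m + n i + n j)]) *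
      (\prod_(i < r)
        ((tpoch q p [:: q ^ (n i - l)] (m - k + 1) *
          tpoch q p [:: a * q ^ (n i + 2 * k - idx i)]
            (m - k + 1 - r%:Z + idx i) *
          tpoch q p [:: a * q ^ (l + 2 * k)] (n i - l - idx i)) /
         (tpoch q p [:: q] (m - k + idx i) *
          tpoch q p [:: a * q ^ (l + 2 * k)] (m - k + 1 - r%:Z + idx i) *
          tpoch q p [:: a * q ^ (1 + l + idx i)] (n i - l - idx i)))) *
      (\prod_(i < r)
        ((tpoch q p [:: b * q ^ (1 + n i + k + l)] (m - k + 1) *
          tpoch q p [:: b * q ^ (1 + 2 * l + 2 * idx i)]
            (2 * n i - 2 * l - 2 * idx i)) /
         (tpoch q p [:: b * q ^ (1 + 2 * n i + k - idx i)] (m - k + idx i) *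
          tpoch q p [:: b * q ^ (1 + 2 * l + k + idx i)]
            (2 * n i - 2 * l - 2 * idx i)))) *
      (\prod_(i < r)
        ((tpoch q p [:: a * q ^ (k - n i) / b] (m - k + 1) *
          tpoch q p [:: a * q ^ (1 - n i) / b; a * q ^ (- n i) / b]
            (n i - l - idx i)) /
         (tpoch q p [:: a * q ^ (k - l - idx i) / b] (m - k + 1) *
          tpoch q p [:: a * q ^ (k - n i) / b] (n i - l + 1 - 2 * idx i) *
          tpoch q p [:: a * q ^ (k - r%:Z - n i) / b]
            (n i - l + r%:Z - 2 * idx i)))))
  /\
  (* (c) *)
  (forall (l k m : int) (n : 'I_r -> int),
    weakly_increasing n ->
    0 <= m - l - k ->
    let u := fun i : 'I_r => (l + idx i, k - idx i) in
    let v := fun i : 'I_r => (n i, m - n i) in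
    nonintersecting_gf a b q p u v = path_det a b q p u v /\
    path_det a b q p u v =
      q ^ (2 * 'C(r.+1, 3)%:Z + (l - k + 1) * 'C(r.+1, 2)%:Z - r%:Z * l * k
           + \sum_(i < r) (k - idx i) * n i) *
      (\prod_(i < r) \prod_(j < r | (i < j)%N)
         theta p [:: q ^ (n j - n i); a * q ^ (m - n i - n j) / b]) *
      (\prod_(i < r)
        ((tpoch q p [:: q ^ (n i - l)] (m - n i - k + idx i) *
          tpoch q p [:: a * q ^ (n i + 2 * k - idx i)] (m - n i - k + 1) *
          tpoch q p [:: a * q ^ (l + 2 * k)] (n i - l - idx i)) /
         (tpoch q p [:: q] (m - n i - k + r%:Z) *
          tpoch q p [:: a * q ^ (l + 2 * k)] (m - n i - k + 1) *
          tpoch q p [:: a * q ^ (1 + l + idx i)] (n i - l - idx i)))) *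
      (\prod_(i < r)
        ((tpoch q p [:: b * q ^ (1 + n i + k + l)] (m - n i - k + idx i) *
          tpoch q p [:: b * q ^ (1 + 2 * l + 2 * idx i)]
            (2 * n i - 2 * l - 2 * idx i)) /
         (tpoch q p [:: b * q ^ (1 + 2 * n i + k - idx i)]
            (m - n i - k + idx i) *
          tpoch q p [:: b * q ^ (1 + 2 * l + k + idx i)]
            (2 * n i - 2 * l - 2 * idx i)))) *
      (\prod_(i < r)
        (tpoch q p [:: a * q ^ (1 + k - n i - idx i) / b]
           (m - n i - k + idx i) /
         tpoch q p [:: a * q ^ (k - l - idx i) / b] (m - n i - k + idx i))) *
      (\prod_(i < r)
        (tpoch q p [:: a * q ^ (1 - n i) / b; a * q ^ (- n i) / b]
           (n i - l - idx i) /
         (tpoch q p [:: a * q ^ (1 + k - n i - idx i) / b] (n i - l - idx i) *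
          tpoch q p [:: a * q ^ (k - r%:Z - n i) / b]
            (n i - l + r%:Z - 2 * idx i)))))
  /\
  (* (d) *)
  (forall (l n m : int) (k : 'I_r -> int),
    weakly_decreasing k ->
    (forall i, 0 <= n - l + m - k i) ->
    let u := fun i : 'I_r => (l, k i) in
    let v := fun i : 'I_r => (n + idx i, m - idx i) in
    nonintersecting_gf a b q p u v = path_det a b q p u v /\
    path_det a b q p u v =
      q ^ (\sum_(i < r) (n - l + idx i) * k i) *
      (\prod_(i < r) \prod_(j < r | (i < j)%N)
         theta p [:: q ^ (k i - k j); a * q ^ (l + k i + k j)]) *
      (\prod_(i < r)
        ((tpoch q p [:: q ^ (1 + n + idx i - l)] (m - k i - idx i) *
          tpoch q p [:: a * q ^ (1 + n + 2 * k i)] (m - k i) *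
          tpoch q p [:: a * q ^ (1 + l + 2 * k i)] (n - l)) /
         (tpoch q p [:: q] (m - k i - 1) *
          tpoch q p [:: a * q ^ (1 + l + 2 * k i)] (m - k i - 1) *
          tpoch q p [:: a * q ^ (1 + l)] (n - l + idx i)))) *
      (\prod_(i < r)
        ((tpoch q p [:: b * q ^ (1 + n + k i + l + r%:Z)]
            (m - k i - r%:Z - 1 + idx i) *
          tpoch q p [:: b * q ^ (1 + 2 * l)] (2 * n - 2 * l + 2 * idx i)) /
         (tpoch q p [:: b * q ^ (1 + 2 * n + k i)] (m - k i + idx i) *
          tpoch q p [:: b * q ^ (1 + 2 * l + k i)] (2 * n - 2 * l)))) *
      (\prod_(i < r)
        ((tpoch q p [:: a * q ^ (1 + k i - n) / b] (m - k i - idx i - 1) *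
          tpoch q p [:: a * q ^ (1 - n - idx i) / b;
                        a * q ^ (- n - idx i) / b] (n - l + idx i)) /
         (tpoch q p [:: a * q ^ (1 + k i - l) / b] (m - k i - idx i) *
          tpoch q p [:: a * q ^ (1 + k i - n) / b] (n - l) *
          tpoch q p [:: a * q ^ (k i - r%:Z - n) / b] (n - l + r%:Z)))))
  /\
  (* (e): the term - 'C(r, 3) in the exponent of q corrects a misprint in the
     published formula, which is false without it whenever 3 <= r. *)
  (forall (k n m : int) (l : 'I_r -> int),
    weakly_increasing l ->
    (forall i, 0 <= n - l i + m - k) ->
    let u := fun i : 'I_r => (l i, k) in
    let v := fun i : 'I_r => (n + idx i, m - idx i) in
    nonintersecting_gf a b q p u v = path_det a b q p u v /\
    path_det a b q p u v =
      q ^ ((n + r%:Z + k) * 'C(r, 2)%:Z - 'C(r, 3)%:Z + (n + 1) * r%:Z * k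
           - \sum_(i < r) (k + idx i - 1) * l i) *
      (\prod_(i < r) \prod_(j < r | (i < j)%N)
         theta p [:: q ^ (l j - l i); b * q ^ (k + l i + l j)]) *
      (\prod_(i < r)
        ((tpoch q p [:: q ^ (1 + n + r%:Z - l i)] (m - k - r%:Z) *
          tpoch q p [:: a * q ^ (1 + n + 2 * k + idx i)] (m - k - 1) *
          tpoch q p [:: a * q ^ (1 + l i + 2 * k)] (n + idx i - l i)) /
         (tpoch q p [:: q] (m - k - idx i) *
          tpoch q p [:: a * q ^ (1 + l i + 2 * k)] (m - k - 1) *
          tpoch q p [:: a * q ^ (1 + l i)] (n + idx i - l i)))) *
      (\prod_(i < r)
        ((tpoch q p [:: b * q ^ (1 + n + k + r%:Z + l i)] (m - k - r%:Z) *
          tpoch q p [:: b * q ^ (1 + 2 * l i)]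
            (2 * n + 2 * idx i - 2 * l i)) /
         (tpoch q p [:: b * q ^ (1 + 2 * n + k + 2 * idx i)] (m - k - idx i) *
          tpoch q p [:: b * q ^ (1 + k + 2 * l i)]
            (2 * n + 2 * idx i - 2 * l i)))) *
      (\prod_(i < r)
        ((tpoch q p [:: a * q ^ (1 + k - n - idx i) / b] (m - k - 1) *
          tpoch q p [:: a * q ^ (1 - n - idx i) / b;
                        a * q ^ (- n - idx i) / b] (n + idx i - l i)) /
         (tpoch q p [:: a * q ^ (1 + k - l i) / b] (m - k - 1) *
          tpoch q p [:: a * q ^ (1 + k - n - idx i) / b;
                        a * q ^ (k - n - idx i) / b] (n + idx i - l i)))))
  /\
  (* (f) *)
  (forall (k n m : int) (l : 'I_r -> int),
    weakly_increasing l ->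
    0 <= n + m - k ->
    let u := fun i : 'I_r => (l i, k - l i) in
    let v := fun i : 'I_r => (n + idx i, m - idx i) in
    nonintersecting_gf a b q p u v = path_det a b q p u v /\
    path_det a b q p u v =
      q ^ (k * 'C(r.+1, 2)%:Z + r%:Z * n * k
           - \sum_(i < r) (n + k + idx i - l i) * l i) *
      (\prod_(i < r) \prod_(j < r | (i < j)%N)
         theta p [:: q ^ (l j - l i); a * q ^ (k - l i - l j) / b]) *
      (\prod_(i < r)
        ((tpoch q p [:: q ^ (1 + n + r%:Z - l i)]
            (m - k - r%:Z + l i + idx i - 1) *
          tpoch q p [:: a * q ^ (1 + n + 2 * k - 2 * l i)] (m - k + l i) *
          tpoch q p [:: a * q ^ (1 + 2 * k - l i)] (n - l i)) /
         (tpoch q p [:: q] (m - k + l i - 1) *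
          tpoch q p [:: a * q ^ (1 + 2 * k - l i)] (m - k + l i - idx i) *
          tpoch q p [:: a * q ^ (1 + l i)] (n + idx i - l i)))) *
      (\prod_(i < r)
        ((tpoch q p [:: b * q ^ (1 + n + k + idx i)] (m - k + l i - idx i) *
          tpoch q p [:: b * q ^ (1 + 2 * l i)]
            (2 * n + 2 * idx i - 2 * l i)) /
         (tpoch q p [:: b * q ^ (1 + 2 * n + k - l i)] (m - k + l i + idx i) *
          tpoch q p [:: b * q ^ (1 + k + l i)] (2 * n - 2 * l i)))) *
      (\prod_(i < r)
        (tpoch q p [:: a * q ^ (1 + k - n - l i) / b]
           (m - k + l i - idx i - 1) /
         tpoch q p [:: a * q ^ (1 + k - 2 * l i) / b] (m - k + l i - 1))) *
      (\prod_(i < r)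
        (tpoch q p [:: a * q ^ (1 - n - idx i) / b;
                       a * q ^ (- n - idx i) / b] (n + idx i - l i) /
         (tpoch q p [:: a * q ^ (1 + k - n - l i) / b] (n - l i) *
          tpoch q p [:: a * q ^ (k - n - r%:Z - l i) / b]
            (n + r%:Z - l i))))).
Proof.
have th1 : theta1 p 1 = 0.
  have := theta1V R p p_lt1 1 (oner_neq0 _); rewrite invr1 mulr1 => /eqP.
  by rewrite -addr_eq0 -mulr2n mulrn_eq0 => /eqP.
have thV x : x != 0 -> theta1 p x^-1 = - theta1 p x / x by exact: theta1V.
have add := theta_addition R p p_lt1.
have sqrt (c : R[i]) : exists d, d ^+ 2 = c by exists (sqrtC c); rewrite sqrtCK.
split; [|split; [|split; [|split; [|split]]]].
- move=> l k n m mono pos u v; split.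
    by apply: lgv => i j ij; have := mono i j ij; rewrite /northwest /u /v /idx /=; lia.
  exact: (path_det_vertical_ends _ a b q p a_neq0 b_neq0 q_neq0 th1 add sqrt gen r l k n m pos).
- move=> l k m n mono pos u v; split.
    by apply: lgv => i j ij; have := mono i j ij; rewrite /northwest /u /v /idx /=; lia.
  exact: (path_det_horizontal_ends _ a b q p a_neq0 b_neq0 q_neq0 th1 thV add sqrt gen r l k m n pos).
- move=> l k m n mono pos u v; split.
    by apply: lgv => i j ij; have := mono i j ij; rewrite /northwest /u /v /idx /=; lia.
  exact: (path_det_antidiagonal_ends _ a b q p a_neq0 b_neq0 q_neq0 th1 thV add sqrt gen r l k m n pos).
- move=> l n m k mono pos u v; split.
    by apply: lgv => i j ij; have := mono i j ij; rewrite /northwest /u /v /idx /=; lia.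
  exact: (path_det_vertical_starts _ a b q p a_neq0 b_neq0 q_neq0 th1 thV add sqrt gen r l n m k pos).
- move=> k n m l mono pos u v; split.
    by apply: lgv => i j ij; have := mono i j ij; rewrite /northwest /u /v /idx /=; lia.
  exact: (path_det_horizontal_starts _ a b q p a_neq0 b_neq0 q_neq0 th1 thV add sqrt gen r k n m l pos).
- move=> k n m l mono pos u v; split.
    by apply: lgv => i j ij; have := mono i j ij; rewrite /northwest /u /v /idx /=; lia.
  exact: (path_det_antidiagonal_starts _ a b q p a_neq0 b_neq0 q_neq0 th1 thV add sqrt gen r k n m l pos).
Qed.
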